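(* Let $0<|q|<1$, $n\ge2$, $\underline{a}=(a_1,\dots,a_n)\in(q^{\mathbb{Q}})^n$, $\underline{b}=(b_1,\dots,b_n)\in(q^{\mathbb{Q}}\setminus q^{-\mathbb{N}})^n$ with $b_1=q$, $\lambda\in\mathbb{C}^\times$. Assume that the $q$-difference operator $$z\lambda\prod_{i=1}^n(a_i\sigma_q-1)-\prod_{j=1}^n\left(\tfrac{b_j}{q}\sigma_q-1\right)$$ is irreducible and not $q$-Kummer induced. Then ${}_n\Phi_n(\underline{a},\underline{b},\lambda,q;z)$ is $\sigma_{\mathbf{q}}$-transcendental over $\mathbb{C}(z^* )$.
   Context: $\mathbf{q}\in\mathbb{C}^\times$ is a complex number with $|\mathbf{q}|\neq1$ such that $q$ and $\mathbf{q}$ are multiplicatively independent: for $\ell,m\in\mathbb{Z}$, $q^\ell\mathbf{q}^m=1$ implies $\ell=m=0$. Fix a determination $\log q$; for $\alpha\in\mathbb{C}$ put $q^\alpha=e^{\alpha\log q}$, $q^{\mathbb{Q}}=\{q^\alpha:\alpha\in\mathbb{Q}\}$, $q^{-\mathbb{N}}=\{q^{-m}:m\in\mathbb{N}\}$ with $0\in\mathbb{N}$. $\sigma_q(f(z))=f(qz)$. The basic hypergeometric series is the formal power series $${}_n\Phi_n(\underline{a},\underline{b},\lambda,q;z)=\sum_{m\ge0}\frac{\prod_{i=1}^n(1-a_i)(1-a_iq)\cdots(1-a_iq^{m-1})}{\prod_{j=1}^n(1-b_j)(1-b_jq)\cdots(1-b_jq^{m-1})}\lambda^mz^m .$$ The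 operator is irreducible over $\mathbb{C}(z)$ (not a product of operators of lower order) if and only if $a_i\notin b_jq^{\mathbb{Z}}$ for all $i,j\in\{1,\dots,n\}$. It is $q$-Kummer induced if it is irreducible and there exist a divisor $d\ne1$ of $n$ and permutations $\mu,\nu$ of $\{1,\dots,n\}$ such that $a_i\in a_{\mu(i)}q^{1/d}q^{\mathbb{Z}}$ and $b_i\in b_{\nu(i)}q^{1/d}q^{\mathbb{Z}}$ for all $i$. $\mathbb{C}(z^* )=\bigcup_{j\ge1}\mathbb{C}(z^{1/j})\subset\mathbb{C}((z^* ))=\bigcup_{j\ge1}\mathbb{C}((z^{1/j}))$. The automorphism $\sigma_{\mathbf{q}}$ of $\mathbb{C}((z^* ))$ is given by $z^{1/j}\mapsto\mathbf{q}_jz^{1/j}$ for a fixed sequence with $\mathbf{q}_j^j=\mathbf{q}$ and $\mathbf{q}_j^l=\mathbf{q}_k$ if $j=lk$; on power series in $z$ it is $f(z)\mapsto f(\mathbf{q}z)$. An element $f$ is $\sigma_{\mathbf{q}}$-transcendental over $\mathbb{C}(z^* )$ if $f,\sigma_{\mathbf{q}}(f),\sigma_{\mathbf{q}}^2(f),\dots$ are algebraically independent over $\mathbb{C}(z^* )$. *)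

(* Defs.v *)
From HB Require Import structures.
From mathcomp Require Import all_boot all_order all_fingroup all_algebra.
From mathcomp Require Import complex.
From mathcomp Require Import -(notations) mpoly.
From mathcomp Require Import boolp classical_sets functions cardinality fsbigop.
From mathcomp Require Import reals sequences exp trigo.
From mathcomp Require Import ring lra zify.

Set Implicit Arguments.
Unset Strict Implicit.
Unset Printing Implicit Defensive.

Import Order.TTheory GRing.Theory Num.Theory.
Local Open Scope classical_set_scope.
Local Open Scope ring_scope.

Section PuiseuxCarrier.
Variable F : fieldType.

(* Elements of F((z^* )) are encoded by their coefficient functions: f stands
   for the sum of f r z^r over rational r, and f lies in F((z^{1/j})) iff its
   support consists of elements of (1/j)Z bounded from below. *)
Definition puiseux_support (j : nat) (N : int) (f : rat -> F) :=
  forall r, f r != 0 -> (r * j%:R \is a Num.int) /\ N%:~R <= r * j%:R.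

Definition puiseux_pred : {pred rat -> F} :=
  [pred f | `[< exists j N, (0 < j)%N /\ puiseux_support j N f >]].

Record puiseux := Puiseux { pcoef :> rat -> F; _ : pcoef \in puiseux_pred }.

HB.instance Definition _ := [isSub for pcoef].
HB.instance Definition _ := [Choice of puiseux by <:].

Lemma puiseux_predP (f : rat -> F) :
  reflect (exists j N, (0 < j)%N /\ puiseux_support j N f) (f \in puiseux_pred).
Proof. exact: asboolP. Qed.

Lemma puiseux_support_le (l j : nat) (N M : int) f : (0 < l)%N ->
  M <= N * l%:Z -> puiseux_support j N f -> puiseux_support (j * l) M f.
Proof.
move=> l0 MN sf r /sf[rj Nr]; rewrite natrM mulrA; split.
  by rewrite rpredM // pmulrn intr_int.
apply: le_trans (_ : (N * l%:Z)%:~R <= _); first by rewrite ler_int.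
by rewrite intrM ler_wpM2r // ler0n.
Qed.

Lemma puiseux_common (f g : rat -> F) : f \in puiseux_pred ->
  g \in puiseux_pred -> exists j N,
  [/\ (0 < j)%N, puiseux_support j N f & puiseux_support j N g].
Proof.
move=> /puiseux_predP[j [N [j0 fj]]] /puiseux_predP[k [M [k0 gk]]].
exists (j * k)%N, (Num.min (N * k%:Z) (M * j%:Z)); split.
- by rewrite muln_gt0 j0.
- by apply: puiseux_support_le fj => //; rewrite ge_min lexx.
- by rewrite mulnC; apply: puiseux_support_le gk => //; rewrite ge_min lexx orbT.
Qed.

Fact puiseux_zmod_closed : zmod_closed puiseux_pred.
Proof.
split; first by apply/puiseux_predP; exists 1%N, 0; split=> // r; rewrite eqxx.
move=> f g pf pg; have [j [N [j0 fj gj]]] := puiseux_common pf pg.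
apply/puiseux_predP; exists j, N; split=> // r fgr.
have [fr|/fj//] := eqVneq (f r) 0; apply: gj.
apply: contraNneq fgr => gr.
by rewrite -[_ r]/(f r - g r) fr gr subrr.
Qed.
HB.instance Definition _ :=
  GRing.isZmodClosed.Build (rat -> F) puiseux_pred puiseux_zmod_closed.
HB.instance Definition _ := [SubChoice_isSubZmodule of puiseux by <:].

Lemma puiseuxP (f g : puiseux) : (forall r, f r = g r) -> f = g.
Proof. by move=> fg; apply/val_inj/funext. Qed.

Lemma pcoefD (f g : puiseux) r : (f + g) r = f r + g r.
Proof. by []. Qed.
Lemma pcoef0 r : (0 : puiseux) r = 0.
Proof. by []. Qed.

End PuiseuxCarrier.

Section PuiseuxPresentation.
Variable F : fieldType.
Implicit Types (j n : nat) (N M : int) (u v w : nat -> F) (r : rat).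

(* z^{N/j} * (sum over i of u_i z^{i/j}) *)
Definition pser j N u : rat -> F := fun r =>
  let x := r * j%:R - N%:~R in
  if x \is a Num.nat then u (Num.truncn x) else 0.

Lemma pserE j N u n : (0 < j)%N ->
  pser j N u ((N%:~R + n%:R) / j%:R) = u n.
Proof.
move=> j0; rewrite /pser divfK ?pnatr_eq0 -?lt0n //.
by rewrite [_ + n%:R]addrC addrK natr_nat natrK.
Qed.

Lemma pser_neq0 j N u r : (0 < j)%N -> pser j N u r != 0 ->
  exists n, r = (N%:~R + n%:R) / j%:R.
Proof.
rewrite /pser => j0; case: natrP => [[n en] _|_]; last by rewrite eqxx.
exists n; rewrite -en [N%:~R + _]addrC subrK mulfK // pnatr_eq0 -lt0n //.
Qed.

Lemma pser_ext j N u v : u =1 v -> pser j N u = pser j N v.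
Proof. by move=> /funext->. Qed.

Lemma pser_eq j N u (f : rat -> F) : (0 < j)%N ->
  (forall n, f ((N%:~R + n%:R) / j%:R) = u n) ->
  (forall r, f r != 0 -> exists n : nat, r = (N%:~R + n%:R) / j%:R) ->
  f = pser j N u.
Proof.
move=> j0 fu fr; apply/funext => r.
have [f0|/fr[n ->]] := eqVneq (f r) 0; last by rewrite fu pserE.
have [->//|/(pser_neq0 j0)[n en]] := eqVneq (pser j N u r) 0.
by rewrite en pserE // -fu -en.
Qed.

Lemma pser_support j N u : (0 < j)%N -> puiseux_support j N (pser j N u).
Proof.
move=> j0 r /(pser_neq0 j0)[n ->].
rewrite divfK ?pnatr_eq0 -?lt0n // lerDl ler0n; split => //.
by rewrite rpredD ?intr_int // pmulrn intr_int.
Qed.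

Lemma pser_pred j N u : (0 < j)%N -> pser j N u \in @puiseux_pred F.
Proof.
by move=> j0; apply/puiseux_predP; exists j, N; split=> //; apply: pser_support.
Qed.

Lemma supportE j N (f : rat -> F) : (0 < j)%N -> puiseux_support j N f ->
  f = pser j N (fun n => f ((N%:~R + n%:R) / j%:R)).
Proof.
move=> j0 sf; apply: pser_eq => // r /sf[/intrP[m rm]]; rewrite rm ler_int => Nm.
exists `|m - N|%N.
rewrite -[_%:R]/((Posz `|m - N|%N)%:~R) gez0_abs ?subr_ge0 // -intrD.
by rewrite [N + _]addrC subrK -rm mulfK // pnatr_eq0 -lt0n.
Qed.

Definition conv u v n : F := \sum_(i < n.+1) u i * v (n - i)%N.

Lemma convC u v : conv u v =1 conv v u.
Proof.
move=> n; rewrite /conv (reindex_inj rev_ord_inj) /=; apply: eq_bigr => i _.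
by rewrite subSS subKn 1?mulrC // -ltnS.
Qed.

Lemma conv_poly u v n m : (n < m)%N ->
  conv u v n = ((\poly_(i < m) u i) * (\poly_(i < m) v i))`_n.
Proof.
move=> nm; rewrite coefM; apply: eq_bigr => i _; rewrite !coef_poly.
have le_in : (i <= n)%N by rewrite -ltnS.
rewrite (leq_ltn_trans le_in nm).
by rewrite (leq_ltn_trans _ nm) // leq_subr.
Qed.

Lemma convA u v w : conv u (conv v w) =1 conv (conv u v) w.
Proof.
move=> n; set U := \poly_(i < n.+1) u i; set V := \poly_(i < n.+1) v i.
set W := \poly_(i < n.+1) w i.
transitivity (U * V * W)`_n.
  rewrite -mulrA coefM /conv; apply: eq_bigr => i _.
  rewrite coef_poly ltn_ord; congr (_ * _).
  by rewrite -/(conv v w (n - i)) (conv_poly _ _ (m := n.+1)) // ltnS leq_subr.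
rewrite coefM /conv; apply: eq_bigr => i _.
rewrite [W`__]coef_poly ltnS leq_subr; congr (_ * _).
by rewrite -/(conv u v i) (conv_poly _ _ (m := n.+1)).
Qed.

Definition delta n : F := (n == 0)%:R.

Lemma conv1 u : conv delta u =1 u.
Proof.
move=> n; rewrite /conv big_ord_recl /delta mul1r subn0 big1 ?addr0 // => i _.
by rewrite mul0r.
Qed.

Lemma convDl u v w : conv (fun n => u n + v n) w =1
  fun n => conv u w n + conv v w n.
Proof.
by move=> n; rewrite /conv -big_split; apply: eq_bigr => i _; rewrite mulrDl.
Qed.

Fixpoint inv_seq v n : seq F :=
  if n is m.+1 then
    rcons (inv_seq v m)
      ((v 0)^-1 * ((m == 0)%:R - \sum_(i < m) (inv_seq v m)`_i * v (m - i)%N))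
  else [::].
Definition inv_ser v n : F := (inv_seq v n.+1)`_n.

Lemma size_inv_seq v n : size (inv_seq v n) = n.
Proof. by elim: n => //= n IH; rewrite size_rcons IH. Qed.

Lemma nth_inv_seq v n i : (i < n)%N -> (inv_seq v n)`_i = inv_ser v i.
Proof.
elim: n => // n IH; rewrite ltnS leq_eqVlt => /orP[/eqP->//|lin].
by rewrite /= nth_rcons size_inv_seq lin IH.
Qed.

Lemma conv_inv v : v 0 != 0 -> conv (inv_ser v) v =1 delta.
Proof.
move=> v0 n; rewrite /conv big_ord_recr /= subnn.
rewrite [X in _ + X * _]/inv_ser /= nth_rcons size_inv_seq ltnn eqxx.
rewrite mulrAC mulVf // mul1r addrC -[RHS]addr0 /delta -addrA; congr (_ + _).
rewrite addrC; apply/eqP; rewrite subr_eq0; apply/eqP.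
by apply: eq_bigr => i _; rewrite nth_inv_seq.
Qed.

Definition pmulf (f g : rat -> F) : rat -> F := fun r =>
  \sum_(s \in [set: rat]) f s * g (r - s).

Lemma pmulf_pser j N M u v : (0 < j)%N ->
  pmulf (pser j N u) (pser j M v) = pser j (N + M) (conv u v).
Proof.
move=> j0; have jn0 : j%:R != 0 :> rat by rewrite pnatr_eq0 -lt0n.
apply: pser_eq => // [n|r fr].
  set r := (_ / _); pose h (i : nat) : rat := (N%:~R + i%:R) / j%:R.
  have hinj : injective h.
    move=> x y /(mulIf (invr_neq0 jn0)) /addrI /eqP.
    by rewrite eqr_nat => /eqP.
  have rh i : (i <= n)%N -> r - h i = (M%:~R + (n - i)%:R) / j%:R.
    by move=> le_in; rewrite /r /h -mulrBl natrB // intrD; congr (_ / _); ring.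
  rewrite /pmulf (fsbigE (map h (iota 0 n.+1))) //.
  - rewrite big_map -/(index_iota 0 n.+1) big_mkord.
    rewrite (eq_bigl xpredT) => [|i]; last by rewrite in_setT.
    by apply: eq_bigr => i _; rewrite rh -1?ltnS // !pserE.
  - by rewrite map_inj_uniq // iota_uniq.
  - move=> s _ /mapP sh; apply/eqP; rewrite mulf_eq0; apply/norP => -[].
    move=> /(pser_neq0 j0)[i si] /(pser_neq0 j0)[k rk]; apply: sh.
    exists i => //; rewrite mem_iota /= add0n ltnS.
    have : n%:R = (i + k)%:R :> rat.
      move: rk; rewrite si /r -mulrBl => /(mulIf (invr_neq0 jn0)).
      by rewrite intrD natrD => E; lra.
    by move/eqP; rewrite eqr_nat => /eqP->; rewrite leq_addr.
apply: contrapT => nr; move/eqP: fr; apply; apply: fsbig1 => s _.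
apply/eqP; rewrite mulf_eq0; apply/norP => -[].
move=> /(pser_neq0 j0)[i si] /(pser_neq0 j0)[k rk]; apply: nr; exists (i + k)%N.
rewrite -[LHS](subrK s) rk si -mulrDl intrD natrD; congr (_ / _); ring.
Qed.

Lemma pserD j N u v : (0 < j)%N ->
  pser j N (fun n => u n + v n) = pser j N u + pser j N v.
Proof.
move=> j0; apply/funext => r; rewrite /pser -[RHS]/(_ + _) /=.
by case: ifP => // _; rewrite addr0.
Qed.

Lemma pser_neq0_lead j N u : (0 < j)%N -> pser j N u != 0 ->
  exists2 n, u n != 0 & pser j N u = pser j (N + n%:Z) (fun i => u (n + i)%N).
Proof.
move=> j0 fn0; have [n0 un0] : exists n, u n != 0.
  apply: contrapT => nu; move/eqP: fn0; apply; apply/funext => r.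
  rewrite /pser; case: ifP => // _; apply/eqP; apply: contrapT => h.
  by apply: nu; eexists; apply/negP; exact: h.
pose n := ex_minn (ex_intro (fun n => u n != 0) n0 un0).
have [un nmin] : u n != 0 /\ forall i, u i != 0 -> (n <= i)%N.
  by rewrite /n; case: ex_minnP.
exists n => //; apply: pser_eq => // [i|r].
  by rewrite intrD -addrA -natrD pserE.
move=> fr; have [m rm] := pser_neq0 j0 fr.
have nm : (n <= m)%N by apply: nmin; move: fr; rewrite rm pserE.
exists (m - n)%N; rewrite rm natrB // intrD; congr (_ / _).
by rewrite -[n%:~R]/(n%:R : rat); ring.
Qed.

End PuiseuxPresentation.

Section PuiseuxField.
Variable F : fieldType.
Implicit Types f g h : puiseux F.

Lemma pser_rep2 f g : exists j N u v,
  [/\ (0 < j)%N, f = pser j N u :> (rat -> F) & g = pser j N v :> (rat -> F)].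
Proof.
have [j [N [j0 fj gj]]] := puiseux_common (valP f) (valP g).
by exists j, N; do 2![eexists]; split; [|exact: supportE fj|exact: supportE gj].
Qed.

Lemma pser_rep3 f g h : exists j N u v w,
  [/\ (0 < j)%N, f = pser j N u :> (rat -> F), g = pser j N v :> (rat -> F)
    & h = pser j N w :> (rat -> F)].
Proof.
have [j [N [j0 fj gj]]] := puiseux_common (valP f) (valP g).
have /puiseux_predP[k [M [k0 hk]]] := valP h.
pose L := Num.min (N * k%:Z) (M * j%:Z).
exists (j * k)%N, L; do 3![eexists]; split.
- by rewrite muln_gt0 j0.
- apply: supportE; first by rewrite muln_gt0 j0.
  by apply: puiseux_support_le fj => //; rewrite ge_min lexx.
- apply: supportE; first by rewrite muln_gt0 j0.
  by apply: puiseux_support_le gj => //; rewrite ge_min lexx.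
- apply: supportE; first by rewrite muln_gt0 j0.
  rewrite mulnC; apply: puiseux_support_le hk => //.
  by rewrite ge_min lexx orbT.
Qed.

Fact pmul_pred f g : pmulf f g \in @puiseux_pred F.
Proof.
have [j [N [u [v [j0 -> ->]]]]] := pser_rep2 f g.
by rewrite pmulf_pser // pser_pred.
Qed.
Definition pmul f g : puiseux F := Puiseux (pmul_pred f g).

Fact pone_pred : (fun r : rat => (r == 0)%:R) \in @puiseux_pred F.
Proof.
apply/puiseux_predP; exists 1%N, 0; split=> // r.
by have [->|] := eqVneq r 0; rewrite ?eqxx // mul0r rpred0.
Qed.
Definition pone : puiseux F := Puiseux pone_pred.

Lemma poneE j : (0 < j)%N -> pone = pser j 0 (@delta F) :> (rat -> F).
Proof.
move=> j0; apply: pser_eq => // [n|r] /=.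
  by rewrite add0r mulf_eq0 invr_eq0 !pnatr_eq0 (gtn_eqF j0) orbF.
by have [-> _|] := eqVneq r 0; rewrite ?eqxx //; exists 0%N; rewrite addr0 mul0r.
Qed.

Fact pmulA : associative pmul.
Proof.
move=> f g h; apply/val_inj => /=.
have [j [N [u [v [w [j0 -> -> ->]]]]]] := pser_rep3 f g h.
by rewrite !pmulf_pser // addrA; apply/pser_ext/convA.
Qed.

Fact pmulC : commutative pmul.
Proof.
move=> f g; apply/val_inj => /=.
have [j [N [u [v [j0 -> ->]]]]] := pser_rep2 f g.
by rewrite !pmulf_pser //; apply/pser_ext/convC.
Qed.

Fact pmul1 : left_id pone pmul.
Proof.
move=> f; apply/val_inj; rewrite -[LHS]/(pmulf pone f) [RHS]/=.
have [j [N [u [_ [j0 -> _]]]]] := pser_rep2 f f.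
by rewrite (poneE j0) pmulf_pser // add0r; apply/pser_ext/conv1.
Qed.

Fact pmulDl : left_distributive pmul +%R.
Proof.
move=> f g h; apply/val_inj => /=.
have [j [N [u [v [w [j0 -> -> ->]]]]]] := pser_rep3 f g h.
rewrite -pserD // !pmulf_pser // -pserD //; apply/pser_ext/convDl.
Qed.

Fact pone_neq0 : pone != 0.
Proof.
apply/eqP => e; have /eqP : pone 0 = 0 by rewrite e.
by rewrite /= oner_eq0.
Qed.

HB.instance Definition _ := GRing.Zmodule_isComNzRing.Build (puiseux F)
  pmulA pmulC pmul1 pmulDl pone_neq0.

Lemma pcoefM f g r : (f * g) r = \sum_(s \in [set: rat]) f s * g (r - s).
Proof. by []. Qed.

Lemma pcoef1 r : (1 : puiseux F) r = (r == 0)%:R.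
Proof. by []. Qed.

Lemma puiseux_inv_ex f : f != 0 -> exists g, g * f = 1.
Proof.
move=> fn0; have [j [N [u [_ [j0 fE _]]]]] := pser_rep2 f f.
have [|n un fE'] := @pser_neq0_lead F j N u j0.
  by rewrite -fE; apply: contraNneq fn0 => f0; apply/eqP/val_inj.
rewrite -{}fE in fE'; set v := (fun i => _) in fE'.
exists (Puiseux (pser_pred (- (N + n%:Z)) (inv_ser v) j0)).
apply/val_inj; rewrite [LHS]/= -[RHS]/(pcoef pone) (poneE j0) fE'.
rewrite pmulf_pser // addNr.
by apply/pser_ext/conv_inv; rewrite /v addn0.
Qed.

Definition pinv f : puiseux F :=
  if pselect (f != 0) is left fn0 then projT1 (cid (puiseux_inv_ex fn0)) else 0.

Fact pmulVf f : f != 0 -> pinv f * f = 1.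
Proof. by rewrite /pinv; case: pselect => // fn0 _; case: cid. Qed.

Fact pinv0 : pinv 0 = 0.
Proof.
rewrite /pinv; case: pselect => // n0.
by exfalso; move: n0; rewrite eqxx.
Qed.

HB.instance Definition _ :=
  GRing.ComNzRing_isField.Build (puiseux F) pmulVf pinv0.

End PuiseuxField.

Section PuiseuxElements.
Variable F : fieldType.

Lemma absz_denqE (e : rat) : (`|denq e|%N)%:R = (denq e)%:~R :> rat.
Proof. by rewrite -[in RHS]absz_denq. Qed.

Fact pmono_pred (c : F) (e : rat) :
  (fun r => if r == e then c else 0) \in @puiseux_pred F.
Proof.
apply/puiseux_predP; exists `|denq e|%N, (numq e); split; first by rewrite absz_gt0.
move=> r /=; have [->|] := eqVneq r e; last by rewrite eqxx.
by rewrite absz_denqE -numqE intr_int lexx.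
Qed.
Definition pmono c e : puiseux F := Puiseux (pmono_pred c e).

Lemma pmonoM c d e s : pmono c e * pmono d s = pmono (c * d) (e + s).
Proof.
apply: puiseuxP => r; rewrite pcoefM (fsbigE [:: e]) //.
  rewrite big_mkcond big_seq1 in_setT /= eqxx subr_eq [s + e]addrC.
  by case: eqP; rewrite ?mulr0.
by move=> i _; rewrite inE /= => /negPf->; rewrite mul0r.
Qed.

Definition pconst c : puiseux F := pmono c 0.

Fact pconst_zmod : zmod_morphism pconst.
Proof.
move=> c d; apply: puiseuxP => r; rewrite -[RHS]/(pconst c r - pconst d r) /=.
by case: ifP; rewrite ?subr0.
Qed.
HB.instance Definition _ :=
  GRing.isZmodMorphism.Build F (puiseux F) pconst pconst_zmod.

Fact pconst_monoid : monoid_morphism pconst.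
Proof.
split; last by move=> c d; rewrite pmonoM addr0.
by apply: puiseuxP => r; rewrite pcoef1 /=; case: eqP.
Qed.
HB.instance Definition _ :=
  GRing.isMonoidMorphism.Build F (puiseux F) pconst pconst_monoid.

(* zroot j is z^{1/j} (for j > 0) *)
Definition zroot (j : nat) : puiseux F := pmono 1 j%:R^-1.

Lemma zrootX j k : zroot j ^+ k = pmono 1 (k%:R / j%:R).
Proof.
elim: k => [|k IH]; first by rewrite mul0r expr0 -(rmorph1 pconst).
by rewrite exprS IH pmonoM mulr1 -[k.+1]add1n natrD mulrDl mul1r.
Qed.

(* F(z^* ): the elements p(z^{1/j}) / d(z^{1/j}) *)
Definition ratpuiseux : set (puiseux F) := [set f | exists j (p d : {poly F}),
  [/\ (0 < j)%N, d != 0 &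
      f = (map_poly pconst p).[zroot j] / (map_poly pconst d).[zroot j]]].

Definition pseries_fun (u : nat -> F) : rat -> F :=
  fun r => if r \is a Num.nat then u (Num.truncn r) else 0.

Fact pseries_pred u : pseries_fun u \in @puiseux_pred F.
Proof.
apply/puiseux_predP; exists 1%N, 0; split=> // r; rewrite /pseries_fun mulr1.
case: ifP => [rn _|]; last by rewrite eqxx.
by rewrite intr_nat ?natr_ge0.
Qed.

(* the power series with coefficients u, as an element of F((z^* )) *)
Definition pseries u : puiseux F := Puiseux (pseries_pred u).

Definition root_system (Q : F) (Qr : nat -> F) :=
  (forall j, (0 < j)%N -> Qr j ^+ j = Q) /\
  (forall j l k, (0 < j)%N -> j = (l * k)%N -> Qr j ^+ l = Qr k).

(* z^{k/j} is mapped to (Qr j)^k z^{k/j}; for a root system Qr this does not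
   depend on the representation k/j, and the irreducible one is used. *)
Definition psigma_fun (Qr : nat -> F) (f : rat -> F) : rat -> F :=
  fun r => Qr `|denq r|%N ^ numq r * f r.

Fact psigma_pred Qr (f : puiseux F) : psigma_fun Qr f \in @puiseux_pred F.
Proof.
have /puiseux_predP[j [N [j0 fj]]] := valP f.
apply/puiseux_predP; exists j, N; split=> // r.
by rewrite mulf_eq0 negb_or => /andP[_ /fj].
Qed.
Definition psigma Qr (f : puiseux F) : puiseux F :=
  Puiseux (psigma_pred Qr f).

Section RootSystem.
Variables (Q : F) (Qr : nat -> F).
Hypotheses (Q0 : Q != 0) (QrP : root_system Q Qr).

Lemma psigma_coef (f : puiseux F) (j : nat) (k : int) : (0 < j)%N ->
  psigma Qr f (k%:~R / j%:R) = Qr j ^ k * f (k%:~R / j%:R).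
Proof.
move=> j0; rewrite /= /psigma_fun; congr (_ * _).
set r := (_ / _); have [l jl kl] : exists2 l : nat,
    j = (l * `|denq r|)%N & k = l%:Z * numq r.
  have e : numq r * j%:Z = k * denq r.
    apply/eqP; rewrite -(eqr_int rat) !intrM numqE mulrAC divfK //.
    by rewrite pnatr_eq0 -lt0n.
  have cop := coprime_num_den r.
  have /dvdnP[l jl] : (`|denq r| %| j)%N.
    rewrite -(Gauss_dvdr _ (m := `|denq r|) (n := `|numq r|)); last first.
      by rewrite coprime_sym.
    by rewrite -[X in (_ * X)%N]/(`|j%:Z|%N) -abszM e abszM dvdn_mull.
  exists l => //; apply: (mulIf (denq_neq0 r)).
  by rewrite -e jl PoszM absz_denq mulrCA mulrA.
rewrite -/r [in RHS]kl -exprz_exp -[Qr j ^ l%:Z]/(Qr j ^+ l).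
by case: QrP => _ /(_ j l _ j0 jl) ->.
Qed.

Lemma psigma_series u : psigma Qr (pseries u) = pseries (fun m => Q ^+ m * u m).
Proof.
apply: puiseuxP => r; have [/natrP[m ->]|rn] := boolP (r \is a Num.nat).
  have e : m%:R = m%:Z%:~R / 1%:R :> rat by rewrite divr1.
  rewrite [in LHS]e psigma_coef // -e /= /pseries_fun natr_nat natrK.
  by case: QrP => /(_ 1%N isT) <-.
by rewrite /= /psigma_fun /pseries_fun (negPf rn) mulr0.
Qed.

Lemma psigma_zroot j : (0 < j)%N ->
  psigma Qr (zroot j) = pconst (Qr j) * zroot j.
Proof.
move=> j0; rewrite pmonoM add0r mulr1; apply: puiseuxP => r.
have [->|rj] := eqVneq r j%:R^-1; last by rewrite /= /psigma_fun (negPf rj) mulr0.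
have e : j%:R^-1 = 1%:~R / j%:R :> rat by rewrite mul1r.
by rewrite [in LHS]e psigma_coef // -e /= eqxx mulr1 expr1z.
Qed.

Lemma rat_common (r s : rat) : exists (j : nat) (k l : int),
  [/\ (0 < j)%N, r = k%:~R / j%:R & s = l%:~R / j%:R].
Proof.
exists (`|denq r| * `|denq s|)%N, (numq r * denq s), (numq s * denq r).
split; first by rewrite muln_gt0 !absz_gt0 !denq_neq0.
- rewrite natrM !absz_denqE intrM invfM mulrACA divff ?mulr1 ?divq_num_den //.
  by rewrite intr_eq0 denq_neq0.
- rewrite natrM !absz_denqE intrM invfM [_^-1 * _]mulrC mulrACA.
  by rewrite divff ?mulr1 ?divq_num_den // intr_eq0 denq_neq0.
Qed.

Lemma psigma_monoid : monoid_morphism (psigma Qr).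
Proof.
split.
  apply: puiseuxP => r; rewrite pcoef1.
  have -> : psigma Qr 1 r = Qr `|denq r|%N ^ numq r * (r == 0)%:R by [].
  have n0 : numq 0 = 0 by apply/eqP; rewrite numq_eq0.
  have [->|r0] := eqVneq r 0; last by rewrite mulr0.
  by rewrite n0 expr0z; exact: mul1r.
move=> f g; apply: puiseuxP => r; rewrite [LHS]/= /psigma_fun !pcoefM.
rewrite mulr_fsumr; apply: eq_fsbigr => s _.
have [j [k [l [j0 -> ->]]]] := rat_common r s.
have Qj0 : Qr j != 0.
  case: QrP => /(_ j j0) Qj _; apply: contraNneq Q0 => e.
  by rewrite -Qj e expr0n (gtn_eqF j0).
pose one := 1 : puiseux F.
have chi (m : int) : Qr `|denq (m%:~R / j%:R)|%N ^ numq (m%:~R / j%:R) = Qr j ^ m.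
  have := psigma_coef (pmono 1 (m%:~R / j%:R)) m j0.
  by rewrite /= /psigma_fun eqxx !mulr1.
rewrite -mulrBl -intrB /= /psigma_fun !chi mulrACA -expfzDr //.
by rewrite [l + _]addrC subrK.
Qed.

End RootSystem.

End PuiseuxElements.

(* x_0, x_1, x_2, etc. are algebraically independent over the subfield S *)
Definition alg_independent (K : fieldType) (S : set K) (x : nat -> K) :=
  forall (k : nat) (P : mpoly k K),
    (forall m, S (mcoeff m P)) ->
    meval (fun i : 'I_k => x i) P = 0 -> P = 0.

Definition sigma_transcendental (F : fieldType) (Qr : nat -> F)
    (f : puiseux F) :=
  alg_independent (@ratpuiseux F) (fun i => iter i (psigma Qr) f).

Notation "{ 'ratfun' F }" := {fraction {poly F}} (format "{ 'ratfun'  F }").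

Local Notation "x %:F" := (tofrac x).

Section QDifferenceOperators.
Variables (F : fieldType) (q : F).

(* f(z) |-> f(qz) on F(z) *)
Definition ratshift (f : {ratfun F}) : {ratfun F} :=
  (\n_(generic_quotient.repr f) \Po (q *: 'X))%:F / (\d_(generic_quotient.repr f) \Po (q *: 'X))%:F.

Lemma fracE (f : {ratfun F}) :
  f = (\n_(generic_quotient.repr f))%:F / (\d_(generic_quotient.repr f))%:F.
Proof.
rewrite -[LHS](generic_quotient.reprK f); move: (generic_quotient.repr f) => x.
have x0 := denom_ratioP x; unlock FracField.tofrac.
rewrite -[X in _ = _ * X]FracField.pi_inv -[RHS]FracField.pi_mul.
rewrite /FracField.invf /FracField.mulf !numden_Ratio ?oner_neq0 //.
by rewrite mulr1 mul1r Ratio_numden.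
Qed.

Lemma ratshiftE (p d : {poly F}) : q != 0 -> d != 0 ->
  ratshift (p%:F / d%:F) = (p \Po (q *: 'X))%:F / (d \Po (q *: 'X))%:F.
Proof.
move=> q0 d0; have s2 : size (q *: 'X : {poly F}) = 2%N.
  by rewrite size_scale // size_polyX.
have cmp0 (e : {poly F}) : e != 0 -> (e \Po (q *: 'X))%:F != 0.
  move=> e0; rewrite tofrac_eq0 -size_poly_eq0 size_comp_poly2 //.
  by rewrite size_poly_eq0.
rewrite /ratshift; have := fracE (p%:F / d%:F).
move: (generic_quotient.repr _) => x; have := denom_ratioP x.
move: (\n_x) (\d_x) => m e e0 /eqP.
have dF : d%:F != 0 by rewrite tofrac_eq0.
have eF : e%:F != 0 by rewrite tofrac_eq0.
rewrite (eqr_div _ _ dF eF) -!tofracM tofrac_eq => /eqP pe.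
apply/eqP; rewrite (eqr_div _ _ (cmp0 _ e0) (cmp0 _ d0)) -!tofracM -!comp_polyM.
by rewrite pe.
Qed.

(* An operator \sum_i c_i sigma_q^i is encoded by the polynomial
   \sum_i c_i 'X^i; opmul is the composition of operators, for which
   sigma_q c = ratshift c sigma_q, and size A is the order of A plus one. *)
Definition opmul (A B : {poly {ratfun F}}) : {poly {ratfun F}} :=
  \sum_(i < size A) \sum_(j < size B) (A`_i * iter i ratshift B`_j) *: 'X^(i + j).

Definition op_irreducible (A : {poly {ratfun F}}) :=
  ~ exists B C, [/\ A = opmul B C, (size B < size A)%N & (size C < size A)%N].

(* c sigma_q - 1 *)
Definition op_factor (c : F) : {poly {ratfun F}} := (c%:P)%:F *: 'X - 1.

Definition hyper_op n (a b : 'I_n -> F) (lambda : F) : {poly {ratfun F}} :=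
  ((lambda *: 'X)%:F *: \big[opmul/1]_(i < n) op_factor (a i))
  - \big[opmul/1]_(j < n) op_factor (b j / q).

Definition qpochhammer (a : F) (m : nat) : F := \prod_(k < m) (1 - a * q ^+ k).

Definition hyper_series n (a b : 'I_n -> F) (lambda : F) : puiseux F :=
  pseries (fun m => (\prod_(i < n) qpochhammer (a i) m)
                    / (\prod_(j < n) qpochhammer (b j) m) * lambda ^+ m).

End QDifferenceOperators.

Section QPowers.
Variable R : realType.
Local Open Scope complex_scope.

Definition cexp (x : R[i]) : R[i] :=
  (expR (complex.Re x) * cos (complex.Im x)) +i* (expR (complex.Re x) * sin (complex.Im x)).

Lemma cexpD x y : cexp (x + y) = cexp x * cexp y.
Proof.
case: x y => [a b] [c d]; rewrite /cexp /= expRD cosD sinD.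
by simpc; congr (_ +i* _); ring.
Qed.

(* q^alpha, for a determination logq of the logarithm of q *)
Definition qpow (logq alpha : R[i]) : R[i] := cexp (alpha * logq).

Definition qpow_rat (logq : R[i]) : set R[i] :=
  [set qpow logq (ratr alpha) | alpha in [set: rat]].

Definition kummer_shift (q logq : R[i]) (n d : nat) (a : 'I_n -> R[i]) :=
  exists mu : 'S_n, forall i, exists k : int,
    a i = a (mu i) * qpow logq d%:R^-1 * q ^ k.

Definition q_kummer_induced (q logq : R[i]) (n : nat) (a b : 'I_n -> R[i])
    (lambda : R[i]) :=
  op_irreducible q (hyper_op q a b lambda) /\
  exists d, [/\ (d %| n)%N, d <> 1%N, kummer_shift q logq d a
    & kummer_shift q logq d b].

End QPowers.

(* Main.v *)
(** The coefficients of the series are lambda^m times a quotient of q-Pochhammer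
    products, so f = sum c_m z^m converges near 0, and its q-difference equation
    extends it to a function phi on C which is continuous off the spiral
    lambda^-1 q^-N and has at most simple poles there.  The polar parts R_K
    satisfy a recurrence.  R_0 is nonzero, being the limit of c_m / lambda^m; if
    n consecutive R_K vanished, the R_K would be finitely many and
    sum R_K / (1 - lambda q^K z) would be a rational solution, against
    irreducibility.

    Suppose that f(z), ..., f(Q^(k-1) z) are algebraically independent over
    C(z^* ), and that F(f(z), ..., f(Q^k z)) = 0 with leading coefficient F_d in the
    last variable.  The poles of f(Q^k z) lie on the spiral z_K = Q^-k q^-K / lambda,
    where the f(Q^i z), i < k, are regular because q and Q are multiplicatively
    independent; letting z tend to z_K gives F_d(f(z_K), ..., f(Q^(k-1) z_K)) = 0
    whenever R_K <> 0.  Hence the product of the q-shifts of F_d by 0, ..., n-1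
    vanishes at z_K for all large K.  Along the spiral the values f(Q^i q^j z_K)
    obey an invertible linear recurrence with coefficients rational in q^K, and a
    polynomial relation holding for all large K holds for all K in Z, because the
    relations of bounded degree form a finitely generated module stable under the
    shift.  As K tends to -oo the z_K tend to 0, so F_d(f(z), ...) has zeros
    accumulating at 0 and vanishes: a contradiction. *)
Require Import Defs.
From mathcomp Require Import all_boot all_order all_algebra complex.
From mathcomp Require Import -(notations) mpoly.
From mathcomp Require Import boolp classical_sets reals.
From mathcomp Require exp trigo.
From mathcomp Require Import ring lra zify.

Set Implicit Arguments.
Unset Strict Implicit.
Unset Printing Implicit Defensive.

Import Order.TTheory GRing.Theory Num.Theory.
Local Open Scope ring_scope.

(** * Rational solutions and factorizations of the operator *)

Section Charpoly.
Variable F : fieldType.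

(** The symbol of a product of factors c_i sigma_q - 1. Since sigma_q multiplies z^m by q^m,
    coefficient recurrences are read off from its values at powers of q. *)
Definition charpoly n (c : 'I_n -> F) : {poly F} := \prod_i (c i *: 'X - 1).

Lemma horner_charpoly n (c : 'I_n -> F) z : (charpoly c).[z] = \prod_i (c i * z - 1).
Proof. by rewrite horner_prod; apply: eq_bigr => i _; rewrite !hornerE. Qed.

Lemma coef0_charpoly n (c : 'I_n -> F) : (charpoly c)`_0 = (-1) ^+ n.
Proof.
rewrite -horner_coef0 horner_charpoly -[X in _ ^+ X](card_ord n) -prodr_const.
by apply: eq_bigr => i _; rewrite mulr0 sub0r.
Qed.

Lemma size_charpoly n (c : 'I_n -> F) : (forall i, c i != 0) ->
  size (charpoly c) = n.+1.
Proof.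
move=> c0; have sz i : size (c i *: 'X - 1 : {poly F}) = 2%N.
  by rewrite size_addl ?size_scale ?size_polyX // size_opp size_poly1.
rewrite size_prod; last by move=> i _; rewrite -size_poly_gt0 sz.
by under eq_bigr do rewrite sz; rewrite sum_nat_const cardT size_enum_ord; lia.
Qed.

Lemma lead_coef_charpoly n (c : 'I_n -> F) : (forall i, c i != 0) ->
  (charpoly c)`_n = \prod_i c i.
Proof.
move=> c0; rewrite -[X in _`_X]/(n.+1.-1) -(size_charpoly c0) -lead_coefE lead_coef_prod.
apply: eq_bigr => i _; rewrite lead_coefDl ?lead_coefZ ?lead_coefX ?mulr1 //.
by rewrite size_opp size_poly1 size_scale // size_polyX.
Qed.

End Charpoly.

Section Operators.
Variables (F : fieldType) (q : F).
Hypothesis q0 : q != 0.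
Local Notation "x %:F" := (@tofrac {poly F} x).
Local Notation cst c := ((c%:P)%:F).
Local Notation sh := (ratshift q).

Lemma fracP (x : {ratfun F}) : exists p d, d != 0 /\ x = p%:F / d%:F.
Proof.
by do 2!eexists; split; last exact: fracE; exact: denom_ratioP.
Qed.

Lemma comp_scaleX_neq0 (d : {poly F}) : d != 0 -> d \Po (q *: 'X) != 0.
Proof.
move=> d0; rewrite -size_poly_eq0 size_comp_poly2 ?size_poly_eq0 //.
by rewrite size_scale // size_polyX.
Qed.

Lemma ratshift_poly (p : {poly F}) : sh p%:F = (p \Po (q *: 'X))%:F.
Proof.
have := @ratshiftE F q p 1 q0 (oner_neq0 _).
by rewrite -[1 \Po _]/(1%:P \Po _) comp_polyC !tofrac1 !divr1.
Qed.

Lemma ratshift_cst c : sh (cst c) = cst c.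
Proof. by rewrite ratshift_poly comp_polyC. Qed.

Lemma ratshiftM x y : sh (x * y) = sh x * sh y.
Proof.
have [p [d [d0 ->]]] := fracP x; have [p' [d' [d'0 ->]]] := fracP y.
rewrite mulf_div -!tofracM !ratshiftE ?mulf_neq0 // mulf_div -!tofracM.
by rewrite !comp_polyM.
Qed.

Lemma ratshiftD x y : sh (x + y) = sh x + sh y.
Proof.
have [p [d [d0 ->]]] := fracP x; have [p' [d' [d'0 ->]]] := fracP y.
rewrite addf_div ?tofrac_eq0 // -!tofracM -tofracD !ratshiftE ?mulf_neq0 //.
rewrite addf_div ?tofrac_eq0 ?comp_scaleX_neq0 // -!tofracM -tofracD.
by rewrite !comp_polyM comp_polyD !comp_polyM.
Qed.

Lemma ratshift0 : sh 0 = 0.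
Proof. by rewrite -tofrac0 ratshift_poly comp_poly0. Qed.

Lemma iter_ratshift_cst l c : iter l sh (cst c) = cst c.
Proof. by elim: l => //= l ->; rewrite ratshift_cst. Qed.

Lemma iter_ratshiftM l x y : iter l sh (x * y) = iter l sh x * iter l sh y.
Proof. by elim: l => //= l ->; rewrite ratshiftM. Qed.

Lemma iter_ratshiftD l x y : iter l sh (x + y) = iter l sh x + iter l sh y.
Proof. by elim: l => //= l ->; rewrite ratshiftD. Qed.

Lemma iter_ratshift0 l : iter l sh 0 = 0.
Proof. by elim: l => //= l ->; rewrite ratshift0. Qed.

Lemma iter_ratshift_sum l (I : Type) (r : seq I) (f : I -> {ratfun F}) :
  iter l sh (\sum_(i <- r) f i) = \sum_(i <- r) iter l sh (f i).
Proof. exact: (big_morph _ (iter_ratshiftD l) (iter_ratshift0 l)). Qed.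

Lemma iter_ratshift_neq0 l x : x != 0 -> iter l sh x != 0.
Proof.
move=> x0; have : iter l sh x * iter l sh x^-1 = 1.
  by rewrite -iter_ratshiftM divff // -tofrac1 iter_ratshift_cst.
by move=> e; apply: contra_eq_neq e => ->; rewrite mul0r eq_sym oner_neq0.
Qed.

Lemma iter_ratshiftV l x : iter l sh x^-1 = (iter l sh x)^-1.
Proof.
have [->|x0] := eqVneq x 0; first by rewrite invr0 iter_ratshift0 invr0.
apply: (mulfI (iter_ratshift_neq0 l x0)).
rewrite -iter_ratshiftM !divff ?iter_ratshift_neq0 //.
by rewrite -tofrac1 iter_ratshift_cst.
Qed.

Let telescope_aux (K : fieldType) (c s x y : K) : x != 0 -> y != 0 ->
  c = - s / x - (- (s + c * x) / y) * (y / x).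
Proof. by move=> x0 y0; field; rewrite x0 y0. Qed.

Let telescope_aux0 (K : fieldType) (c x y : K) : x != 0 -> y != 0 ->
  c = - (- (c * x) / y * (y / x)).
Proof. by move=> x0 y0; field; rewrite x0 y0. Qed.

(* A rational solution u gives the right factor sigma_q - u(qz)/u(z). *)
Lemma op_right_factor (L : {poly {ratfun F}}) m (u : {ratfun F}) : (2 <= m)%N ->
  size L = m.+1 -> u != 0 -> \sum_(l < m.+1) L`_l * iter l sh u = 0 ->
  ~ op_irreducible q L.
Proof.
move=> m2 sL u0 Lu; apply.
pose g : {ratfun F} := sh u / u.
(* Right division by sigma_q - g requires L_(l+1) = b_l - b_(l+1) g(q^(l+1) z), which the partial
   sums of L u solve. The division is exact because the full sum is 0, so that b_m vanishes. *)
pose s l : {ratfun F} := \sum_(j < l) L`_j * iter j sh u.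
pose b l : {ratfun F} := - s l.+1 / iter l.+1 sh u.
pose B := \poly_(l < m) b l; pose C : {poly {ratfun F}} := 'X - g%:P.
have un l := iter_ratshift_neq0 l u0.
have sC : size C = 2%N by rewrite /C size_XsubC.
exists B, C; split; last 2 first.
- by rewrite sL ltnS size_poly.
- by rewrite sL sC.
have gE l : iter l sh g = iter l.+1 sh u / iter l sh u.
  by rewrite /g iter_ratshiftM iter_ratshiftV -iterSr.
have Lb l : (l < m)%N -> L`_l.+1 = b l - (if (l.+1 < m)%N then b l.+1 * iter l.+1 sh g else 0).
  move=> lm; have -> : (if (l.+1 < m)%N then b l.+1 * iter l.+1 sh g else 0) =
      b l.+1 * iter l.+1 sh g.
    case: ltnP => // ml; have -> : l.+1 = m by apply/eqP; rewrite eqn_leq lm ml.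
    by rewrite /b [s m.+1]Lu oppr0 !mul0r.
  have sS : s l.+2 = s l.+1 + L`_l.+1 * iter l.+1 sh u by rewrite /s big_ord_recr.
  rewrite gE /b sS; apply: telescope_aux; exact: un.
have L0 : L`_0 = - (b 0%N * g).
  have s1 : s 1%N = L`_0 * u by rewrite /s big_ord1.
  by rewrite /b s1 /g; apply: telescope_aux0; [exact: u0 | exact: (un 1%N)].
have BC : opmul q B C = \sum_(i < m)
      ((- (b i * iter i sh g)) *: 'X^i + b i *: 'X^(i.+1) : {poly {ratfun F}}).
  pose G i : {poly {ratfun F}} :=
    (- (B`_i * iter i sh g)) *: 'X^i + B`_i *: 'X^(i.+1).
  rewrite (eq_bigr (fun i : 'I_m => G i)); last first.
    by move=> i _; rewrite /G coef_poly ltn_ord.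
  have -> : opmul q B C = \sum_(i < size B) G i.
    rewrite /opmul sC; apply: eq_bigr => i _.
    rewrite !big_ord_recl big_ord0 addr0 /= /bump /= !addn0 addn1.
    rewrite /C !coefB !coefX !coefC /= sub0r subr0.
    have -> : iter i sh 1 = 1 by rewrite -tofrac1 iter_ratshift_cst.
    have -> : iter i sh (- g) = - iter i sh g.
      have e : iter i sh (- g) + iter i sh g = 0.
        by rewrite -iter_ratshiftD addNr iter_ratshift0.
      by apply/eqP; rewrite -addr_eq0; apply/eqP.
    by rewrite mulrN mulr1.
  rewrite (big_ord_widen m G) ?size_poly // big_mkcond.
  apply: eq_bigr => i _; case: ltnP => // iB.
  by rewrite /G (nth_default _ iB) mul0r oppr0 !scale0r addr0.
rewrite BC big_split /= -[LHS]coefK sL poly_def big_ord_recl L0 expr0.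
case: m m2 {sL Lu B BC} Lb => // m _ Lb.
rewrite [X in _ = X + _]big_ord_recl expr0 -addrA; congr (_ + _).
rewrite [in LHS]big_ord_recr /= [in RHS]addrC [X in _ = X + _]big_ord_recr /=.
rewrite Lb // ltnn subr0 addrAC -big_split /=; congr (_ + _).
apply: eq_bigr => i _; rewrite /bump /= add1n Lb; last by rewrite ltnS ltnW.
by rewrite ltnS ltn_ord scalerBl scaleNr.
Qed.

Local Notation emb := (map_poly (@tofrac {poly F} \o polyC)).

(** Constants are fixed by sigma_q, so operators with constant coefficients compose like commuting
    polynomials. *)
Lemma opmul_emb (p r : {poly F}) : opmul q (emb p) (emb r) = emb (p * r).
Proof.
rewrite rmorphM /= -[X in _ = X * _]coefK -[X in _ = _ * X]coefK !poly_def mulr_suml.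
apply: eq_bigr => i _; rewrite mulr_sumr; apply: eq_bigr => j _.
by rewrite !coef_map /= iter_ratshift_cst -scalerAl -scalerAr scalerA exprD.
Qed.

Lemma op_factor_emb c : op_factor c = emb (c *: 'X - 1).
Proof. by rewrite rmorphB rmorph1 /= map_polyZ map_polyX. Qed.

Lemma hyper_opE n (a b : 'I_n -> F) lambda :
  hyper_op q a b lambda =
  (lambda *: 'X)%:F *: emb (charpoly a) - emb (charpoly (fun j => b j / q)).
Proof.
have e1 : emb 1 = 1 by rewrite rmorph1.
have em p r : emb (p * r) = opmul q (emb p) (emb r) by rewrite opmul_emb.
rewrite /hyper_op /charpoly; congr (_ *: _ - _); rewrite (big_morph _ em e1);
  by apply: eq_bigr => i _; rewrite op_factor_emb.
Qed.

Definition opapp n (al : {poly F}) u := \sum_(l < n.+1) cst al`_l * iter l sh u.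

Lemma hyper_op_reducible n (a b : 'I_n -> F) lambda u : (2 <= n)%N ->
  lambda != 0 -> (forall i, a i != 0) -> (forall j, b j != 0) -> u != 0 ->
  (lambda *: 'X)%:F * opapp n (charpoly a) u =
    opapp n (charpoly (fun j => b j / q)) u ->
  ~ op_irreducible q (hyper_op q a b lambda).
Proof.
move=> n2 l0 a0 b0 u0 Lu; set al := charpoly _ in Lu; set be := charpoly _ in Lu.
have sal : size al = n.+1 by apply: size_charpoly.
have sbe : size be = n.+1.
  by apply: size_charpoly => j; rewrite mulf_neq0 ?invr_eq0.
have cE l : (hyper_op q a b lambda)`_l = (lambda *: 'X)%:F * cst al`_l - cst be`_l.
  by rewrite hyper_opE coefB coefZ !coef_map.
apply: (op_right_factor n2 _ u0).
  apply/eqP; rewrite eqn_leq; apply/andP; split.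
    apply/leq_sizeP => j nj; rewrite cE !nth_default ?sal ?sbe //.
    by rewrite tofrac0 mulr0 subr0.
  (* The order is exactly n: the coefficient of sigma_q^n is a polynomial in z whose term of degree
     1 is lambda times the leading coefficient of [al]. *)
  rewrite ltnNge; apply/negP => /leq_sizeP/(_ n (leqnn n)); rewrite cE.
  rewrite -tofracM -tofracB => /eqP; rewrite tofrac_eq0 => /eqP/polyP/(_ 1%N).
  rewrite coefB coefMC coefZ coefX coefC /= mulr1 subr0 coef0 => /eqP.
  by rewrite mulf_eq0 (negPf l0) -[n]/(n.+1.-1) -sal -lead_coefE lead_coef_eq0
     -size_poly_eq0 sal.
under eq_bigr do rewrite cE mulrBl -mulrA.
by rewrite sumrB -mulr_sumr -[X in _ * X]/(opapp n al u) Lu subrr.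
Qed.

Lemma comp_scaleX (c : F) (p : {poly F}) m : (p \Po (c *: 'X))`_m = c ^+ m * p`_m.
Proof.
rewrite comp_polyE (eq_bigr (fun i : 'I_(size p) => (p`_i * c ^+ i) *: 'X^i)).
  rewrite -(poly_def (size p) (fun i => p`_i * c ^+ i)) coef_poly.
  by case: ltnP => [_|mp]; rewrite 1?mulrC // nth_default ?mul0r.
by move=> i _; rewrite exprZn scalerA.
Qed.

(** Monomials are eigenvectors: sigma_q^l z^m = q^(l m) z^m. *)
Lemma opapp_poly n (al p : {poly F}) : (size al <= n.+1)%N ->
  opapp n al p%:F = (\poly_(m < size p) (al.[q ^+ m] * p`_m))%:F.
Proof.
move=> sal; have shE l : iter l sh p%:F = (p \Po (q ^+ l *: 'X))%:F.
  elim: l => [|l /= ->]; first by rewrite expr0 scale1r comp_polyXr.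
  by rewrite ratshift_poly -comp_polyA comp_polyZ comp_polyX scalerA -exprSr.
rewrite /opapp; under eq_bigr do rewrite shE -tofracM.
rewrite -(raddf_sum (@tofrac {poly F})); congr (_%:F); apply/polyP => m.
rewrite coef_sum coef_poly (horner_coef_wide _ sal) mulr_suml.
under eq_bigr do rewrite coefCM comp_scaleX.
case: ltnP => [mp|mp]; last first.
  by apply: big1 => l _; rewrite (nth_default _ mp) !mulr0.
by apply: eq_bigr => l _; rewrite mulrA -!exprM mulnC.
Qed.

Variables (n : nat) (a b : 'I_n -> F) (lambda : F).
Hypotheses (n2 : (2 <= n)%N) (l0 : lambda != 0) (a0 : forall i, a i != 0)
  (b0 : forall j, b j != 0) (irr : op_irreducible q (hyper_op q a b lambda)).

Local Notation al := (charpoly a).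
Local Notation be := (charpoly (fun j => b j / q)).

Let sal : size al = n.+1. Proof. exact: size_charpoly. Qed.
Let sbe : size be = n.+1.
Proof. by apply: size_charpoly => j; rewrite mulf_neq0 ?invr_eq0. Qed.

(** If the value at q^M were 0, the recurrence would make the truncation of the series after z^M a
    polynomial solution, and the operator would be reducible. *)
Lemma irreducible_nonterminating (c : nat -> F) M :
  c 0%N != 0 -> be.[1] = 0 ->
  (forall m, be.[q ^+ m.+1] * c m.+1 = lambda * al.[q ^+ m] * c m) ->
  al.[q ^+ M] != 0.
Proof.
move=> c0 be1 crec; apply/eqP => alM.
pose p := \poly_(m < M.+1) c m.
have p0 : p != 0.
  by apply: contraNneq c0 => /polyP/(_ 0%N); rewrite coef_poly coef0 /= => ->.
apply: (hyper_op_reducible n2 l0 a0 b0 (u := p%:F) _ _ irr).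
  by rewrite tofrac_eq0.
rewrite -/al -/be !opapp_poly ?sal ?sbe // -tofracM; congr (_%:F).
apply/polyP => m; rewrite -scalerAl coefZ coefXM !coef_poly.
(* Some c_k with k <= M may be 0 a priori, so the degree of [p] may be below M. *)
have pz k : (size p <= k)%N -> (k <= M)%N -> c k = 0.
  by move=> pk kM; rewrite -(nth_default 0 pk) coef_poly ltnS kM.
case: m => [|m] /=; first by rewrite expr0 be1 mul0r mulr0 if_same.
have szp k : (k < size p)%N -> (k <= M)%N.
  by move=> /leq_trans -/(_ _ (size_poly _ _)).
have e1 : (if (m < size p)%N then al.[q ^+ m] * (if (m < M.+1)%N then c m else 0) else 0)
   = if (m < M)%N then al.[q ^+ m] * c m else 0.
  case: (ltnP m (size p)) => [mp|mp].
    have mM := szp _ mp; rewrite ltnS mM; case: ltnP => // Mm.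
    have -> : m = M by lia.
    by rewrite alM mul0r.
  case: ltnP => // mM; have -> : c m = 0 by apply: pz; rewrite // ltnW.
  by rewrite mulr0.
rewrite e1; case: ltnP => mM; last first.
  rewrite mulr0; case: ltnP => // /szp; lia.
rewrite ltnS mM; case: ltnP => [_|mp]; first by rewrite crec; ring.
by rewrite mulrA -crec pz // mulr0.
Qed.

(* The rational solution is the sum of the D_K/(1 - lambda q^K z). *)
Lemma irreducible_no_poly (D : {poly F}) : (forall k, q ^+ k.+1 != 1) ->
  D`_0 != 0 -> be.[1] = 0 -> al * D = (be * D) \Po (q *: 'X) -> False.
Proof.
move=> q1 D0 be1 aD.
pose d K : {poly F} := 1 - (lambda * q ^+ K) *: 'X.
pose e K : {ratfun F} := (d K)%:F^-1; pose M := (n + size D)%N.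
have d0 K : d K != 0.
  apply/eqP => /polyP/(_ 0%N); rewrite coefB coefZ coefX coef1 coef0 mulr0 subr0.
  by move/eqP; rewrite oner_eq0.
have dF K : (d K)%:F != 0 by rewrite tofrac_eq0.
have she K : sh (e K) = e K.+1.
  rewrite /e -[sh _]/(iter 1 sh _) iter_ratshiftV /= ratshift_poly; congr (_%:F^-1).
  rewrite /d comp_polyB comp_polyZ comp_polyX -[1 \Po _]/(1%:P \Po _) comp_polyC.
  by rewrite scalerA -mulrA -exprSr.
(* As sigma_q sends e_K to e_(K+1), [E] turns multiplication by X into sigma_q. The bound M leaves
   room for n shifts of D. *)
pose E (P : {poly F}) : {ratfun F} := \sum_(K < M.+1) cst P`_K * e K.
have E_X (P : {poly F}) : (size P <= M)%N -> sh (E P) = E ('X * P).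
  move=> sP; rewrite /E big_ord_recr big_ord_recl /=.
  rewrite (nth_default _ sP) tofrac0 mul0r addr0.
  rewrite coefXM eqxx tofrac0 mul0r add0r -[sh _]/(iter 1 sh _) iter_ratshift_sum.
  apply: eq_bigr => K _; rewrite iter_ratshiftM iter_ratshift_cst /= she.
  by rewrite coefXM.
have E_Xn l : (l <= n)%N -> iter l sh (E D) = E ('X^l * D).
  elim: l => [|l IH] ln; first by rewrite expr0 mul1r.
  rewrite iterS IH ?(ltnW ln) // E_X ?exprS ?mulrA //.
  have [->|Dn0] := eqVneq D 0; first by rewrite mulr0 size_poly0.
  by rewrite size_monicM ?monicXn // size_polyXn /M; lia.
have E_lin (I : Type) (r : seq I) (f : I -> F) (P : I -> {poly F}) :
    E (\sum_(i <- r) f i *: P i) = \sum_(i <- r) cst (f i) * E (P i).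
  rewrite /E; under [RHS]eq_bigr do rewrite mulr_sumr.
  rewrite exchange_big; apply: eq_bigr => K _; rewrite coef_sum.
  rewrite raddf_sum (raddf_sum (@tofrac {poly F})) mulr_suml.
  by apply: eq_bigr => i _ /=; rewrite coefZ polyCM tofracM mulrA.
have E_op (P : {poly F}) : size P = n.+1 -> opapp n P (E D) = E (P * D).
  move=> sP; rewrite -[P in RHS]coefK sP poly_def mulr_suml.
  under [in RHS]eq_bigr do rewrite -scalerAl.
  by rewrite E_lin; apply: eq_bigr => l _; rewrite E_Xn // -ltnS.
apply: (hyper_op_reducible n2 l0 a0 b0 (u := E D) _ _ irr); last first.
  rewrite -/al -/be !E_op ?sal ?sbe //.
  (* Up to a constant, lambda z acts on e_K as the scalar q^(-K). The equation for D then matches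
     all polar parts, and the constants left over add up to a multiple of be(1) = 0. *)
  have lx K : (lambda *: 'X)%:F * e K = cst (q ^- K) * (e K - 1).
    apply: (mulIf (dF K)); rewrite -!mulrA mulrBl mulVf // mul1r mulr1.
    rewrite -tofrac1 -tofracB -tofracM; congr (_%:F).
    rewrite /d; apply/polyP => j; rewrite coefCM !(coefB, coefZ, coefX, coef1).
    have qK : q ^+ K != 0 by rewrite expf_neq0.
    by rewrite opprB addrC subrK mulrA mulrCA mulVf // mulr1.
  have coefaD K : cst (al * D)`_K * cst (q ^- K) = cst (be * D)`_K.
    rewrite aD comp_scaleX -tofracM -polyCM mulrAC mulfV ?mul1r //.
    by rewrite expf_neq0.
  rewrite /E mulr_sumr.
  rewrite (eq_bigr (fun K : 'I_M.+1 => cst (be * D)`_K * e K - cst (be * D)`_K)).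
    rewrite sumrB -(raddf_sum (@tofrac {poly F})) -raddf_sum.
    have -> : \sum_(K < M.+1) (be * D)`_K = (be * D).[1].
      rewrite (@horner_coef_wide _ M.+1); last first.
        rewrite (leq_trans (size_polyMleq _ _)) // sbe /M; lia.
      by apply: eq_bigr => K _; rewrite expr1n mulr1.
    by rewrite hornerM be1 mul0r /= polyC0 tofrac0 subr0.
  move=> K _; rewrite mulrCA lx mulrA coefaD; ring.
(* The solution is not zero: once denominators are cleared, its value at 1/lambda, the pole of e_0,
   is D_0 times the product of the 1 - q^K with K > 0. *)
apply/eqP => u0.
pose p : {poly F} := \sum_(K < M.+1) D`_K *: \prod_(L < M.+1 | L != K) d L.
have p0 : p = 0.
  have : (\prod_(K < M.+1) d K)%:F * E D = p%:F.
    rewrite mulr_sumr raddf_sum /=; apply: eq_bigr => K _.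
    rewrite (bigD1 K) //= tofracM -mul_polyC tofracM /e.
    by rewrite mulrC -mulrA (mulKf (dF K)).
  by rewrite u0 mulr0 => /esym/eqP; rewrite tofrac_eq0 => /eqP.
have : p.[lambda^-1] = 0 by rewrite p0 horner0.
have dl K : (d K).[lambda^-1] = 1 - q ^+ K.
  by rewrite !hornerE mulrAC mulfV // mul1r.
rewrite /p horner_sum big_ord_recl /= [X in _ + X]big1; last first.
  move=> K _; rewrite hornerZ horner_prod (bigD1 ord0) //=.
  by rewrite dl expr0 subrr mul0r mulr0.
rewrite addr0 hornerZ horner_prod => /eqP; rewrite mulf_eq0 (negPf D0) /=.
apply/negP/prodf_neq0 => K K0; rewrite dl subr_eq0 eq_sym.
by case: K K0 => [[|K] HK] // _; apply: q1.
Qed.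

End Operators.

(** * Polynomial relations along a spiral *)

Section Spiral.
Variable F : fieldType.

Definition lincomb (A : finType) (c : A -> {poly F}) (x : F) (y : A -> F) : F :=
  \sum_a (c a).[x] * y a.

Lemma lincombDM (A : finType) (c c' : A -> {poly F}) p x y :
  lincomb (fun a => c a + p * c' a) x y = lincomb c x y + p.[x] * lincomb c' x y.
Proof.
rewrite /lincomb mulr_sumr -big_split; apply: eq_bigr => a _.
by rewrite hornerD hornerM mulrDl mulrA.
Qed.

(* The relations form a submodule of a free F[X]-module of finite rank, which
   is finitely generated: this gives the uniformity. *)
Lemma uniform_threshold (A : finType) (S : set (A -> {poly F}))
    (x : int -> F) (y : int -> A -> F) :
  (forall c c' p, S c -> S c' -> S (fun a => c a + p * c' a)) ->
  (forall c, S c -> exists K0, forall K, K <= K0 -> lincomb c (x K) (y K) = 0) ->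
  exists K0, forall c, S c -> forall K, K <= K0 -> lincomb c (x K) (y K) = 0.
Proof.
move=> Scl Sev.
(* Induction on the set of coordinates that are allowed to be nonzero. *)
suff H (s : seq A) : exists K0, forall c, S c -> (forall a, a \notin s -> c a = 0) ->
    forall K, K <= K0 -> lincomb c (x K) (y K) = 0.
  have [K0 HK] := H (enum A); exists K0 => c Sc; apply: HK => // a.
  by rewrite mem_enum.
elim: s => [|a s [K1 IH]].
  exists 0 => c _ c0 K _; rewrite /lincomb big1 // => a _.
  by rewrite c0 // horner0 mul0r.
(* An element c0 whose a-th coordinate is nonzero of least size generates the ideal of all a-th
   coordinates. Euclidean division then removes the coordinate a from any other relation. *)
pose P m := `[< exists c, [/\ S c, forall b, b \notin a :: s -> c b = 0,
   c a != 0 & size (c a) = m] >].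
have [[m Pm]|nP] := pselect (exists m, P m); last first.
  exists K1 => c Sc cs; apply: IH => // b bs; have [->|ba] := eqVneq b a.
    apply/eqP; apply: contrapT => /negP ca; apply: nP; exists (size (c a)).
    by apply/asboolP; exists c; split.
  by apply: cs; rewrite inE negb_or ba.
have exP : exists m, P m by exists m.
case: (ex_minnP exP) => {Pm}m /asboolP[c0 [Sc0 c0s c0a szm]] mmin.
have [K2 HK2] := Sev _ Sc0.
exists (Num.min K1 K2) => c Sc cs K; rewrite le_min => /andP[KK1 KK2].
pose p := - (c a %/ c0 a); pose d b := c b + p * c0 b.
have Sd : S d by apply: Scl.
have da : d a = c a %% c0 a.
  by apply/eqP; rewrite /d mulNr subr_eq addrC -divp_eq.
have d0 : lincomb d (x K) (y K) = 0.
  apply: IH => // b bs; have [->|ba] := eqVneq b a; last first.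
    by rewrite /d cs ?c0s ?inE ?negb_or ?ba // mulr0 addr0.
  apply/eqP; apply: contrapT => /negP dn0.
  have := mmin (size (d a)); rewrite -szm leqNgt da ltn_modp c0a.
  suff -> : P (size (c a %% c0 a)) by move=> /(_ isT).
  apply/asboolP; exists d; split => //; last by rewrite da.
  by move=> e es; rewrite /d cs // c0s // mulr0 addr0.
by move: d0; rewrite lincombDM HK2 // mulr0 addr0.
Qed.

(** Relations valid for all K near -oo form a module [S] stable under [T], the pullback along K -> K
    + 1 with denominators cleared. One threshold serves all of [S] and can be raised step by step: d
    at K follows from T d at K - 1, because [H] does not vanish there. *)
Lemma spiral_linear (A : finType) (x : int -> F) (y : int -> A -> F) (s : F)
    (h : A -> {poly F}) (B : A -> A -> {poly F}) (Kmax : int) :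
  (forall K, x (K + 1) = s * x K) ->
  (forall K a, K < Kmax -> (h a).[x K] != 0) ->
  (forall K a, K < Kmax -> (h a).[x K] * y (K + 1) a = lincomb (B a) (x K) (y K)) ->
  forall c K0, (forall K, K <= K0 -> lincomb c (x K) (y K) = 0) ->
  lincomb c (x Kmax) (y Kmax) = 0.
Proof.
move=> xs h0 yB c K0 cK0.
pose H := \prod_a h a.
have H0 K : K < Kmax -> H.[x K] != 0.
  by move=> Kx; rewrite /H horner_prod; apply/prodf_neq0 => a _; apply: h0.
pose S : set (A -> {poly F}) := fun c => exists K0, forall K, K <= K0 ->
  lincomb c (x K) (y K) = 0.
have [||K1 HK1] := @uniform_threshold A S x y.
- move=> c1 c2 p [k1 H1] [k2 H2]; exists (Num.min k1 k2) => K.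
  by rewrite le_min => /andP[l1 l2]; rewrite lincombDM H1 ?H2 // mulr0 addr0.
- by [].
pose T (d : A -> {poly F}) a' :=
  \sum_a (d a \Po (s *: 'X)) * (\prod_(b | b != a) h b) * B a a'.
have TE d K : K < Kmax ->
    lincomb (T d) (x K) (y K) = H.[x K] * lincomb d (x (K + 1)) (y (K + 1)).
  move=> Kx; rewrite /lincomb mulr_sumr.
  rewrite (eq_bigr (fun a' => \sum_a (d a).[x (K + 1)] *
    (\prod_(b | b != a) h b).[x K] * (B a a').[x K] * y K a')); last first.
    move=> a' _; rewrite /T horner_sum mulr_suml; apply: eq_bigr => a _.
    by rewrite !hornerM horner_comp hornerZ hornerX -xs.
  rewrite exchange_big; apply: eq_bigr => a _ /=.
  rewrite (eq_bigr (fun a' => (d a).[x (K + 1)] * (\prod_(b | b != a) h b).[x K]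
     * ((B a a').[x K] * y K a'))); last by move=> a' _; rewrite !mulrA.
  rewrite -mulr_sumr -[X in _ * X]/(lincomb (B a) (x K) (y K)) -yB //.
  have -> : H = h a * \prod_(b | b != a) h b by rewrite /H (bigD1 a).
  by rewrite hornerM; ring.
(* The induction ranges over all of [S], since d at K is reduced to a different relation, T d, at K
   - 1. *)
have main (j : nat) : forall d, S d -> forall K, K <= K1 + j%:Z -> K <= Kmax ->
    lincomb d (x K) (y K) = 0.
  elim: j => [|j IH] d Sd K; first by rewrite addr0 => Kle _; apply: HK1.
  move=> Kj Kx.
  have Kx1 : K - 1 < Kmax by lia.
  have STd : S (T d).
    case: (Sd) => k Hk; exists (Num.min (k - 1) (Kmax - 1)) => L.
    rewrite le_min => /andP[l1 l2]; rewrite TE; last by lia.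
    by rewrite Hk ?mulr0 //; lia.
  have := IH _ STd (K - 1); rewrite TE // subrK => /(_ _ _)/eqP.
  rewrite mulf_eq0 (negPf (H0 _ Kx1)) /= => e; apply/eqP; apply: e; lia.
by apply: (main `|Kmax - K1|%N c) => //; [exists K0|lia].
Qed.

(** Polynomial functions of x and of the coordinates, given by closure rules so that they are
    recognized from the shape of an expression. *)
Inductive pfun (A : finType) : (F -> (A -> F) -> F) -> Prop :=
| pfun_poly p : pfun (fun x _ => p.[x])
| pfun_coord a : pfun (fun _ y => y a)
| pfun_add G H : pfun G -> pfun H -> pfun (fun x y => G x y + H x y)
| pfun_mul G H : pfun G -> pfun H -> pfun (fun x y => G x y * H x y).

(* With 1 added to the coordinates (as [None]), all monomials can be padded to
   products of exactly D coordinates, on which the recursion acts linearly. *)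
Definition words_eval (A : Type) (l : seq ({poly F} * seq (option A))) (x : F)
    (y : A -> F) : F :=
  \sum_(t <- l) t.1.[x] * \prod_(a <- t.2) oapp y 1 a.

(** The factor [l] is an accumulator: with it, a product is handled by chaining the two induction
    hypotheses, and a sum by padding both results to length D1 + D2. *)
Lemma pfun_words_mul (A : finType) G : pfun G ->
  forall D l, all (fun t : {poly F} * seq (option A) => size t.2 == D) l ->
  exists D' l', all (fun t : {poly F} * seq (option A) => size t.2 == D') l' /\
    forall x y, words_eval l' x y = words_eval l x y * G x y.
Proof.
elim=> [p|a|G1 G2 _ IH1 _ IH2|G1 G2 _ IH1 _ IH2] D l lD.
- exists D, [seq (t.1 * p, t.2) | t <- l]; rewrite all_map; split=> // x y.
  rewrite /words_eval big_map mulr_suml; apply: eq_bigr => t _ /=.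
  by rewrite hornerM; ring.
- exists D.+1, [seq (t.1, Some a :: t.2) | t <- l]; rewrite all_map; split=> // x y.
  rewrite /words_eval big_map mulr_suml; apply: eq_bigr => t _ /=.
  by rewrite big_cons /=; ring.
- have [D1 [l1 [al1 e1]]] := IH1 _ _ lD; have [D2 [l2 [al2 e2]]] := IH2 _ _ lD.
  pose pad k (t : {poly F} * seq (option A)) := (t.1, nseq k None ++ t.2).
  have padE k t x (y : A -> F) : (pad k t).1.[x] * \prod_(a <- (pad k t).2) oapp y 1 a
      = t.1.[x] * \prod_(a <- t.2) oapp y 1 a.
    by rewrite /pad big_cat big_nseq /= iter_fix ?mul1r //= mul1r.
  exists (D1 + D2)%N, ([seq pad D2 t | t <- l1] ++ [seq pad D1 t | t <- l2]).
  split.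
    rewrite all_cat !all_map; apply/andP; split.
      apply: sub_all al1 => t /= /eqP<-; by rewrite size_cat size_nseq addnC.
    by apply: sub_all al2 => t /= /eqP<-; rewrite size_cat size_nseq.
  move=> x y; rewrite mulrDr -e1 -e2 /words_eval big_cat !big_map.
  by congr (_ + _); apply: eq_bigr => t _; rewrite padE.
- have [D1 [l1 [al1 e1]]] := IH1 _ _ lD; have [D2 [l2 [al2 e2]]] := IH2 _ _ al1.
  by exists D2, l2; split=> // x y; rewrite e2 e1 mulrA.
Qed.

(** Words of a fixed length D form a finite type, so the padded monomials can serve as coordinates
    of a linear form; terms with the same word are grouped. *)
Lemma pfun_lincomb (A : finType) G : pfun G ->
  exists D (c : {ffun 'I_D -> option A} -> {poly F}),
  forall x y, G x y = lincomb c x (fun w => \prod_i oapp y 1 (w i)).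
Proof.
move=> pG; have [|D [l [lD lE]]] := @pfun_words_mul A G pG 0%N [:: (1, [::])].
  by [].
exists D, (fun w => \sum_(t <- l | t.2 == codom w) t.1) => x y.
have := lE x y; rewrite {2}/words_eval big_seq1 big_nil hornerC !mul1r => <-.
rewrite /lincomb (eq_bigr (fun w : {ffun _} => \sum_(t <- l | t.2 == codom w)
  t.1.[x] * \prod_(a <- t.2) oapp y 1 a)); last first.
  move=> w _; rewrite horner_sum mulr_suml; apply: eq_bigr => t /eqP->.
  by rewrite /= /image_mem big_map big_enum.
under eq_bigr do rewrite big_mkcond.
rewrite exchange_big /words_eval !big_seq; apply: eq_bigr => t tl.
rewrite -big_mkcond /=.
have /eqP st := allP lD _ tl.
pose w0 : {ffun 'I_D -> option A} := [ffun i : 'I_D => nth None t.2 i].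
rewrite (big_pred1 w0) // => w; apply/eqP/eqP => [tw|->].
  apply/ffunP => i; rewrite ffunE tw /= (nth_map i) ?size_enum_ord //.
  by rewrite nth_ord_enum.
apply: (@eq_from_nth _ None); first by rewrite size_codom card_ord.
move=> i; rewrite st => iD; rewrite /= (nth_map (Ordinal iD)) ?size_enum_ord //.
by rewrite ffunE nth_enum_ord.
Qed.

(** The linear recursion, extended by the constant coordinate 1, acts on products of D coordinates
    through its D-th tensor power. This reduces polynomial relations to [spiral_linear]. *)
Lemma spiral_pfun (A : finType) (x : int -> F) (y : int -> A -> F) (s : F)
    (h : A -> {poly F}) (B : A -> A -> {poly F}) (Kmax : int) G :
  pfun G ->
  (forall K, x (K + 1) = s * x K) ->
  (forall K a, K < Kmax -> (h a).[x K] != 0) ->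
  (forall K a, K < Kmax -> (h a).[x K] * y (K + 1) a = lincomb (B a) (x K) (y K)) ->
  forall K0, (forall K, K <= K0 -> G (x K) (y K) = 0) -> G (x Kmax) (y Kmax) = 0.
Proof.
move=> pG xs h0 yB K0 GK0; have [D [c cE]] := pfun_lincomb pG.
pose h' a := oapp h 1 a.
pose B' (a a' : option A) : {poly F} := match a, a' with
  | Some b, Some b' => B b b' | None, None => 1 | _, _ => 0 end.
pose y' K a := oapp (y K) 1 a.
have yB' K a : K < Kmax -> (h' a).[x K] * y' (K + 1) a = lincomb (B' a) (x K) (y' K).
  move=> Kx; rewrite /lincomb.
  have optE (f : option A -> F) : \sum_o f o = f None + \sum_b f (Some b).
    rewrite (bigD1 None) //=; congr (_ + _).
    rewrite (reindex_omap Some id) /=; last by case.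
    by apply: eq_bigl => b; rewrite eqxx.
  rewrite optE; case: a => [a|] /=.
    by rewrite horner0 mul0r add0r yB.
  by rewrite !hornerC !mul1r big1 ?addr0 // => b _; rewrite mul0r.
pose h2 (w : {ffun 'I_D -> option A}) := \prod_i h' (w i).
pose B2 (w w' : {ffun 'I_D -> option A}) := \prod_i B' (w i) (w' i).
pose y2 K (w : {ffun 'I_D -> option A}) := \prod_i y' K (w i).
rewrite cE; apply: (@spiral_linear _ x y2 s h2 B2 Kmax _ _ _ c K0) => //.
- move=> K w Kx; rewrite horner_prod; apply/prodf_neq0 => i _.
  by case: (w i) => [a|] /=; rewrite ?hornerC ?oner_neq0 ?h0.
- move=> K w Kx; rewrite horner_prod -big_split /=.
  rewrite (eq_bigr (fun i => lincomb (B' (w i)) (x K) (y' K))); last first.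
    by move=> i _; rewrite yB'.
  rewrite /lincomb bigA_distr_bigA /=; apply: eq_bigr => w' _.
  by rewrite horner_prod big_split.
- by move=> K Kl; rewrite -cE GK0.
Qed.

End Spiral.

(** * Convergent series as Puiseux series *)

Section Germs.
Variable R : realType.
Local Notation C := R[i].
Implicit Types (x y z w : C).

(** The modulus as an element of R, where real arithmetic applies; the norm of the library takes its
    values in C. *)
Definition cmod (x : C) : R := ComplexField.Normc.normc x.

Lemma cmodE x : `|x| = (cmod x)%:C%C.
Proof. by []. Qed.

Lemma cmodM x y : cmod (x * y) = cmod x * cmod y.
Proof. exact: ComplexField.Normc.normcM. Qed.
Lemma cmodN x : cmod (- x) = cmod x.
Proof. exact: normcN. Qed.
Lemma cmod0 : cmod 0 = 0.
Proof. exact: ComplexField.Normc.normc0. Qed.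
Lemma cmod1 : cmod 1 = 1.
Proof. exact: ComplexField.Normc.normc1. Qed.
Lemma cmodV x : cmod x^-1 = (cmod x)^-1.
Proof. exact: ComplexField.Normc.normcV. Qed.
Lemma cmodD x y : cmod (x + y) <= cmod x + cmod y.
Proof. exact: le_normcD. Qed.
Lemma cmodB x y : cmod (x - y) <= cmod x + cmod y.
Proof. by rewrite -(cmodN y) cmodD. Qed.
Lemma cmodBC x y : cmod (x - y) = cmod (y - x).
Proof. by rewrite -cmodN opprB. Qed.
Lemma cmod_ge0 x : 0 <= cmod x.
Proof. by case: x => a b; rewrite sqrtr_ge0. Qed.
Lemma cmod_eq0 x : (cmod x == 0) = (x == 0).
Proof.
apply/eqP/eqP => [/ComplexField.Normc.eq0_normc//|->]; exact: cmod0.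
Qed.
Lemma cmod_gt0 x : (0 < cmod x) = (x != 0).
Proof. by rewrite lt_def cmod_ge0 andbT cmod_eq0. Qed.
Lemma cmodX x n : cmod (x ^+ n) = cmod x ^+ n.
Proof. by elim: n => [|n IH]; rewrite ?expr0 ?cmod1 // !exprS cmodM IH. Qed.
Lemma cmod_sum (I : Type) (r : seq I) (P : pred I) (f : I -> C) :
  cmod (\sum_(i <- r | P i) f i) <= \sum_(i <- r | P i) cmod (f i).
Proof.
elim/big_rec2: _ => [|i x y _ h]; first by rewrite cmod0.
by apply: le_trans (cmodD _ _) _; rewrite lerD2l.
Qed.

Lemma bernoulli (h : R) M : 0 <= h -> 1 + h *+ M <= (1 + h) ^+ M.
Proof.
move=> h0; elim: M => [|M IH]; first by rewrite mulr0n addr0 expr0.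
rewrite exprS; apply: le_trans (_ : (1 + h) * (1 + h *+ M) <= _).
  rewrite mulrDr mulr1 mulrDl mul1r mulrS -!addrA lerD2l lerD2l lerDl.
  by rewrite mulr_ge0 // mulrn_wge0.
by rewrite ler_pM2l // ltr_wpDr.
Qed.

Lemma exp_small (x e : R) : 0 <= x -> x < 1 -> 0 < e -> exists M, x ^+ M < e.
Proof.
rewrite le_eqVlt => /orP[/eqP<- _ e0|x0 x1 e0]; first by exists 1%N; rewrite expr1.
pose h := x^-1 - 1; have h0 : 0 < h by rewrite subr_gt0 invf_gt1.
have [M eM] : exists M : nat, e^-1 / h < M%:R.
  by exists (Num.truncn (e^-1 / h)).+1; apply: truncnS_gt.
exists M; rewrite -[x]invrK exprVn invf_plt ?posrE ?exprn_gt0 ?invr_gt0 //.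
have -> : x^-1 = 1 + h by rewrite /h addrC subrK.
apply: lt_le_trans (bernoulli M (ltW h0)); rewrite ltr_pdivrMr // in eM.
by rewrite ltr_wpDl // -mulr_natl.
Qed.

Lemma expM_small (a x e : R) : 0 <= x -> x < 1 -> 0 < e -> exists M, a * x ^+ M < e.
Proof.
move=> x0 x1 e0; have p : 0 < `|a| + 1 by rewrite ltr_wpDl.
have [M hM] := exp_small x0 x1 (divr_gt0 e0 p); exists M.
rewrite ltr_pdivlMr // in hM; apply: le_lt_trans hM.
rewrite mulrC ler_wpM2l ?exprn_ge0 //.
by apply: le_trans (ler_norm a) _; rewrite lerDl.
Qed.

Lemma geometric_bound_eq0 (x a t : R) : 0 <= t -> t < 1 -> 0 <= x ->
  (forall M, x <= a * t ^+ M) -> x = 0.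
Proof.
move=> t0 t1 x0 H; apply/eqP; rewrite eq_le x0 andbT leNgt; apply/negP => xp.
have [M] := expM_small a t0 t1 xp; apply/negP; rewrite -leNgt; exact: H.
Qed.

Lemma geometric_ge0 (u : nat -> C) (s c : R) :
  (forall m, cmod (u m) <= c * s ^+ m) -> 0 <= c.
Proof. by move=> /(_ 0%N); rewrite expr0 mulr1; apply: le_trans (cmod_ge0 _). Qed.

(** A quantitative form of analyticity at 0: geometric error bounds for all partial sums, which pass
    to sums and products without any limit. *)
Definition germ_data (u : nat -> C) (s c : R) (g : C -> C) :=
  [/\ 0 < s, forall m, cmod (u m) <= c * s ^+ m &
    forall w M, s * cmod w <= 1 ->
      cmod (g w - \sum_(m < M) u m * w ^+ m) <= c * (s * cmod w) ^+ M].

(** Here w stands for the local parameter z^(1/N), and only exponents >= 0 occur. *)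
Definition germ (N : nat) (f : puiseux C) (g : C -> C) :=
  exists u s c, f = pser N 0 u :> (rat -> C) /\ germ_data u s c g.

Variable N : nat.
Hypothesis N0 : (0 < N)%N.

Lemma germ_eq0 f g : germ N f g -> f = 0 ->
  exists2 e, 0 < e & forall w, cmod w < e -> g w = 0.
Proof.
move=> [u [s [c [fu [s0 us gu]]]]] f0.
have u0 m : u m = 0 by rewrite -(@pserE C N 0 u m N0) -fu f0.
exists (s^-1 / 2) => [|w we]; first by rewrite divr_gt0 ?invr_gt0.
have sw : s * cmod w <= 2^-1.
  by rewrite -ler_pdivlMl // ltW.
apply/eqP; rewrite -cmod_eq0; apply/eqP.
have h2 : 2^-1 < 1 :> R by lra.
apply: (@geometric_bound_eq0 _ c 2^-1); rewrite ?cmod_ge0 ?invr_ge0 // => M.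
have c0 := geometric_ge0 us.
have := gu w M; rewrite big1 ?subr0 => [|m _]; last by rewrite u0 mul0r.
move=> /(_ _)/le_trans; apply; first by apply: le_trans sw _; lra.
have s0' := ltW s0.
by rewrite ler_wpM2l // lerXn2r ?nnegrE ?mulr_ge0 ?cmod_ge0 ?invr_ge0 ?ler0n.
Qed.

(** Isolated zeros: if u_m is the first nonzero coefficient, a zero w satisfies |u_m| <= c s^(m+1)
    |w|, which fails for small w. *)
Lemma germ_identity f g : germ N f g ->
  (forall e, 0 < e -> exists w, [/\ w != 0, cmod w < e & g w = 0]) -> f = 0.
Proof.
move=> [u [s [c [fu [s0 us gu]]]]] gz.
suff u0 m : u m = 0.
  apply/val_inj; rewrite /= fu; apply/funext => r; rewrite /pser.
  by case: ifP; rewrite ?u0.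
elim/ltn_ind: m => m IH; apply/eqP; rewrite -cmod_eq0; apply: contraTT isT => um.
have ump : 0 < cmod (u m) by rewrite lt_def um cmod_ge0.
have c0 := geometric_ge0 us.
pose d := c * s ^+ m.+1 + 1.
have d0 : 0 < d by rewrite ltr_wpDl // mulr_ge0 // exprn_ge0 // ltW.
have [|w [w0 we gw]] := gz (Num.min s^-1 (cmod (u m) / d)).
  by rewrite lt_min invr_gt0 s0 divr_gt0.
move: we; rewrite lt_min => /andP[ws wd].
have wp : 0 < cmod w by rewrite cmod_gt0.
have := gu w m.+1; rewrite gw big_ord_recr /= big1 => [|i _]; last first.
  by rewrite IH ?mul0r.
rewrite sub0r cmodN add0r cmodM cmodX exprMn.
have sw : s * cmod w <= 1 by rewrite -ler_pdivlMl // mulr1 ltW.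
rewrite [cmod w ^+ m.+1]exprS !mulrA ler_pM2r ?exprn_gt0 // => /(_ sw) h1.
move: wd; rewrite ltr_pdivlMr // /d => h2; move: h1; rewrite leNgt => /negP[].
by rewrite -mulrA mulrC; lra.
Qed.

Lemma germ_data_le u s c s' c' g : s <= s' -> c <= c' ->
  germ_data u s c g -> germ_data u s' c' g.
Proof.
move=> ss cc [s0 us gu]; have c0 := geometric_ge0 us.
have sw w : s * cmod w <= s' * cmod w by rewrite ler_wpM2r ?cmod_ge0.
have s0' := ltW s0; have ss0 : 0 <= s' by apply: le_trans ss.
split; first exact: lt_le_trans ss.
  move=> m; apply: le_trans (us m) _; apply: ler_pM => //; first exact: exprn_ge0.
  by rewrite lerXn2r.
move=> w M sw1; apply: le_trans (gu w M _) _; first exact: le_trans (sw w) sw1.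
apply: ler_pM => //; first by rewrite exprn_ge0 // mulr_ge0 ?cmod_ge0.
by rewrite lerXn2r ?nnegrE ?mulr_ge0 ?cmod_ge0.
Qed.

Lemma germ2 f1 g1 f2 g2 : germ N f1 g1 -> germ N f2 g2 ->
  exists u1 u2 s c, [/\ f1 = pser N 0 u1 :> (rat -> C), f2 = pser N 0 u2 :> (rat -> C),
    germ_data u1 s c g1 & germ_data u2 s c g2].
Proof.
move=> [u1 [s1 [c1 [f1u G1]]]] [u2 [s2 [c2 [f2u G2]]]].
exists u1, u2, (Num.max s1 s2), (Num.max c1 c2); split=> //.
  by apply: (@germ_data_le _ s1 c1) => //; rewrite le_max lexx.
by apply: (@germ_data_le _ s2 c2) => //; rewrite le_max lexx orbT.
Qed.

Lemma germD f1 g1 f2 g2 : germ N f1 g1 -> germ N f2 g2 ->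
  germ N (f1 + f2) (fun w => g1 w + g2 w).
Proof.
move=> G1 G2; have [u1 [u2 [s [c [f1u f2u [s0 u1s gu1] [_ u2s gu2]]]]]] := germ2 G1 G2.
exists (fun m => u1 m + u2 m), s, (c + c); split.
  by rewrite pserD // -f1u -f2u.
split=> //.
- by move=> m; rewrite mulrDl; apply: le_trans (cmodD _ _) _; apply: lerD.
- move=> w M sw; have -> : g1 w + g2 w - \sum_(m < M) (u1 m + u2 m) * w ^+ m =
    (g1 w - \sum_(m < M) u1 m * w ^+ m) + (g2 w - \sum_(m < M) u2 m * w ^+ m).
    by under eq_bigr do rewrite mulrDl; rewrite big_split /=; ring.
  by rewrite mulrDl; apply: le_trans (cmodD _ _) _; apply: lerD; [apply: gu1|apply: gu2].
Qed.

Lemma conv_psum (u v : nat -> C) w M :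
  \sum_(m < M) conv u v m * w ^+ m =
  \sum_(i < M) u i * w ^+ i * \sum_(j < M - i) v j * w ^+ j.
Proof.
elim: M => [|M IH]; first by rewrite !big_ord0.
rewrite big_ord_recr IH /= [RHS]big_ord_recr /= subSnn big_ord1 expr0 mulr1.
rewrite /conv big_ord_recr /= subnn mulrDl addrA.
rewrite [u M * _ * _]mulrAC; congr (_ + _).
rewrite mulr_suml -big_split; apply: eq_bigr => i _ /=.
rewrite subSn ?(ltnW (ltn_ord i)) // big_ord_recr /= mulrDr; congr (_ + _).
have -> : w ^+ M = w ^+ i * w ^+ (M - i) by rewrite -exprD subnKC // ltnW.
ring.
Qed.

(** In the Cauchy product the error bounds acquire a factor M + 1. It is absorbed by 2^M, hence the
    new rate 2 s. *)
Lemma germM f1 g1 f2 g2 : germ N f1 g1 -> germ N f2 g2 ->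
  germ N (f1 * f2) (fun w => g1 w * g2 w).
Proof.
move=> G1 G2; have [u1 [u2 [s [c [f1u f2u [s0 u1s gu1] [_ u2s gu2]]]]]] := germ2 G1 G2.
have c0 := geometric_ge0 u1s; have s0' := ltW s0.
have nat2 M (x : R) : 0 <= x -> M.+1%:R * x ^+ M <= (2 * x) ^+ M.
  by move=> x0; rewrite exprMn ler_wpM2r ?exprn_ge0 // -natrX ler_nat ltn_expl.
exists (conv u1 u2), (2 * s), (c ^+ 2); split.
  by rewrite -[LHS]/(pmulf f1 f2) f1u f2u pmulf_pser.
split=> [|m|w M sw2].
- by rewrite mulr_gt0.
- apply: le_trans (cmod_sum _ _ _) _.
  apply: (@le_trans _ _ (\sum_(i < m.+1) c ^+ 2 * s ^+ m)).
    apply: ler_sum => i _; have -> : s ^+ m = s ^+ i * s ^+ (m - i).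
      by rewrite -exprD subnKC // -ltnS.
    by rewrite cmodM expr2 mulrACA ler_pM ?cmod_ge0.
  rewrite sumr_const card_ord -[_ *+ m.+1]mulr_natl mulrCA.
  by rewrite ler_wpM2l ?exprn_ge0 // nat2.
- set t := s * cmod w; have t0 : 0 <= t by rewrite mulr_ge0 ?cmod_ge0.
  have t1 : t <= 1 by move: sw2; rewrite -mulrA -/t; lra.
  have g2b : cmod (g2 w) <= c.
    by have := gu2 w 0%N t1; rewrite big_ord0 subr0 expr0 mulr1.
  have -> : g1 w * g2 w - \sum_(m < M) conv u1 u2 m * w ^+ m =
     (g1 w - \sum_(i < M) u1 i * w ^+ i) * g2 w +
     \sum_(i < M) u1 i * w ^+ i * (g2 w - \sum_(j < M - i) u2 j * w ^+ j).
    rewrite conv_psum; under [X in _ = _ + X]eq_bigr do rewrite mulrBr.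
    by rewrite sumrB -mulr_suml; ring.
  rewrite -[2 * s * _]mulrA -/t; apply: le_trans (cmodD _ _) _.
  have b1 : cmod ((g1 w - \sum_(i < M) u1 i * w ^+ i) * g2 w) <= c ^+ 2 * t ^+ M.
    by rewrite cmodM expr2 mulrAC ler_pM ?cmod_ge0 // gu1.
  have b2 : cmod (\sum_(i < M) u1 i * w ^+ i * (g2 w - \sum_(j < M - i) u2 j * w ^+ j))
      <= M%:R * (c ^+ 2 * t ^+ M).
    apply: le_trans (cmod_sum _ _ _) _.
    apply: (@le_trans _ _ (\sum_(i < M) c ^+ 2 * t ^+ M)); last first.
      by rewrite sumr_const card_ord mulr_natl.
    apply: ler_sum => i _; have -> : t ^+ M = t ^+ i * t ^+ (M - i).
      by rewrite -exprD subnKC // ltnW.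
    rewrite cmodM expr2 mulrACA ler_pM ?cmod_ge0 ?gu2 //.
    by rewrite cmodM cmodX /t exprMn mulrA ler_wpM2r ?exprn_ge0 ?cmod_ge0.
  apply: le_trans (lerD b1 b2) _.
  have -> : c ^+ 2 * t ^+ M + M%:R * (c ^+ 2 * t ^+ M) = c ^+ 2 * (M.+1%:R * t ^+ M).
    by rewrite -natr1; ring.
  by rewrite ler_wpM2l ?exprn_ge0 // nat2.
Qed.

Lemma germ_finite (f : puiseux C) (k : nat) (x : C) :
  f = pser N 0 (fun m => (m == k)%:R * x) :> (rat -> C) -> germ N f (fun w => x * w ^+ k).
Proof.
move=> fE; exists (fun m => (m == k)%:R * x), 1, (cmod x); split=> //; split=> // [m|w M].
  by rewrite expr1n mulr1 cmodM; case: eqP; rewrite ?cmod1 ?cmod0 ?mul1r ?mul0r ?cmod_ge0.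
rewrite mul1r => w1; have [kM|Mk] := ltnP k M.
  rewrite (bigD1 (Ordinal kM)) //= eqxx mul1r big1 => [|i].
    by rewrite addr0 subrr cmod0 mulr_ge0 ?cmod_ge0 // exprn_ge0 ?cmod_ge0.
  by rewrite -val_eqE /= => /negPf->; rewrite !mul0r.
rewrite big1 => [|i _]; last first.
  by rewrite (ltn_eqF (leq_trans (ltn_ord i) Mk)) !mul0r.
by rewrite subr0 cmodM cmodX ler_wpM2l ?cmod_ge0 // ler_wiXn2l ?cmod_ge0.
Qed.

Lemma germ_const x : germ N (pconst x) (fun=> x).
Proof.
suff : germ N (pconst x) (fun w => x * w ^+ 0).
  by rewrite (_ : (fun w => _) = (fun=> x)) //; apply/funext => w; rewrite mulr1.
apply: germ_finite; apply: pser_eq => // [n|r] /=.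
  rewrite add0r mulf_eq0 invr_eq0 !pnatr_eq0 (gtn_eqF N0) orbF.
  by case: eqP; rewrite ?mul1r ?mul0r.
by have [-> _|_ /eqP//] := eqVneq r 0; exists 0%N; rewrite addr0 mul0r.
Qed.

Lemma germ_zroot : germ N (zroot C N) id.
Proof.
suff : germ N (zroot C N) (fun w => 1 * w ^+ 1).
  by rewrite (_ : (fun w => _) = id) //; apply/funext => w; rewrite mul1r.
have Nn : N%:R != 0 :> rat by rewrite pnatr_eq0 -lt0n.
apply: germ_finite; apply: pser_eq => // [n|r] /=.
  rewrite add0r mulr1 -[X in _ == X]mul1r (inj_eq (mulIf (invr_neq0 Nn))).
  by rewrite -[1]/(1%:R) eqr_nat; case: eqP.
by have [-> _|_ /eqP//] := eqVneq r N%:R^-1; exists 1%N; rewrite add0r mul1r.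
Qed.

Lemma germ_sum (I : Type) (r : seq I) (P : pred I) f (g : I -> C -> C) :
  (forall i, germ N (f i) (g i)) ->
  germ N (\sum_(i <- r | P i) f i) (fun w => \sum_(i <- r | P i) g i w).
Proof.
move=> fg; elim: r => [|i r IH].
  rewrite big_nil (_ : (fun w => _) = (fun=> 0)).
    by rewrite -(rmorph0 (@pconst C)); apply: germ_const.
  by apply/funext => w; rewrite big_nil.
rewrite big_cons (_ : (fun w => _) =
  (fun w => if P i then g i w + \sum_(i <- r | P i) g i w else \sum_(i <- r | P i) g i w)).
  by case: (P i) => //; apply: germD.
by apply/funext => w; rewrite big_cons.
Qed.

Lemma germ_prod (I : Type) (r : seq I) (P : pred I) f (g : I -> C -> C) :
  (forall i, germ N (f i) (g i)) ->
  germ N (\prod_(i <- r | P i) f i) (fun w => \prod_(i <- r | P i) g i w).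
Proof.
move=> fg; elim: r => [|i r IH].
  rewrite big_nil (_ : (fun w => _) = (fun=> 1)).
    by rewrite -(rmorph1 (@pconst C)); apply: germ_const.
  by apply/funext => w; rewrite big_nil.
rewrite big_cons (_ : (fun w => _) =
  (fun w => if P i then g i w * \prod_(i <- r | P i) g i w else \prod_(i <- r | P i) g i w)).
  by case: (P i) => //; apply: germM.
by apply/funext => w; rewrite big_cons.
Qed.

Lemma germX f g k : germ N f g -> germ N (f ^+ k) (fun w => g w ^+ k).
Proof.
move=> fg; rewrite -[k]card_ord -prodr_const.
rewrite (_ : (fun w => _) = (fun w => \prod_(i in 'I_k) g w)); first exact: germ_prod.
by apply/funext => w; rewrite prodr_const card_ord.
Qed.

Lemma germ_poly (p : {poly C}) :
  germ N (map_poly (@pconst C) p).[zroot C N] (fun w => p.[w]).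
Proof.
rewrite (_ : (fun w => _) = (fun w => \sum_(i < size p) p`_i * w ^+ i)); last first.
  by apply/funext => w; rewrite horner_coef.
rewrite horner_coef size_map_poly; apply: germ_sum => i; rewrite coef_map.
by apply: germM; [apply: germ_const | apply: germX germ_zroot].
Qed.

Lemma germ_series (u : nat -> C) (s c : R) (g : C -> C) :
  germ_data u s c g -> germ N (pseries u) (fun w => g (w ^+ N)).
Proof.
move=> [s0 us gu]; have c0 := geometric_ge0 us.
(* Taking s' >= 1 ensures s <= s'^N, the rate needed after substituting w^N. *)
pose s' := Num.max 1 s.
have s1 : 1 <= s' by rewrite le_max lexx.
have ss' : s <= s' by rewrite le_max lexx orbT.
have s'0 : 0 < s' by apply: lt_le_trans s1.
have sN : s <= s' ^+ N.
  by apply: le_trans ss' _; rewrite -[X in X <= _]expr1 ler_weXn2l.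
pose v m := if (N %| m)%N then u (m %/ N)%N else 0.
(* The number of multiples of N below M is M / N rounded up. *)
have vsum w M : \sum_(m < M) v m * w ^+ m =
    \sum_(k < (M + N.-1) %/ N) u k * (w ^+ N) ^+ k.
  elim: M => [|M IH].
    by rewrite big_ord0 add0n divn_small ?prednK // big_ord0.
  rewrite big_ord_recr IH /= /v.
  have [/dvdnP[k ->]|nd] := boolP (N %| M)%N.
    have -> : ((k * N).+1 + N.-1 = k.+1 * N)%N by rewrite mulSn addSn -addnS prednK // addnC.
    rewrite !mulnK // big_ord_recr /= -exprM [(k * N)%N]mulnC.
    by rewrite mulnC divnMDl // divn_small ?prednK // addn0.
  rewrite mul0r addr0.
  suff -> : ((M.+1 + N.-1) %/ N = (M + N.-1) %/ N)%N by [].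
  have r0 : (0 < M %% N)%N by rewrite lt0n.
  have rN : (M %% N < N)%N by rewrite ltn_pmod.
  rewrite (divn_eq M N) -addnS -!addnA !divnMDl //; congr (_ + _)%N.
  have -> : (M %% N + N.-1 = N + (M %% N).-1)%N by lia.
  have -> : ((M %% N).+1 + N.-1 = N + M %% N)%N by lia.
  rewrite -[X in (X + _)%N](mul1n N) -[X in _ = ((X + _) %/ _)%N](mul1n N) !divnMDl //.
  by rewrite !divn_small //; lia.
exists v, s', c; split; last split=> // [m|w M sw].
- apply: pser_eq => // [n|r] /=; have Nn : N%:R != 0 :> rat by rewrite pnatr_eq0 -lt0n.
    rewrite /pseries_fun add0r /v; case: ifP => [/natrP[k nk]|nn].
      have -> : n = (k * N)%N.
        by apply/eqP; rewrite -(eqr_nat rat) natrM -nk divfK.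
      by rewrite dvdn_mull // mulnK // natrM mulfK // natrK.
    case: ifP => // /dvdnP[k nk]; move: nn; rewrite nk natrM mulfK // natr_nat //.
  rewrite /pseries_fun; case: ifP => [/natrP[k ->] _|_ /eqP//].
  by exists (k * N)%N; rewrite add0r natrM mulfK.
- rewrite /v; case: ifP => [/dvdnP[k ->]|_]; last first.
    by rewrite cmod0 mulr_ge0 // exprn_ge0 // ltW.
  rewrite mulnK //; apply: le_trans (us k) _; rewrite ler_wpM2l // mulnC exprM.
  by rewrite lerXn2r ?nnegrE ?exprn_ge0 ?(ltW s0) ?(ltW s'0).
- set t := s' * cmod w in sw *; have t0 : 0 <= t by rewrite mulr_ge0 ?cmod_ge0 // ltW.
  have sw' : s * cmod (w ^+ N) <= t ^+ N.
    by rewrite cmodX exprMn ler_wpM2r ?exprn_ge0 ?cmod_ge0.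
  rewrite vsum; apply: le_trans (gu _ _ _) _.
    by apply: le_trans sw' _; rewrite exprn_ile1.
  rewrite ler_wpM2l //; set k := ((M + N.-1) %/ N)%N.
  apply: (@le_trans _ _ ((t ^+ N) ^+ k)).
    by rewrite lerXn2r ?nnegrE ?mulr_ge0 ?cmod_ge0 ?exprn_ge0 ?(ltW s0).
  rewrite -exprM ler_wiXn2l // /k.
  have := divn_eq (M + N.-1)%N N; have := ltn_pmod (M + N.-1)%N N0; lia.
Qed.

End Germs.

(** * Limits and sums of complex series *)

Section Limits.
Variable R : realType.
Local Notation C := R[i].

(** The limit is the supremum of the lower bounds a_M - e_M; each a_M + e_M is an upper bound of
    them. *)
Lemma real_complete (a e : nat -> R) :
  (forall M M', (M <= M')%N -> `|a M' - a M| <= e M) ->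
  exists l, forall M, `|l - a M| <= e M.
Proof.
move=> H; pose E : set R := [set a M - e M | M in [set: nat]]%classic.
have ub M : ubound E (a M + e M).
  move=> _ [M' _ <-]; have [MM|MM] := leqP M M'.
    have := H _ _ MM; have := H _ _ (leqnn M'); rewrite subrr normr0.
    by rewrite ler_norml => h /andP[_ h2]; lra.
  have := H _ _ (ltnW MM); have := H _ _ (leqnn M); rewrite subrr normr0.
  by rewrite ler_norml => h /andP[h1 _]; lra.
have E0 : (E !=set0)%classic by exists (a 0%N - e 0%N); exists 0%N.
exists (sup E) => M; rewrite ler_norml.
have h1 : a M - e M <= sup E.
  by apply: sup_upper_bound; [split=> //; exists (a 0%N + e 0%N)|exists M].
have h2 : sup E <= a M + e M by apply: ge_sup.
by apply/andP; split; lra.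
Qed.

Lemma cmod_Re (x : C) : `|complex.Re x| <= cmod x.
Proof.
by have := normc_ge_Re x; rewrite cmodE lecR.
Qed.

Lemma cmod_Im (x : C) : `|complex.Im x| <= cmod x.
Proof.
have -> : cmod x = cmod (x * 'i%C).
  rewrite cmodM [X in _ * X](_ : _ = 1) ?mulr1 // /cmod /=.
  by rewrite expr0n expr1n add0r sqrtr1.
by apply: le_trans (cmod_Re _); rewrite ReiNIm normrN.
Qed.

Lemma cmod_le_ReIm (x : C) : cmod x <= `|complex.Re x| + `|complex.Im x|.
Proof.
have rc (r : R) : cmod r%:C%C = `|r|.
  by rewrite /cmod /= expr0n addr0 sqrtr_sqr.
rewrite [X in cmod X]complexE; apply: le_trans (cmodD _ _) _.
rewrite cmodM !rc [X in _ + X * _](_ : _ = 1) ?mul1r // /cmod /=.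
by rewrite expr0n expr1n add0r sqrtr1.
Qed.

(** The factor 2 comes from treating real and imaginary parts separately. *)
Lemma complex_complete (a : nat -> C) (e : nat -> R) :
  (forall M M', (M <= M')%N -> cmod (a M' - a M) <= e M) ->
  exists l, forall M, cmod (l - a M) <= 2 * e M.
Proof.
move=> H.
have [M M' MM|x xE] := @real_complete (fun M => complex.Re (a M)) e.
  have := le_trans (cmod_Re _) (H _ _ MM).
  by case: (a M') (a M) => [? ?] [? ?].
have [M M' MM|y yE] := @real_complete (fun M => complex.Im (a M)) e.
  have := le_trans (cmod_Im _) (H _ _ MM).
  by case: (a M') (a M) => [? ?] [? ?].
exists (x +i* y)%C => M; apply: le_trans (cmod_le_ReIm _) _.
rewrite mulr2n mulrDl mul1r; have := xE M; have := yE M.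
by case: (a M) => [? ?] /= h1 h2; apply: lerD.
Qed.

Lemma power_series_sum (u : nat -> C) (s c : R) : 0 < s ->
  (forall m, cmod (u m) <= c * s ^+ m) ->
  exists g : C -> C, forall w M, s * cmod w < 1 ->
    cmod (g w - \sum_(m < M) u m * w ^+ m) <= 2 * c / (1 - s * cmod w) * (s * cmod w) ^+ M.
Proof.
move=> s0 us; have c0 := geometric_ge0 us.
suff H w : exists v, forall M, s * cmod w < 1 ->
    cmod (v - \sum_(m < M) u m * w ^+ m) <= 2 * c / (1 - s * cmod w) * (s * cmod w) ^+ M.
  by have [g gE] := boolp.choice H; exists g.
(* Outside the disc nothing is claimed, and 0 is only a default value. *)
have [w1|w1] := ltP (s * cmod w) 1; last by exists 0.
set t := s * cmod w in w1 *; have t0 : 0 <= t by rewrite mulr_ge0 ?cmod_ge0 // ltW.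
have t1 : 0 < 1 - t by rewrite subr_gt0.
have [M M' MM|v vE] := @complex_complete (fun M => \sum_(m < M) u m * w ^+ m)
    (fun M => c / (1 - t) * t ^+ M); last first.
  by exists v => M _; rewrite -mulrA -mulrA mulrA -mulrA; have := vE M; rewrite !mulrA.
(* The bound is put in telescoping form so that the induction on M' closes. *)
suff H : cmod (\sum_(m < M') u m * w ^+ m - \sum_(m < M) u m * w ^+ m) <=
    c / (1 - t) * (t ^+ M - t ^+ M').
  apply: le_trans H _; rewrite ler_wpM2l ?divr_ge0 ?(ltW t1) //.
  by rewrite gerBl exprn_ge0.
elim: M' MM => [|M' IH]; first by rewrite leqn0 => /eqP->; rewrite !subrr cmod0 mulr0.
rewrite leq_eqVlt => /orP[/eqP->|MM]; first by rewrite !subrr cmod0 mulr0.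
rewrite big_ord_recr /= addrAC; apply: le_trans (cmodD _ _) _.
have -> : c / (1 - t) * (t ^+ M - t ^+ M'.+1) =
    c / (1 - t) * (t ^+ M - t ^+ M') + c * t ^+ M'.
  rewrite exprS; field; by rewrite gt_eqF.
apply: lerD; first exact: IH.
rewrite cmodM cmodX /t exprMn mulrA ler_wpM2r ?exprn_ge0 ?cmod_ge0 //.
Qed.

Definition near0 (P : C -> Prop) :=
  exists2 d : R, 0 < d & forall t, t != 0 -> cmod t < d -> P t.

(** Limits are taken as a complex parameter t tends to 0 without being 0. Continuity of a function
    at z0 is expressed through all curves Z that tend to z0. *)
Definition tends (f : C -> C) (l : C) :=
  forall e : R, 0 < e -> near0 (fun t => cmod (f t - l) < e).

Lemma near0_and P Q : near0 P -> near0 Q -> near0 (fun t => P t /\ Q t).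
Proof.
move=> [d d0 HP] [d' d'0 HQ]; exists (Num.min d d'); first by rewrite lt_min d0.
by move=> t t0; rewrite lt_min => /andP[h h']; split; [apply: HP|apply: HQ].
Qed.

Lemma near0_imp (P Q : C -> Prop) : (forall t, P t -> Q t) -> near0 P -> near0 Q.
Proof. by move=> PQ [d d0 HP]; exists d => // t t0 td; apply/PQ/HP. Qed.

Lemma near0_all (I : finType) (P : I -> C -> Prop) :
  (forall i, near0 (P i)) -> near0 (fun t => forall i, P i t).
Proof.
move=> H; suff K (s : seq I) : near0 (fun t => forall i, i \in s -> P i t).
  by apply: near0_imp (K (enum I)) => t h i; apply: h; rewrite mem_enum.
elim: s => [|i s IH]; first by exists 1.
apply: near0_imp (near0_and (H i) IH) => t [h1 h2] j.
by rewrite inE => /orP[/eqP->|]; [|apply: h2].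
Qed.

Lemma near0_ex P : near0 P -> exists2 t, t != 0 & P t.
Proof.
move=> [d d0 HP]; exists (d / 2)%:C%C.
  by rewrite eq_complex /= eqxx andbT gt_eqF // divr_gt0.
apply: HP; first by rewrite eq_complex /= eqxx andbT gt_eqF // divr_gt0.
rewrite /cmod /= expr0n addr0 sqrtr_sqr ger0_norm; last by rewrite divr_ge0 // ltW.
by lra.
Qed.

Lemma tends_cst l : tends (fun=> l) l.
Proof. by move=> e e0; exists 1 => // t _ _; rewrite subrr cmod0. Qed.

Lemma tends_id : tends id 0.
Proof. by move=> e e0; exists e => // t _; rewrite subr0. Qed.

Lemma tends_near f g l : near0 (fun t => f t = g t) -> tends f l -> tends g l.
Proof.
by move=> fg fl e /fl h; apply: near0_imp (near0_and fg h) => t [->].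
Qed.

Lemma tends_ext f g l : f =1 g -> tends f l -> tends g l.
Proof. by move=> fg; apply: tends_near; exists 1 => // t _ _; apply: fg. Qed.

Lemma tendsD f g l m : tends f l -> tends g m -> tends (fun t => f t + g t) (l + m).
Proof.
move=> fl gm e e0; have e2 : 0 < e / 2 by rewrite divr_gt0.
apply: near0_imp (near0_and (fl _ e2) (gm _ e2)) => t [h1 h2].
have -> : f t + g t - (l + m) = (f t - l) + (g t - m) by ring.
by apply: le_lt_trans (cmodD _ _) _; lra.
Qed.

Lemma tendsM f g l m : tends f l -> tends g m -> tends (fun t => f t * g t) (l * m).
Proof.
move=> fl gm e e0; pose k := 1 + cmod l + cmod m.
have k0 : 0 < k by rewrite /k -addrA ltr_pwDl // addr_ge0 ?cmod_ge0.
pose d := Num.min 1 (e / k).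
have d0 : 0 < d by rewrite lt_min ltr01 divr_gt0.
apply: near0_imp (near0_and (fl _ d0) (gm _ d0)) => t [h1 h2].
have -> : f t * g t - l * m =
   (f t - l) * (g t - m) + (l * (g t - m) + m * (f t - l)) by ring.
apply: le_lt_trans (cmodD _ _) _; rewrite cmodM.
have h3 := le_trans (cmodD (l * (g t - m)) (m * (f t - l))) (lexx _).
rewrite !cmodM in h3.
have d1 : d <= 1 by rewrite ge_min lexx.
have dk : d * k <= e by rewrite -ler_pdivlMr // ge_min lexx orbT.
have := cmod_ge0 l; have := cmod_ge0 m; have := cmod_ge0 (f t - l).
have := cmod_ge0 (g t - m); rewrite /k in dk.
move: (cmod (f t - l)) (cmod (g t - m)) (cmod l) (cmod m) h1 h2 h3 dk => a b L M.
by move=> h1 h2 h3 dk b0 a0 M0 L0; nra.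
Qed.

Lemma tendsN f l : tends f l -> tends (fun t => - f t) (- l).
Proof.
move=> /(tendsM (tends_cst (-1))); rewrite mulN1r; apply: tends_ext => t.
by rewrite mulN1r.
Qed.

Lemma tendsB f g l m : tends f l -> tends g m -> tends (fun t => f t - g t) (l - m).
Proof. by move=> fl /tendsN gm; apply: tendsD. Qed.

Lemma tends_neq f l x : tends f l -> l != x -> near0 (fun t => f t != x).
Proof.
move=> fl lx; have p : 0 < cmod (x - l) by rewrite cmod_gt0 subr_eq0 eq_sym.
apply: near0_imp (fl _ p) => t; apply: contraTneq => ->.
by rewrite -leNgt.
Qed.

Lemma tendsV f l : l != 0 -> tends f l -> tends (fun t => (f t)^-1) l^-1.
Proof.
move=> l0 fl e e0; have lp : 0 < cmod l by rewrite cmod_gt0.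
have d0 : 0 < Num.min (cmod l / 2) (e * cmod l ^+ 2 / 2).
  by rewrite lt_min !divr_gt0 // mulr_gt0 // exprn_gt0.
apply: near0_imp (near0_and (fl _ d0) (tends_neq fl l0)) => t [].
rewrite lt_min => /andP[h1 h2] f0.
have -> : (f t)^-1 - l^-1 = (l - f t) * (f t * l)^-1 by field; rewrite l0 f0.
rewrite cmodM cmodV cmodM ltr_pdivrMr; last by rewrite mulr_gt0 // cmod_gt0.
rewrite cmodBC; have h3 : cmod l <= cmod (f t) + cmod (f t - l).
  have := cmodB (f t) (f t - l); by rewrite (_ : f t - (f t - l) = l) //; ring.
apply: lt_le_trans h2 _; rewrite expr2 [e * (_ * _)]mulrA -!mulrA ler_wpM2l ?(ltW e0) //.
rewrite [leRHS]mulrC ler_wpM2l ?cmod_ge0 //; lra.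
Qed.

Lemma tends_unique f l m : tends f l -> tends f m -> l = m.
Proof.
move=> fl fm; have [//|lm] := eqVneq l m.
have p : 0 < cmod (l - m) by rewrite cmod_gt0 subr_eq0.
have p2 : 0 < cmod (l - m) / 2 by rewrite divr_gt0.
have [t _ [h1 h2]] := near0_ex (near0_and (fl _ p2) (fm _ p2)).
have := cmodB (f t - m) (f t - l).
rewrite (_ : f t - m - (f t - l) = l - m); [by move=> h; exfalso; clear lm; lra|by ring].
Qed.

Lemma tends_sum (I : Type) (r : seq I) (P : pred I) (f : I -> C -> C) l :
  (forall i, tends (f i) (l i)) ->
  tends (fun t => \sum_(i <- r | P i) f i t) (\sum_(i <- r | P i) l i).
Proof.
move=> fl; elim: r => [|i r IH].
  by rewrite big_nil; apply: tends_ext (tends_cst 0) => t; rewrite big_nil.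
rewrite big_cons; case: ifP => Pi.
  by apply: tends_ext (tendsD (fl i) IH) => t; rewrite big_cons Pi.
by apply: tends_ext IH => t; rewrite big_cons Pi.
Qed.

Lemma tendsX f l k : tends f l -> tends (fun t => f t ^+ k) (l ^+ k).
Proof.
move=> fl; elim: k => [|k IH]; first by rewrite expr0; apply: tends_cst.
by rewrite exprS; apply: tends_ext (tendsM fl IH) => t; rewrite exprS.
Qed.

Lemma tends_prod (I : Type) (r : seq I) (P : pred I) (f : I -> C -> C) l :
  (forall i, tends (f i) (l i)) ->
  tends (fun t => \prod_(i <- r | P i) f i t) (\prod_(i <- r | P i) l i).
Proof.
move=> fl; elim: r => [|i r IH].
  by rewrite big_nil; apply: tends_ext (tends_cst 1) => t; rewrite big_nil.
rewrite big_cons; case: ifP => Pi.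
  by apply: tends_ext (tendsM (fl i) IH) => t; rewrite big_cons Pi.
by apply: tends_ext IH => t; rewrite big_cons Pi.
Qed.

Lemma tends_horner (p : {poly C}) f l : tends f l -> tends (fun t => p.[f t]) p.[l].
Proof.
move=> fl; rewrite horner_coef.
have := @tends_sum _ (index_enum 'I_(size p)) xpredT (fun i t => p`_i * f t ^+ i)
  (fun i => p`_i * l ^+ i) (fun i => tendsM (tends_cst _) (tendsX _ fl)).
by apply: tends_ext => t; rewrite horner_coef.
Qed.

End Limits.

(** * Continuation of the hypergeometric series *)

Section Continuation.
Variable R : realType.
Local Notation C := R[i].

Lemma poly_lipschitz0 (p : {poly C}) : exists2 L : R, 0 <= L &
  forall x, cmod x <= 1 -> cmod (p.[x] - p`_0) <= L * cmod x.
Proof.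
elim/poly_ind: p => [|p c [L L0 IH]].
  by exists 0 => // x _; rewrite horner0 coef0 subr0 cmod0 mul0r.
exists (cmod p`_0 + L) => [|x x1]; first by rewrite addr_ge0 ?cmod_ge0.
rewrite !hornerE coefD coefMX coefC eqxx add0r addrK cmodM ler_wpM2r ?cmod_ge0 //.
rewrite -[p.[x]](subrK p`_0) addrC; apply: le_trans (cmodD _ _) _.
rewrite lerD2l; apply: le_trans (IH _ x1) _.
by rewrite -[leRHS]mulr1 ler_wpM2l.
Qed.

(* Weierstrass: prod (1 - x_k) >= 1 - sum x_k and prod (1 + x_k) <= 1/(1 - sum x_k). *)
Lemma product_bounds (g rho : nat -> C) (A t : R) m0 :
  0 <= A -> 0 < t -> t < 1 -> (forall m, g m != 0) ->
  (forall m, g m.+1 = rho m * g m) ->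
  (forall m, (m0 <= m)%N -> cmod (rho m - 1) <= A * t ^+ m) ->
  exists m1 lo hi, [/\ 0 < lo, forall m, cmod (g m) <= hi &
    forall m, (m1 <= m)%N -> lo <= cmod (g m)].
Proof.
move=> A0 t0 t1 g0 gS rhoA; pose B := A / (1 - t).
have tp : 0 < 1 - t by rewrite subr_gt0.
have B0 : 0 <= B by rewrite divr_ge0 // ltW.
have h2 : 0 < 2^-1 :> R by rewrite invr_gt0.
have [k hk] := expM_small B (ltW t0) t1 h2.
(* S m is the sum of A t^j for m1 <= j < m; m1 is chosen so that these sums stay below 1/2. *)
pose m1 := (m0 + k)%N; pose S m := B * (t ^+ m1 - t ^+ m).
have Bm1 : B * t ^+ m1 <= 2^-1.
  apply: le_trans (ltW hk); rewrite ler_wpM2l // /m1 addnC exprD ler_piMr //.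
    by rewrite exprn_ge0 // ltW.
  by rewrite exprn_ile1 // ltW.
have S12 m : (m1 <= m)%N -> 0 <= S m <= 2^-1.
  move=> mm; rewrite /S mulr_ge0 //=; last by rewrite subr_ge0 ler_wiXn2l ?(ltW t0) ?(ltW t1).
  by apply: le_trans Bm1; rewrite ler_wpM2l // gerBl exprn_ge0 // ltW.
have Sx m : S m.+1 = S m + A * t ^+ m.
  by rewrite /S exprS /B; field; rewrite gt_eqF.
have key m : (m1 <= m)%N -> cmod (g m1) * (1 - S m) <= cmod (g m) /\
    cmod (g m) * (1 - S m) <= cmod (g m1).
  elim: m => [|m IH].
    by rewrite leqn0 => /eqP e; rewrite /S e subrr mulr0 subr0 mulr1.
  rewrite leq_eqVlt => /orP[/eqP<-|mm].
    by rewrite /S subrr mulr0 subr0 mulr1.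
  have [IH1 IH2] := IH mm; have /andP[S0 Sh] := S12 _ (leqW mm).
  have /andP[S0' Sh'] := S12 _ mm.
  have xx := rhoA m (leq_trans (leq_addr _ _) mm).
  have r1 : cmod (rho m) <= 1 + A * t ^+ m.
    by rewrite -[rho m](subrK 1) addrC (le_trans (cmodD _ _)) // cmod1 lerD2l.
  have r2 : 1 - A * t ^+ m <= cmod (rho m).
    have := cmodB (rho m) (rho m - 1).
    rewrite (_ : rho m - (rho m - 1) = 1); last by ring.
    by rewrite cmod1 => h; lra.
  rewrite gS cmodM; move: S0 Sh; rewrite Sx.
  have x0 : 0 <= A * t ^+ m by rewrite mulr_ge0 // exprn_ge0 // ltW.
  have gm := cmod_ge0 (g m); have gm1 := cmod_ge0 (g m1); have rm := cmod_ge0 (rho m).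
  move: (A * t ^+ m) (S m) (cmod (g m)) (cmod (g m1)) (cmod (rho m)) IH1 IH2 r1 r2 S0' Sh' x0 gm gm1 rm.
  move=> x s a b r IH1 IH2 r1 r2 s0 sh x0 aa bb rr S0 Sh; clear -IH1 IH2 r1 r2 s0 sh x0 aa bb rr S0 Sh.
  have h1 : (1 - x) * a <= r * a by rewrite ler_wpM2r.
  have h2 : r * a <= (1 + x) * a by rewrite ler_wpM2r.
  split.
    apply: le_trans h1; apply: (@le_trans _ _ ((1 - x) * (b * (1 - s)))); last first.
      by rewrite ler_wpM2l //; lra.
    have -> : (1 - x) * (b * (1 - s)) = b * (1 - (s + x)) + b * (x * s) by ring.
    by rewrite lerDl !mulr_ge0.
  apply: le_trans IH2; apply: (@le_trans _ _ ((1 + x) * a * (1 - (s + x)))).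
    by rewrite ler_wpM2r //; lra.
  have -> : (1 + x) * a * (1 - (s + x)) = a * (1 - s) - a * (x * (s + x)) by ring.
  by rewrite gerBl !mulr_ge0.
have g1 : 0 < cmod (g m1) by rewrite cmod_gt0.
exists m1, (cmod (g m1) / 2), (2 * cmod (g m1) + \sum_(k < m1) cmod (g k)); split.
- by rewrite divr_gt0.
- move=> m; have [mm|mm] := leqP m1 m.
    have [_ h] := key m mm; have /andP[_ Sh] := S12 m mm.
    apply: (@le_trans _ _ (2 * cmod (g m1))); last by rewrite lerDl sumr_ge0 // => *; rewrite cmod_ge0.
    have h3 : cmod (g m) * 2^-1 <= cmod (g m) * (1 - S m).
      by rewrite ler_wpM2l ?cmod_ge0 //; lra.
    by lra.
  rewrite (bigD1 (Ordinal mm)) //= addrCA lerDl addr_ge0 ?mulr_ge0 ?cmod_ge0 //.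
  by rewrite sumr_ge0 // => *; rewrite cmod_ge0.
- move=> m mm; have [h _] := key m mm; have /andP[_ Sh] := S12 m mm.
  by apply: le_trans h; rewrite ler_wpM2l ?cmod_ge0 //; lra.
Qed.

Variables (q lambda : C) (n : nat) (al be : {poly C}) (c : nat -> C).
Hypotheses (q_gt0 : 0 < cmod q) (q_lt1 : cmod q < 1) (lambda0 : lambda != 0).
Hypotheses (sal : size al = n.+1) (sbe : size be = n.+1) (ab0 : al`_0 = be`_0)
  (be0 : be`_0 != 0) (be1 : be.[1] = 0) (beq : forall m, be.[q ^+ m.+1] != 0)
  (alq : forall m, al.[q ^+ m] != 0) (c0 : c 0%N = 1)
  (crec : forall m, be.[q ^+ m.+1] * c m.+1 = lambda * al.[q ^+ m] * c m).

Let q0 : q != 0. Proof. by rewrite -cmod_gt0. Qed.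
Let q1 k : q ^+ k.+1 != 1.
Proof.
apply/eqP => e; have h : cmod q ^+ k.+1 < 1 by rewrite exprn_ilt1 // ltW.
by move: h; rewrite -cmodX e cmod1 ltxx.
Qed.
Let c_neq0 m : c m != 0.
Proof.
elim: m => [|m IH]; first by rewrite c0 oner_neq0.
have := mulf_neq0 (mulf_neq0 lambda0 (alq m)) IH; rewrite -crec.
by rewrite mulf_eq0 negb_or => /andP[].
Qed.

Let lam := cmod lambda.
Let lam0 : 0 < lam. Proof. by rewrite /lam cmod_gt0. Qed.

(** The quotients c_m / lambda^m have successive ratios al(q^m) / be(q^(m+1)), which tend to 1
    geometrically because [al] and [be] have the same constant term. *)
Lemma hyper_coef_bounds : exists m1 lo hi, [/\ 0 < lo,
  forall m, cmod (c m) <= hi * lam ^+ m &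
  forall m, (m1 <= m)%N -> lo * lam ^+ m <= cmod (c m)].
Proof.
have [L1 L10 HL1] := poly_lipschitz0 al; have [L2 L20 HL2] := poly_lipschitz0 be.
pose e0 := cmod be`_0; have e0p : 0 < e0 by rewrite /e0 cmod_gt0.
have e02 : 0 < e0 / 2 by rewrite divr_gt0.
have [m0 hm0] := expM_small L2 (ltW q_gt0) q_lt1 e02.
have qm m : cmod (q ^+ m) <= 1 by rewrite cmodX exprn_ile1 // ltW.
pose g m := c m / lambda ^+ m; pose rho m := al.[q ^+ m] / be.[q ^+ m.+1].
have lm m : lambda ^+ m != 0 by rewrite expf_neq0.
have [||||m||m1 [lo [hi [lo0 ghi glo]]]] :=
  @product_bounds g rho (2 * (L1 + L2) / e0) (cmod q) m0.
- by rewrite divr_ge0 ?mulr_ge0 ?addr_ge0 // ltW.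
- by [].
- by [].
- by move=> m; rewrite /g mulf_neq0 ?invr_eq0.
- apply: (mulfI (lm m.+1)); rewrite mulrCA divff // mulr1.
  apply: (mulfI (beq m)); rewrite crec /rho /g [lambda ^+ _.+1]exprS; field.
  by rewrite lm beq.
- move=> m m0m; have bq : e0 / 2 <= cmod be.[q ^+ m.+1].
    have := HL2 (q ^+ m.+1) (qm _); have := cmodB be.[q ^+ m.+1] (be.[q ^+ m.+1] - be`_0).
    rewrite (_ : _ - (_ - _) = be`_0); last by ring.
    rewrite -/e0 => h1 h2; have h3 : L2 * cmod (q ^+ m.+1) <= L2 * cmod q ^+ m0.
      by rewrite ler_wpM2l // cmodX ler_wiXn2l ?(ltW q_gt0) ?(ltW q_lt1) // leqW.
    lra.
  have -> : rho m - 1 = (al.[q ^+ m] - be.[q ^+ m.+1]) / be.[q ^+ m.+1].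
    by rewrite /rho mulrBl divff.
  rewrite cmodM cmodV ler_pdivrMr; last by apply: lt_le_trans bq.
  apply: (@le_trans _ _ ((L1 + L2) * cmod q ^+ m)).
    have -> : al.[q ^+ m] - be.[q ^+ m.+1] =
      (al.[q ^+ m] - al`_0) - (be.[q ^+ m.+1] - be`_0) by rewrite ab0; ring.
    apply: le_trans (cmodB _ _) _; rewrite mulrDl; apply: lerD.
      by rewrite -cmodX; apply: HL1.
    apply: le_trans (HL2 _ (qm _)) _; rewrite ler_wpM2l // cmodX exprS.
    by rewrite ler_piMl ?exprn_ge0 ?(ltW q_gt0) ?(ltW q_lt1).
  rewrite [leLHS](_ : _ = 2 * (L1 + L2) / e0 * cmod q ^+ m * (e0 / 2)).
    rewrite ler_wpM2l // mulr_ge0 ?exprn_ge0 ?divr_ge0 ?mulr_ge0 ?addr_ge0 //; exact: ltW.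
  by field; rewrite gt_eqF.
have gE m : cmod (c m) = cmod (g m) * lam ^+ m.
  by rewrite /g cmodM cmodV cmodX mulfVK // expf_neq0 // gt_eqF.
exists m1, lo, hi; split=> // m => [|mm]; rewrite gE ler_wpM2r ?exprn_ge0 ?(ltW lam0) //.
exact: glo.
Qed.

(** The coefficient of sigma_q^l in the operator, at the point z. For l = 0 it vanishes only at
    1/lambda, which is the origin of the poles. *)
Definition hcoef (l : nat) (z : C) : C := lambda * z * al`_l - be`_l.

Lemma hcoef0 z : hcoef 0 z = be`_0 * (lambda * z - 1).
Proof. by rewrite /hcoef ab0; ring. Qed.

(** By the recurrence the sum telescopes to its boundary terms, and the one at 0 vanishes because
    be(1) = 0. *)
Lemma hyper_partial_sum z M :
  \sum_(l < n.+1) hcoef l z * (\sum_(m < M) c m * (q ^+ l * z) ^+ m) =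
  be.[q ^+ M] * c M * z ^+ M.
Proof.
have e m : \sum_(l < n.+1) hcoef l z * (c m * (q ^+ l * z) ^+ m) =
    (be.[q ^+ m.+1] * c m.+1 * z ^+ m.+1) - (be.[q ^+ m] * c m * z ^+ m).
  rewrite crec (@horner_coef_wide _ n.+1 be) ?sbe // (@horner_coef_wide _ n.+1 al) ?sal //.
  rewrite mulr_sumr !mulr_suml -sumrB; apply: eq_bigr => l _.
  rewrite /hcoef exprMn -!exprM [(m * l)%N]mulnC exprS; ring.
under eq_bigr do rewrite mulr_sumr.
rewrite exchange_big /=; under eq_bigr do rewrite e.
rewrite -(big_mkord xpredT (fun m => be.[q ^+ m.+1] * c m.+1 * z ^+ m.+1 - be.[q ^+ m] * c m * z ^+ m)).
by rewrite telescope_sumr // expr0 be1 mul0r mul0r subr0.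
Qed.

Section Phi.
Variables (phi0 : C -> C) (hi : R).
Hypothesis phi0P : forall w M, lam * cmod w < 1 ->
  cmod (phi0 w - \sum_(m < M) c m * w ^+ m) <= hi / (1 - lam * cmod w) * (lam * cmod w) ^+ M.
Hypothesis hi_bound : forall m, cmod (c m) <= hi * lam ^+ m.

Let hi0 : 0 <= hi. Proof. exact: geometric_ge0 hi_bound. Qed.

Let qle l z : lam * cmod (q ^+ l * z) <= lam * cmod z.
Proof.
rewrite ler_wpM2l ?(ltW lam0) // cmodM cmodX ler_piMl ?cmod_ge0 //.
by rewrite exprn_ile1 ?(ltW q_gt0) ?(ltW q_lt1).
Qed.

Let lz0 z : 0 <= lam * cmod z. Proof. by rewrite mulr_ge0 ?cmod_ge0 ?(ltW lam0). Qed.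

Lemma phi0_tail w (t : R) M : lam * cmod w <= t -> t < 1 ->
  cmod (phi0 w - \sum_(m < M) c m * w ^+ m) <= hi / (1 - t) * t ^+ M.
Proof.
move=> wt t1; have w1 : lam * cmod w < 1 by apply: le_lt_trans t1.
apply: le_trans (phi0P M w1) _; apply: ler_pM.
- by rewrite divr_ge0 // subr_ge0 ltW.
- by rewrite exprn_ge0.
- by rewrite ler_wpM2l // lef_pV2 ?posrE ?subr_gt0 // lerD2l lerN2.
- by rewrite lerXn2r ?nnegrE // (le_trans (lz0 w)).
Qed.

(** The equation holds up to the tails of the series and the boundary term of [hyper_partial_sum],
    all bounded by a multiple of t^M for every M. *)
Lemma phi0_eq z : lam * cmod z < 1 -> \sum_(l < n.+1) hcoef l z * phi0 (q ^+ l * z) = 0.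
Proof.
move=> z1; apply/eqP; rewrite -cmod_eq0; apply/eqP; set t := lam * cmod z in z1.
have [L L0 HL] := poly_lipschitz0 be.
pose k := \sum_(l < n.+1) cmod (hcoef l z) * (hi / (1 - t)).
pose b := cmod be`_0 + L.
apply: (@geometric_bound_eq0 R _ (k + b * hi) t) => //; rewrite ?lz0 ?cmod_ge0 // => M.
have -> : \sum_(l < n.+1) hcoef l z * phi0 (q ^+ l * z) =
   \sum_(l < n.+1) hcoef l z * (phi0 (q ^+ l * z) - \sum_(m < M) c m * (q ^+ l * z) ^+ m)
   + be.[q ^+ M] * c M * z ^+ M.
  rewrite -hyper_partial_sum -big_split; apply: eq_bigr => l _ /=.
  by rewrite -mulrDr subrK.
apply: le_trans (cmodD _ _) _; rewrite mulrDl; apply: lerD.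
  apply: le_trans (cmod_sum _ _ _) _; rewrite /k mulr_suml; apply: ler_sum => l _.
  rewrite cmodM -mulrA ler_wpM2l ?cmod_ge0 //.
  by apply: phi0_tail => //; apply: qle.
rewrite !cmodM cmodX -mulrA -mulrA; apply: ler_pM; rewrite ?mulr_ge0 ?exprn_ge0 ?cmod_ge0 //.
  rewrite -[be.[_]](subrK be`_0) addrC; apply: le_trans (cmodD _ _) _.
  have q1' : cmod (q ^+ M) <= 1 by rewrite cmodX exprn_ile1 // ltW.
  rewrite lerD2l; apply: le_trans (HL _ q1') _.
  by rewrite -[leRHS]mulr1 ler_wpM2l.
by rewrite exprMn mulrA ler_wpM2r ?exprn_ge0 ?cmod_ge0.
Qed.

(** Recursion on fuel: each use of the equation brings the arguments closer to the disc by a factor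
    of at least |q|, so k steps suffice once lam |z| |q|^k < 1. The value for exhausted fuel and the
    one at 1/lambda, where the divisor is 0, are defaults. *)
Fixpoint phik (k : nat) (z : C) : C :=
  if lam * cmod z < 1 then phi0 z else
  if k is k'.+1 then - (\sum_(l < n) hcoef l.+1 z * phik k' (q ^+ l.+1 * z)) / hcoef 0 z
  else 0.

Let step_le k l z : lam * cmod (q ^+ l.+1 * z) * cmod q ^+ k <= lam * cmod z * cmod q ^+ k.+1.
Proof.
have -> : lam * cmod (q ^+ l.+1 * z) * cmod q ^+ k =
    lam * cmod z * cmod q ^+ k.+1 * cmod q ^+ l.
  by rewrite cmodM cmodX !exprS; ring.
rewrite ler_piMr ?mulr_ge0 ?exprn_ge0 ?cmod_ge0 ?(ltW lam0) //.
by rewrite exprn_ile1 ?cmod_ge0 // ltW.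
Qed.

Lemma phik_stable k z : lam * cmod z * cmod q ^+ k < 1 -> phik k.+1 z = phik k z.
Proof.
elim: k z => [|k IH] z; first by rewrite expr0 mulr1 /= => ->.
move=> zk; rewrite [LHS]/= [RHS]/=; case: ifP => // _.
congr (- _ / _); apply: eq_bigr => l _; congr (_ * _); apply: IH.
exact: le_lt_trans zk.
Qed.

Lemma phik_stableD j k z : lam * cmod z * cmod q ^+ k < 1 -> phik (k + j) z = phik k z.
Proof.
move=> zk; elim: j => [|j IH]; first by rewrite addn0.
rewrite addnS phik_stable ?IH //; apply: le_lt_trans zk.
rewrite ler_wpM2l // exprD ler_piMr ?exprn_ge0 ?cmod_ge0 //.
by rewrite exprn_ile1 ?cmod_ge0 // ltW.
Qed.

Lemma depth_ex z : exists k, lam * cmod z * cmod q ^+ k < 1.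
Proof. exact: expM_small (ltW q_gt0) q_lt1 ltr01. Qed.

Definition phi (z : C) : C := phik (projT1 (boolp.cid (depth_ex z))) z.

Lemma phiE k z : lam * cmod z * cmod q ^+ k < 1 -> phi z = phik k z.
Proof.
move=> zk; rewrite /phi; case: boolp.cid => j /= zj.
by rewrite -(phik_stableD k zj) addnC phik_stableD.
Qed.

Lemma phi_small z : lam * cmod z < 1 -> phi z = phi0 z.
Proof. by move=> z1; rewrite (@phiE 0) ?expr0 ?mulr1 //= z1. Qed.

Lemma hcoef0_neq0 z : lambda * z != 1 -> hcoef 0 z != 0.
Proof. by move=> z1; rewrite hcoef0 mulf_neq0 // subr_eq0. Qed.

Lemma phi_rec z : lambda * z != 1 ->
  phi z = - (\sum_(l < n) hcoef l.+1 z * phi (q ^+ l.+1 * z)) / hcoef 0 z.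
Proof.
move=> lz1; have h0 := hcoef0_neq0 lz1; have [z1|z1] := ltP (lam * cmod z) 1.
  have := phi0_eq z1; rewrite big_ord_recl expr0 mul1r => /eqP.
  rewrite addr_eq0 => /eqP e; apply: (mulIf h0); rewrite divfK // phi_small // mulrC e.
  congr (- _); apply: eq_bigr => l _; rewrite lift0 phi_small //.
  exact: le_lt_trans z1.
have [k zk] := depth_ex z; have zk1 : lam * cmod z * cmod q ^+ k.+1 < 1.
  apply: le_lt_trans zk; rewrite ler_wpM2l // exprS ler_piMl ?exprn_ge0 ?cmod_ge0 //.
  exact: ltW.
rewrite (phiE zk1) /= ltNge z1 /=; congr (- _ / _).
apply: eq_bigr => l _; rewrite (@phiE k) //; exact: le_lt_trans zk1.
Qed.

Lemma phi_eq z : lambda * z != 1 -> \sum_(l < n.+1) hcoef l z * phi (q ^+ l * z) = 0.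
Proof.
move=> lz1; rewrite big_ord_recl expr0 mul1r (phi_rec lz1) mulrC divfK ?hcoef0_neq0 //.
rewrite addrC; apply/eqP; rewrite subr_eq0; apply/eqP; apply: eq_bigr => l _.
by rewrite lift0.
Qed.

Lemma phi0_continuous Z z0 : tends Z z0 -> lam * cmod z0 < 1 ->
  tends (fun t => phi0 (Z t)) (phi0 z0).
Proof.
move=> Zz z01 e e0; pose t := (1 + lam * cmod z0) / 2.
have t1 : t < 1 by rewrite /t; lra.
have t0 : 0 <= t by rewrite /t divr_ge0 // addr_ge0.
have e3 : 0 < e / 3 by rewrite divr_gt0.
have [M HM] := expM_small (hi / (1 - t)) t0 t1 e3.
have d0 : 0 < (t - lam * cmod z0) / lam by rewrite divr_gt0 // /t; lra.
pose T := \poly_(m < M) c m.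
have TE z : T.[z] = \sum_(m < M) c m * z ^+ m by rewrite horner_poly.
apply: near0_imp (near0_and (Zz _ d0) (tends_horner T Zz e3)) => s [h1 h2].
have Zt : lam * cmod (Z s) <= t.
  rewrite ltr_pdivlMr // in h1.
  have := cmodD (Z s - z0) z0; rewrite subrK => h3.
  by have : cmod (Z s) * lam <= (cmod (Z s - z0) + cmod z0) * lam; [rewrite ler_wpM2r // ltW|lra].
have zt : lam * cmod z0 <= t by rewrite /t; lra.
have := phi0_tail M Zt t1; have := phi0_tail M zt t1; rewrite -!TE => h3 h4.
rewrite (_ : phi0 (Z s) - phi0 z0 = (phi0 (Z s) - T.[Z s]) - (phi0 z0 - T.[z0])
   + (T.[Z s] - T.[z0])); last by ring.
apply: le_lt_trans (cmodD _ _) _; have := cmodB (phi0 (Z s) - T.[Z s]) (phi0 z0 - T.[z0]).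
by lra.
Qed.

Lemma tends_hcoef l Z z0 : tends Z z0 -> tends (fun t => hcoef l (Z t)) (hcoef l z0).
Proof.
move=> Zz; apply: tendsB; last exact: tends_cst.
by apply: tendsM; [apply: tendsM => //|]; exact: tends_cst.
Qed.

(** Induction on the number of steps needed to reach the disc: off the polar spiral the equation
    writes phi(z) through the q^(l+1) z, which are again off the spiral. *)
Lemma phi_continuous Z z0 : tends Z z0 -> (forall K, lambda * z0 * q ^+ K != 1) ->
  tends (fun t => phi (Z t)) (phi z0).
Proof.
have [k] := depth_ex z0; elim: k Z z0 => [|k IH] Z z0 zk Zz good.
  rewrite expr0 mulr1 in zk; rewrite phi_small //.
  apply: tends_near (phi0_continuous Zz zk).
  have d0 : 0 < (1 - lam * cmod z0) / lam by rewrite divr_gt0 // subr_gt0.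
  apply: near0_imp (Zz _ d0) => t ht; rewrite phi_small //.
  rewrite ltr_pdivlMr // in ht; have := cmodD (Z t - z0) z0; rewrite subrK => h3.
  by have : cmod (Z t) * lam <= (cmod (Z t - z0) + cmod z0) * lam; [rewrite ler_wpM2r // ltW|lra].
have lz1 : lambda * z0 != 1 by have := good 0%N; rewrite expr0 mulr1.
rewrite (phi_rec lz1).
have lZ : tends (fun t => lambda * Z t) (lambda * z0) by apply: tendsM => //; apply: tends_cst.
apply: (tends_near (f := fun t => - (\sum_(l < n) hcoef l.+1 (Z t) * phi (q ^+ l.+1 * Z t)) / hcoef 0 (Z t))).
  by apply: near0_imp (tends_neq lZ lz1) => t h; rewrite -phi_rec.
apply: tendsM; last by apply: tendsV; [exact: hcoef0_neq0|exact: tends_hcoef].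
apply/tendsN/tends_sum => l; apply: tendsM; first exact: tends_hcoef.
apply: (IH (fun t => q ^+ l.+1 * Z t)) => [||K].
- exact: le_lt_trans zk.
- by apply: tendsM => //; apply: tends_cst.
- rewrite (_ : lambda * _ * _ = lambda * z0 * q ^+ (l.+1 + K)) //.
  by rewrite exprD; ring.
Qed.

(** The number r is the R_K of a polar part R_K / (1 - lambda q^K z); r = 0 is allowed. *)
Definition polar (K : nat) (r : C) := forall Z, tends Z (q ^- K / lambda) ->
  near0 (fun t => lambda * q ^+ K * Z t != 1) ->
  tends (fun t => (1 - lambda * q ^+ K * Z t) * phi (Z t)) r.

Let qK_neq0 K : q ^+ K != 0. Proof. by rewrite expf_neq0. Qed.

Let qK_neq1 K j : (K <= j)%N -> lambda * (q ^+ j.+1 * (q ^- K / lambda)) != 1.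
Proof.
move=> Kj; rewrite (_ : _ * _ = q ^+ (j - K).+1) //.
rewrite -{1}(subnK Kj) -addSn exprD; field.
by rewrite lambda0 qK_neq0.
Qed.

(** Multiplication by q^(l+1) moves the K-th pole to the pole of index K - l - 1 if l < K. Otherwise
    it moves it to a regular point, where the vanishing factor gives the limit 0. *)
Lemma polar_shift K (r : nat -> C) l : (forall K', (K' < K)%N -> polar K' (r K')) ->
  forall Z, tends Z (q ^- K / lambda) ->
  near0 (fun t => lambda * q ^+ K * Z t != 1) ->
  tends (fun t => (1 - lambda * q ^+ K * Z t) * phi (q ^+ l.+1 * Z t))
    (if (l < K)%N then r (K - l.+1)%N else 0).
Proof.
move=> rP Z Zz Z1; have qZ : tends (fun t => q ^+ l.+1 * Z t) (q ^+ l.+1 * (q ^- K / lambda)).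
  by apply: tendsM => //; apply: tends_cst.
case: ltnP => lK.
  have e t : lambda * q ^+ K * Z t = lambda * q ^+ (K - l.+1) * (q ^+ l.+1 * Z t).
    by rewrite -{1}(subnK lK) exprD; ring.
  have kK : (K - l.+1 < K)%N by lia.
  have zE : q ^+ l.+1 * (q ^- K / lambda) = q ^- (K - l.+1) / lambda.
    rewrite -{1}(subnK lK) exprD; field.
    by rewrite lambda0 !qK_neq0.
  rewrite zE in qZ; apply: tends_ext (rP _ kK _ qZ _) => [t|].
    by rewrite -e.
  by apply: near0_imp Z1 => t; rewrite e.
rewrite -[X in tends _ X](mul0r (phi (q ^+ l.+1 * (q ^- K / lambda)))).
apply: tendsM.
  rewrite (_ : 0 = 1 - lambda * q ^+ K * (q ^- K / lambda)).
    by apply: tendsB; [|apply: tendsM => //]; exact: tends_cst.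
  by field; rewrite lambda0 qK_neq0.
apply: phi_continuous => // j.
rewrite (_ : lambda * _ * _ = lambda * (q ^+ (l + j).+1 * (q ^- K / lambda))).
  by apply: qK_neq1; apply: leq_trans (leq_addr _ _).
by rewrite -addSn exprD; ring.
Qed.

Lemma polar_unique K r r' : polar K r -> polar K r' -> r = r'.
Proof.
move=> rP rP'; pose Z t : C := q ^- K / lambda * (1 + t).
have Zz : tends Z (q ^- K / lambda).
  rewrite -[X in tends _ X]mulr1 -[X in _ * X]addr0.
  by apply: tendsM; [|apply: tendsD; last exact: tends_id]; exact: tends_cst.
have Z1 : near0 (fun t => lambda * q ^+ K * Z t != 1).
  exists 1 => // t t0 _; rewrite (_ : _ * _ = 1 + t).
    by rewrite -subr_eq0 addrC addKr.
  by rewrite /Z; field; rewrite lambda0 qK_neq0.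
exact: tends_unique (rP _ Zz Z1) (rP' _ Zz Z1).
Qed.

Let near_lz K Z : tends Z (q ^- K / lambda) ->
  near0 (fun t => lambda * q ^+ K * Z t != 1) -> near0 (fun t => lambda * Z t != 1).
Proof.
case: K => [|K] Zz; first by apply: near0_imp => t; rewrite expr0 mulr1.
move=> _; have lZ : tends (fun t => lambda * Z t) (lambda * (q ^- K.+1 / lambda)).
  by apply: tendsM => //; exact: tends_cst.
apply: tends_neq lZ _; rewrite mulrC divfK //.
by rewrite invr_eq1 q1.
Qed.

(** All q^(l+1) / lambda are regular points, so the pole at 1/lambda comes from the zero of [hcoef]
    0 alone. *)
Lemma polar0 :
  polar 0 (\sum_(l < n) hcoef l.+1 lambda^-1 * phi (q ^+ l.+1 / lambda) / be`_0).
Proof.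
move=> Z Zz Z1; have Z1' := near_lz Zz Z1.
rewrite expr0 invr1 mul1r in Zz.
apply: (tends_near (f := fun t => \sum_(l < n) hcoef l.+1 (Z t) * phi (q ^+ l.+1 * Z t) / be`_0)).
  apply: near0_imp Z1' => t h; rewrite (phi_rec h) hcoef0 -mulr_suml expr0 mulr1.
  have lz : lambda * Z t - 1 != 0 by rewrite subr_eq0.
  by field; rewrite be0 lz.
apply: tends_sum => l; apply: tendsM; last exact: tends_cst.
apply: tendsM; first exact: tends_hcoef.
apply: phi_continuous => [|j]; first by apply: tendsM => //; exact: tends_cst.
have := @qK_neq1 0 (l + j)%N (leq0n _); rewrite expr0 invr1 mul1r.
by rewrite -addSn exprD -!mulrA [_ / _]mulrC.
Qed.

(** For K > 0, [hcoef] 0 does not vanish at the pole, and the equation multiplied by 1 - lambda q^K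
    z becomes a recurrence between polar coefficients. *)
Lemma polarS K (r : nat -> C) : (forall K', (K' < K)%N -> polar K' (r K')) -> (0 < K)%N ->
  polar K (- (\sum_(l < n) hcoef l.+1 (q ^- K / lambda) *
      (if (l < K)%N then r (K - l.+1)%N else 0)) / hcoef 0 (q ^- K / lambda)).
Proof.
move=> rP K0 Z Zz Z1; have Z1' := near_lz Zz Z1.
apply: (tends_near (f := fun t => - (\sum_(l < n) hcoef l.+1 (Z t) *
   ((1 - lambda * q ^+ K * Z t) * phi (q ^+ l.+1 * Z t))) / hcoef 0 (Z t))).
  apply: near0_imp Z1' => t h; rewrite (phi_rec h); set u := 1 - _.
  set S := \sum_(l < n) hcoef l.+1 (Z t) * phi _.
  have -> : \sum_(l < n) hcoef l.+1 (Z t) * (u * phi (q ^+ l.+1 * Z t)) = u * S.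
    by rewrite mulr_sumr; apply: eq_bigr => l _; rewrite mulrCA.
  ring.
apply: tendsM; last first.
  apply: tendsV; last exact: tends_hcoef.
  apply: hcoef0_neq0; rewrite mulrC divfK // invr_eq1.
  by case: K K0 {rP Z Zz Z1 Z1'} => // K _.
apply/tendsN/tends_sum => l; apply: tendsM; first exact: tends_hcoef.
exact: polar_shift.
Qed.

Lemma polar_ex : exists r, forall K, polar K (r K).
Proof.
(* Each coefficient depends on all earlier ones: finite families are extended one index at a time,
   and the diagonal is taken. *)
have H K : exists r : nat -> C, forall K', (K' < K)%N -> polar K' (r K').
  elim: K => [|K [r rP]]; first by exists (fun=> 0).
  have [r0 r0P] : exists r0, polar K r0.
    case: (posnP K) => [->|K0]; first by eexists; exact: polar0.
    by eexists; exact: polarS rP K0.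
  exists (fun k => if k == K then r0 else r k) => k.
  rewrite ltnS leq_eqVlt; case: eqP => [->//|_] /=; exact: rP.
have [f fP] := boolp.choice H; exists (fun K => f K.+1 K) => K.
exact: fP.
Qed.

(** At z = 1/lambda the term l = 0 of [hyper_partial_sum] disappears. If R_0 = 0, the other terms
    reduce to tails of series, so that c_M / lambda^M is O(|q|^M), against its lower bound. *)
Lemma residue0_neq0 r : polar 0 r -> r != 0.
Proof.
move=> rP; apply/eqP => r0; have := polar_unique rP polar0; rewrite {}r0 => /esym.
rewrite -mulr_suml => /eqP; rewrite mulf_eq0 invr_eq0 (negPf be0) orbF => /eqP S0.
have [m1 [lo [_ [lo0 _ clo]]]] := hyper_coef_bounds.
have [L L0 HL] := poly_lipschitz0 be.
pose Q := cmod q; have Q0 : 0 <= Q by rewrite /Q ltW.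
pose k := \sum_(l < n) cmod (hcoef l.+1 lambda^-1) * (hi / (1 - Q)).
have lq l : lam * cmod (q ^+ l.+1 / lambda) <= Q.
  rewrite cmodM cmodV cmodX -/lam mulrCA divff ?mulr1; last by rewrite gt_eqF.
  by rewrite exprS ler_piMr // exprn_ile1 // ltW.
have bound M : cmod be.[q ^+ M] * (cmod (c M) / lam ^+ M) <= k * Q ^+ M.
  have := hyper_partial_sum lambda^-1 M.
  rewrite big_ord_recl hcoef0 divff // subrr mulr0 mul0r add0r.
  move=> e0; have e : \sum_(l < n) (hcoef (lift ord0 l) lambda^-1 *
      (\sum_(m < M) c m * (q ^+ lift ord0 l / lambda) ^+ m) -
      hcoef l.+1 lambda^-1 * phi (q ^+ l.+1 / lambda)) = be.[q ^+ M] * c M * lambda^-1 ^+ M.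
    by rewrite sumrB S0 subr0 e0.
  have -> : cmod be.[q ^+ M] * (cmod (c M) / lam ^+ M) =
      cmod (be.[q ^+ M] * c M * lambda^-1 ^+ M).
    by rewrite !cmodM cmodX cmodV exprVn mulrA.
  rewrite -e; apply: le_trans (cmod_sum _ _ _) _; rewrite /k mulr_suml.
  apply: ler_sum => l _; rewrite lift0 -mulrBr cmodM -mulrA ler_wpM2l ?cmod_ge0 //.
  rewrite cmodBC phi_small; last exact: le_lt_trans (lq l) q_lt1.
  exact: phi0_tail.
have e0p : 0 < cmod be`_0 by rewrite cmod_gt0.
(* Both the tails and the distance from be(q^M) to be_0 decay like |q|^M, while lo |be_0| is fixed;
   M is taken where the latter dominates. *)
have [M HM] := expM_small ((k + lo * L) * Q ^+ m1) Q0 q_lt1 (mulr_gt0 lo0 e0p).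
have mM : (m1 <= m1 + M)%N by rewrite leq_addr.
rewrite -mulrA -exprD in HM; have b1 := bound (m1 + M)%N.
have b2 : lo <= cmod (c (m1 + M)%N) / lam ^+ (m1 + M).
  by rewrite ler_pdivlMr ?exprn_gt0 // clo.
have q1' : cmod (q ^+ (m1 + M)) <= 1 by rewrite cmodX exprn_ile1 // ltW.
have b3 := HL _ q1'.
have := cmodB be.[q ^+ (m1 + M)] (be.[q ^+ (m1 + M)] - be`_0).
rewrite (_ : _ - (_ - _) = be`_0); last by ring.
rewrite cmodX -/Q in b3 => b4.
have b5 : cmod be.[q ^+ (m1 + M)] * lo <= k * Q ^+ (m1 + M).
  by apply: le_trans b1; rewrite ler_wpM2l ?cmod_ge0.
have b6 : cmod be`_0 * lo <=
    (cmod be.[q ^+ (m1 + M)] + cmod (be.[q ^+ (m1 + M)] - be`_0)) * lo.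
  by rewrite ler_wpM2r // ltW.
have b7 : cmod (be.[q ^+ (m1 + M)] - be`_0) * lo <= L * Q ^+ (m1 + M) * lo.
  by rewrite ler_wpM2r // ltW.
by move: HM; rewrite ltNge => /negP; apply; lra.
Qed.

Hypothesis no_poly : forall D : {poly C}, D`_0 != 0 ->
  al * D = (be * D) \Po (q *: 'X) -> False.

(** The recurrence has order n, so n consecutive zeros propagate and the R_K are the coefficients of
    a polynomial D. Read on D, the recurrence is the equation excluded by [no_poly]. *)
Lemma residue_neq0 r : (forall K, polar K (r K)) ->
  forall K, exists2 j, (j < n)%N & r (K + j)%N != 0.
Proof.
move=> rP K; apply: contrapT => nr.
have rK0 j : (j < n)%N -> r (K + j)%N = 0.
  move=> jn; apply/eqP; apply: contrapT => /negP h; apply: nr.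
  by exists j.
have rS m : (0 < m)%N -> r m = - (\sum_(l < n) hcoef l.+1 (q ^- m / lambda) *
      (if (l < m)%N then r (m - l.+1)%N else 0)) / hcoef 0 (q ^- m / lambda).
  by move=> m0; apply: polar_unique (polarS (fun K' _ => rP K') m0).
have r00 : r 0%N != 0 by apply: residue0_neq0.
have n0 : (0 < n)%N.
  rewrite lt0n; apply: contraNneq be0 => n0.
  have := be1; rewrite (@horner_coef_wide _ n.+1) ?sbe // n0 big_ord1 expr0 mulr1.
  by move=> ->.
have r0 m : (K <= m)%N -> r m = 0.
  elim/ltn_ind: m => m IH Km; have [mK|Kn] := ltnP m (K + n).
    by rewrite -(subnKC Km) rK0 // ltn_subLR.
  rewrite rS; last by lia.
  rewrite big1 ?oppr0 ?mul0r // => l _; have ln := ltn_ord l.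
  by rewrite (leq_trans ln) ?IH ?mulr0 //; lia.
pose D := \poly_(m < K) r m.
have DE m : D`_m = r m by rewrite coef_poly; case: ltnP => // /r0.
apply: (no_poly (D := D)); first by rewrite DE.
apply/polyP => m; rewrite comp_scaleX !coefM mulr_sumr.
have [->|m0] := posnP m; first by rewrite !big_ord1 expr0 mul1r ab0.
apply/eqP; rewrite -subr_eq0 -sumrB; apply/eqP.
have qm := qK_neq0 m; apply: (mulfI (invr_neq0 qm)); rewrite mulr0 mulr_sumr.
have hE l : hcoef l (q ^- m / lambda) = q ^- m * al`_l - be`_l.
  by rewrite /hcoef; congr (_ * _ - _); rewrite mulrC divfK.
rewrite (eq_bigr (fun l : 'I_m.+1 => hcoef l (q ^- m / lambda) * r (m - l)%N)); last first.
  move=> l _; rewrite hE !DE; field; exact: qm.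
have h0 : hcoef 0 (q ^- m / lambda) != 0.
  apply: hcoef0_neq0; rewrite mulrC divfK // invr_eq1.
  by case: (m) m0 => // k _.
have := rS m m0 => /(congr1 (fun x => hcoef 0 (q ^- m / lambda) * x)).
rewrite [X in _ = X]mulrC divfK // => /eqP; rewrite -addr_eq0 => /eqP.
rewrite big_ord_recl /= subn0 => e; rewrite -[RHS]e; congr (_ + _).
pose F l := hcoef l.+1 (q ^- m / lambda) * r (m - l.+1)%N.
rewrite (eq_bigr (fun l : 'I_m => F l)); last by move=> l _; rewrite /bump leq0n add1n.
rewrite [RHS](eq_bigr (fun l : 'I_n => if (l < m)%N then F l else 0)); last first.
  by move=> l _; case: ifP => // _; rewrite mulr0.
(* Both sums are extended to a common range; the extra terms vanish because [al] and [be] have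
   degree n. *)
rewrite (big_ord_widen (n + m) F) ?leq_addl //.
rewrite (big_ord_widen (n + m) (fun l => if (l < m)%N then F l else 0)) ?leq_addr //.
rewrite [LHS]big_mkcond [RHS]big_mkcond; apply: eq_bigr => l _.
case: (ltnP l m) => lm; last by case: ifP.
case: ltnP => // nl.
by rewrite /F hE !nth_default ?sal ?sbe // mulr0 subr0 mul0r.
Qed.

End Phi.

Lemma hyper_continuation :
  (forall D : {poly C}, D`_0 != 0 -> al * D = (be * D) \Po (q *: 'X) -> False) ->
  exists (phi : C -> C) (r : nat -> C), [/\
    exists s k, germ_data c s k phi,
    forall z, lambda * z != 1 -> \sum_(l < n.+1) hcoef l z * phi (q ^+ l * z) = 0,
    forall Z z0, tends Z z0 -> (forall K, lambda * z0 * q ^+ K != 1) ->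
      tends (fun t => phi (Z t)) (phi z0),
    forall K Z, tends Z (q ^- K / lambda) ->
      near0 (fun t => lambda * q ^+ K * Z t != 1) ->
      tends (fun t => (1 - lambda * q ^+ K * Z t) * phi (Z t)) (r K) &
    forall K, exists2 j, (j < n)%N & r (K + j)%N != 0].
Proof.
move=> no_poly; have [_ [_ [hi [_ chi _]]]] := hyper_coef_bounds.
have [phi0 phi0P] := power_series_sum lam0 chi.
have hi0 := geometric_ge0 chi.
(* [power_series_sum] loses a factor 2, so the constant is doubled to fit both hypotheses on
   [phi0]. *)
have chi2 m : cmod (c m) <= 2 * hi * lam ^+ m.
  by apply: le_trans (chi m) _; rewrite ler_wpM2r ?exprn_ge0 ?(ltW lam0) //; lra.
have [r rP] := polar_ex phi0P chi2.
exists (phi phi0), r; split.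
(* On the disc of half the radius, 1 / (1 - lam |w|) is at most 2. *)
- exists (2 * lam), (2 * (2 * hi)); split; first by rewrite mulr_gt0.
    move=> m; apply: le_trans (chi m) _; apply: ler_pM => //; first by rewrite exprn_ge0 // ltW.
      lra.
    by rewrite exprMn ler_peMl ?exprn_ge0 ?(ltW lam0) // exprn_ege1 // ler1n.
  move=> w M w1; have t2 : lam * cmod w <= 2^-1 by rewrite -mulrA in w1; lra.
  have t0 : 0 <= lam * cmod w by rewrite mulr_ge0 ?cmod_ge0 // ltW.
  have t1 : lam * cmod w < 1 by lra.
  rewrite (phi_small _ t1); apply: le_trans (phi0P w M t1) _; apply: ler_pM.
  + by rewrite divr_ge0 ?mulr_ge0 // subr_ge0 ltW.
  + by rewrite exprn_ge0.
  + rewrite ler_pdivrMr ?subr_gt0 //.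
    have : 0 <= hi * (2^-1 - lam * cmod w) by rewrite mulr_ge0 // subr_ge0.
    by lra.
  + rewrite lerXn2r ?nnegrE ?mulr_ge0 ?cmod_ge0 ?(ltW lam0) // -mulrA; lra.
- exact: phi_eq phi0P chi2.
- exact: phi_continuous phi0P chi2.
- exact: rP.
- exact: residue_neq0 phi0P chi2 no_poly r rP.
Qed.

End Continuation.

(** * Multivariate polynomials *)

Section Multivariate.

Lemma mmap_muni (k : nat) (S T : comNzRingType) (f : {rmorphism S -> T})
    (h : 'I_k.+1 -> T) (P : mpoly k.+1 S) :
  mmap f h P = (map_poly (mmap f (fun i : 'I_k => h (widen_ord (leqnSn k) i))) (muni P)).[h ord_max].
Proof.
rewrite muniE rmorph_sum horner_sum; apply: eq_bigr => m _ /=.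
rewrite map_polyZ map_polyXn hornerZ hornerXn /= mmapZ mmapX -mulrA; congr (_ * _).
rewrite /mmap1 big_ord_recr /=; congr (_ * _).
by apply: eq_bigr => i _; rewrite mnmE.
Qed.

Lemma muni_eq0 (k : nat) (S : nzRingType) (P : mpoly k.+1 S) : muni P = 0 -> P = 0.
Proof.
move=> P0; apply/mpolyP => m; rewrite mcoeff0.
pose w (m : multinom k.+1) : multinom k :=
  Multinom [tuple m (widen_ord (leqnSn k) i) | i < k].
have : mcoeff (w m) (muni P)`_(m ord_max) = 0 by rewrite P0 coef0 mcoeff0.
rewrite muniE coef_sum raddf_sum /=.
rewrite (eq_bigr (fun m' => if m' == m then mcoeff m P else 0)); last first.
  move=> m' _; rewrite coefZ coefXn.
  have -> : Multinom [tuple m' (widen_ord (leqnSn k) i) | i < k] = w m' by [].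
  case: (eqVneq m' m) => [->|m'm]; first by rewrite eqxx mulr1 mcoeffZ mcoeffX eqxx mulr1.
  case: eqP => [mm|]; last by rewrite mulr0 mcoeff0.
  rewrite mulr1 mcoeffZ mcoeffX; case: eqP => [ww|]; last by rewrite mulr0.
  case/eqP: m'm; apply/mnmP => i; have [->//|im] := eqVneq i ord_max.
  have ik : (i < k)%N by have := ltn_ord i; rewrite -val_eqE /= in im; lia.
  have -> : i = widen_ord (leqnSn k) (Ordinal ik) by apply/val_inj.
  by have /mnmP/(_ (Ordinal ik)) := ww; rewrite !mnmE.
have [mP|mP] := boolP (m \in msupp P).
  by rewrite (bigD1_seq m) ?msupp_uniq //= eqxx big1 ?addr0 // => m' /negPf->.
by rewrite memN_msupp_eq0.
Qed.

Lemma mmap_sum_polyX (k : nat) (S T : comNzRingType) (f : {rmorphism S -> T})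
    (h : 'I_k -> T) (r : seq (multinom k)) (c : multinom k -> S) :
  mmap f h (\sum_(m <- r) c m *: mpolyX S m) = \sum_(m <- r) f (c m) * mmap1 h m.
Proof. by rewrite rmorph_sum; apply: eq_bigr => m _ /=; rewrite mmapZ mmapX. Qed.

Lemma pfun_sum (F : fieldType) (A : finType) (I : Type) (r : seq I) (G : I -> F -> (A -> F) -> F) :
  (forall i, pfun (G i)) -> pfun (fun x y => \sum_(i <- r) G i x y).
Proof.
move=> GP; elim: r => [|i r IH].
  rewrite (_ : (fun x y => _) = (fun x _ => (0 : {poly F}).[x])); first exact: pfun_poly.
  by apply/funext => x; apply/funext => y; rewrite big_nil horner0.
rewrite (_ : (fun x y => _) = (fun x y => G i x y + \sum_(i <- r) G i x y)).
  exact: pfun_add.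
by apply/funext => x; apply/funext => y; rewrite big_cons.
Qed.

Lemma pfun_prod (F : fieldType) (A : finType) (I : Type) (r : seq I) (G : I -> F -> (A -> F) -> F) :
  (forall i, pfun (G i)) -> pfun (fun x y => \prod_(i <- r) G i x y).
Proof.
move=> GP; elim: r => [|i r IH].
  rewrite (_ : (fun x y => _) = (fun x _ => (1%:P : {poly F}).[x])); first exact: pfun_poly.
  by apply/funext => x; apply/funext => y; rewrite big_nil hornerC.
rewrite (_ : (fun x y => _) = (fun x y => G i x y * \prod_(i <- r) G i x y)).
  exact: pfun_mul.
by apply/funext => x; apply/funext => y; rewrite big_cons.
Qed.

(** The dilation s allows evaluation at the points rho^j x while the coordinates remain those of
    x. *)
Lemma pfun_mmap (F : fieldType) (A : finType) (k : nat) (P : mpoly k {poly F}) (s : F)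
    (g : 'I_k -> A) :
  pfun (fun x (y : A -> F) => mmap (horner_eval (s * x)) (fun i => y (g i)) P).
Proof.
apply: pfun_sum => m; apply: (@pfun_mul _ _ (fun x _ => (mcoeff m P).[s * x])).
  rewrite (_ : (fun x _ => _) = (fun x _ => (mcoeff m P \Po (s *: 'X)).[x])).
    exact: pfun_poly.
  by apply/funext => x; apply/funext => y; rewrite horner_comp hornerZ hornerX.
apply: pfun_prod => i.
have -> : (fun (_ : F) (y : A -> F) => y (g i) ^+ m i) =
    (fun _ y => \prod_(j < m i) y (g i)).
  by apply/funext => x; apply/funext => y; rewrite prodr_const card_ord.
by apply: pfun_prod => j; apply: pfun_coord.
Qed.

Lemma mpoly0E (S : nzRingType) (P : mpoly 0 S) : P = mpolyC 0 (mcoeff mnm0 P).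
Proof.
apply/mpolyP => m; rewrite mcoeffC.
have -> : m = mnm0 by apply/mnmP => -[].
by rewrite eqxx mulr1.
Qed.

(** Polynomials in z^(1/N) as Puiseux series, written as a composite of morphisms so that [mmap]
    accepts it. *)
Definition pz (F : fieldType) (N : nat) : {rmorphism {poly F} -> puiseux F} :=
  horner_eval (zroot F N) \o map_poly (@pconst F).

Lemma pzE (F : fieldType) N (p : {poly F}) : pz F N p = (map_poly (@pconst F) p).[zroot F N].
Proof. by []. Qed.

Lemma pz_inj (F : fieldType) N : (0 < N)%N -> injective (pz F N).
Proof.
move=> N0; apply: raddf_inj => p p0; apply/polyP => m; rewrite coef0.
have Nn : N%:R != 0 :> rat by rewrite pnatr_eq0 -lt0n.
have : pz F N p (m%:R / N%:R) = 0 by rewrite p0.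
have pcoef_sum (I : Type) (r : seq I) (f : I -> puiseux F) e :
    (\sum_(i <- r) f i) e = \sum_(i <- r) f i e.
  by elim/big_rec2: _ => // i y x _ <-.
rewrite pzE horner_coef pcoef_sum size_map_poly.
have e (i : nat) : ((map_poly (@pconst F) p)`_i * zroot F N ^+ i) (m%:R / N%:R) =
    if i == m then p`_m else 0.
  rewrite coef_map zrootX pmonoM add0r mulr1 /= (inj_eq (mulIf (invr_neq0 Nn))) eqr_nat.
  by rewrite eq_sym; case: eqP => // ->.
under eq_bigr do rewrite e.
have [mp|mp] := ltnP m (size p); last by rewrite (nth_default _ mp).
rewrite (bigD1 (Ordinal mp)) //= eqxx big1 ?addr0 // => i.
by rewrite -val_eqE /= => /negPf->.
Qed.

Variable R : realType.
Local Notation C := R[i].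

Lemma germ_mmap N k (f : 'I_k -> puiseux C) (g : 'I_k -> C -> C) (P : mpoly k {poly C}) :
  (0 < N)%N -> (forall i, germ N (f i) (g i)) ->
  germ N (mmap (pz C N) f P) (fun w => mmap (horner_eval w) (fun i => g i w) P).
Proof.
move=> N0 fg; apply: germ_sum => // m; apply: germM => //.
  by rewrite pzE; apply: germ_poly.
by apply: germ_prod => // i; apply: germX.
Qed.

Lemma tends_mmap k (P : mpoly k {poly C}) (w : C -> C) w0 (g : 'I_k -> C -> C) g0 :
  tends w w0 -> (forall i, tends (g i) (g0 i)) ->
  tends (fun t => mmap (horner_eval (w t)) (fun i => g i t) P) (mmap (horner_eval w0) g0 P).
Proof.
move=> ww gg; apply: tends_sum => m; apply: tendsM; first exact: tends_horner.
by apply: tends_prod => i; apply: tendsX.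
Qed.

End Multivariate.

(** * The induction on the number of translates *)

Section Transcendence.
Variable R : realType.
Local Notation C := R[i].
Variables (q Q lambda : C) (n : nat) (al be : {poly C}) (c : nat -> C)
  (phi : C -> C) (res : nat -> C).
Hypotheses (q_gt0 : 0 < cmod q) (q_lt1 : cmod q < 1) (lambda0 : lambda != 0)
  (Q0 : Q != 0) (qQ : forall l m : int, q ^ l * Q ^ m = 1 -> l = 0 /\ m = 0)
  (ab0 : al`_0 = be`_0) (be0 : be`_0 != 0).
Local Notation hc := (hcoef lambda al be).
Hypotheses (hcoefn : forall m l : int, m != 0 -> hc n (Q ^ m * q ^ l / lambda) != 0)
  (phi_germ : exists s k, germ_data c s k phi)
  (phi_eqn : forall z, lambda * z != 1 -> \sum_(l < n.+1) hc l z * phi (q ^+ l * z) = 0)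
  (phi_cont : forall Z z0, tends Z z0 -> (forall K, lambda * z0 * q ^+ K != 1) ->
      tends (fun t => phi (Z t)) (phi z0))
  (phi_polar : forall K Z, tends Z (q ^- K / lambda) ->
      near0 (fun t => lambda * q ^+ K * Z t != 1) ->
      tends (fun t => (1 - lambda * q ^+ K * Z t) * phi (Z t)) (res K))
  (res_neq0 : forall K, exists2 j, (j < n)%N & res (K + j)%N != 0).

Definition scaled_series (i : nat) : puiseux C := pseries (fun m => Q ^+ i ^+ m * c m).

Let q0 : q != 0. Proof. by rewrite -cmod_gt0. Qed.

Lemma germ_scaled N i : (0 < N)%N ->
  germ N (scaled_series i) (fun w => phi (Q ^+ i * w ^+ N)).
Proof.
move=> N0; have [s [k [s0 cs gs]]] := phi_germ.
have Qi : 0 < cmod (Q ^+ i) by rewrite cmod_gt0 expf_neq0.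
apply: (@germ_series _ _ N0 _ (s * cmod (Q ^+ i)) k (fun z => phi (Q ^+ i * z))).
split; first by rewrite mulr_gt0.
  move=> m; rewrite cmodM [cmod (_ ^+ m)]cmodX exprMn mulrA [leRHS]mulrC.
  by rewrite ler_wpM2l ?exprn_ge0 ?cmod_ge0.
move=> w M sw; have := gs (Q ^+ i * w) M; rewrite cmodM mulrA => /(_ sw).
by under eq_bigr do rewrite exprMn mulrCA mulrA.
Qed.

Let Qq_neq1 (m l : int) : m != 0 -> Q ^ m * q ^ l != 1.
Proof. by move=> m0; apply: contraNneq m0; rewrite mulrC => /qQ[_ ->]. Qed.

(** [hcoef] at z = d x^N as a polynomial in x, the form required by [spiral_pfun]. *)
Definition hpol (l N : nat) (d : C) : {poly C} := (lambda * d * al`_l) *: 'X^N - (be`_l)%:P.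

Lemma hpolE l N d x : (hpol l N d).[x] = hc l (d * x ^+ N).
Proof. by rewrite /hpol !hornerE /hcoef /=; ring. Qed.

Section Step.
Variables (N k : nat) (rho omega : C).
Hypotheses (N0 : (0 < N)%N) (rhoN : rho ^+ N = q) (omegaN : omega ^+ N = Q ^- k / lambda).

Let rho0 : rho != 0.
Proof. by apply: contraNneq q0 => r0; rewrite -rhoN r0 expr0n gtn_eqF. Qed.
Let omega0 : omega != 0.
Proof.
have : Q ^- k / lambda != 0 by rewrite mulf_neq0 ?invr_eq0 // expf_neq0.
by rewrite -omegaN expf_eq0 N0.
Qed.
Let rho_lt1 : cmod rho < 1.
Proof.
rewrite ltNge; apply/negP => r1; move: q_lt1; rewrite -rhoN cmodX ltNge.
by rewrite exprn_ege1.
Qed.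
Let rho_gt0 : 0 < cmod rho. Proof. by rewrite cmod_gt0. Qed.

Let rhoNz (K : int) : (rho ^ K) ^+ N = q ^ K.
Proof. by rewrite -[_ ^+ N]/(_ ^ N%:Z) exprzAC -[rho ^ N]/(rho ^+ N) rhoN. Qed.

(* The coordinates (i, j) stand for phi(Q^i q^j z), with z = x^N. *)
Definition coords (k' : nat) (x : C) (a : 'I_k' * 'I_n) : C :=
  phi (Q ^+ a.1 * (q ^+ a.2 * x ^+ N)).

Let n0 : (0 < n)%N.
Proof. by have [j jn _] := res_neq0 0; apply: leq_ltn_trans jn. Qed.

Let sum_pair k' (i : 'I_k') (f : 'I_n -> {poly C}) x (y : 'I_k' * 'I_n -> C) :
  lincomb (fun a => if a.1 == i then f a.2 else 0) x y = \sum_j (f j).[x] * y (i, j).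
Proof.
rewrite /lincomb (eq_bigr (fun a => (if a.1 == i then f a.2 else 0).[x] * y (a.1, a.2))).
  2: by case.
rewrite -(pair_bigA _ (fun i' j => (if i' == i then f j else 0).[x] * y (i', j))) /=.
rewrite (bigD1 i) //= [X in _ + X]big1 ?addr0; last first.
  by move=> i' /negPf->; apply: big1 => j _; rewrite horner0 mul0r.
by apply: eq_bigr => j _; rewrite eqxx.
Qed.

(** Outward motion, from z to z/q: only the coordinate j = 0 is new, and the equation gives it after
    division by [hcoef] 0. Every other coordinate j is the old j - 1. *)
Lemma spiral_up k' G (x : int -> C) (Kmax : int) :
  pfun G -> (forall K, x (K + 1) = rho^-1 * x K) ->
  (forall K i, K <= Kmax -> (i < k')%N -> lambda * (Q ^+ i * x K ^+ N) != 1) ->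
  forall K0, (forall K, K <= K0 -> G (x K) (coords (k' := k') (x K)) = 0) ->
  G (x Kmax) (coords (k' := k') (x Kmax)) = 0.
Proof.
move=> pG xS x1 K0 GK0.
pose h (a : 'I_k' * 'I_n) := if val a.2 == 0%N then hpol 0 N (Q ^+ a.1 / q) else 1%:P.
pose row (i : 'I_k') (j l : 'I_n) : {poly C} :=
  if val j == 0%N then - hpol l.+1 N (Q ^+ i / q) else ((l.+1 == j)%N%:R)%:P.
pose B (a b : 'I_k' * 'I_n) := if b.1 == a.1 then row a.1 a.2 b.2 else 0.
have xq K i : Q ^+ i / q * x K ^+ N = Q ^+ i * x (K + 1) ^+ N.
  by rewrite xS exprMn exprVn rhoN mulrA.
have lz K (i : 'I_k') : K < Kmax -> lambda * (Q ^+ i * x (K + 1) ^+ N) != 1.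
  by move=> KK; apply: x1 => //; rewrite lezD1.
apply: (@spiral_pfun _ _ x (fun K => coords (k' := k') (x K)) rho^-1 h B Kmax G _ _ _ _ K0) => //.
- move=> K [i j] KK; rewrite /h /=; case: ifP => _; last by rewrite hornerC oner_neq0.
  rewrite hpolE xq hcoef0 // mulf_neq0 // subr_eq0; exact: lz.
- move=> K [i j] KK; rewrite (sum_pair i (row i j)) /h /row /=.
  case: (eqVneq (val j) 0%N) => [j0|j0].
    have e := phi_eqn (lz K i KK); rewrite big_ord_recl expr0 mul1r in e.
    rewrite hpolE xq /coords /= j0 expr0 mul1r; apply/eqP; rewrite -subr_eq0; apply/eqP.
    rewrite -[RHS]e; congr (_ + _); rewrite -sumrN; apply: eq_bigr => l _.
    rewrite hornerN hpolE xq lift0 mulNr opprK; congr (_ * phi _).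
    by rewrite xS exprMn exprVn rhoN exprS; field.
  have jj : (j.-1 < n)%N by apply: leq_ltn_trans (leq_pred j) (ltn_ord j).
  rewrite hornerC mul1r (bigD1 (Ordinal jj)) //= prednK ?lt0n // eqxx hornerC mul1r.
  rewrite big1 ?addr0 => [|l]; last first.
    rewrite -val_eqE /= => lj; have -> : (l.+1 == j)%N = false by apply: contraNF lj => /eqP <-.
    by rewrite hornerC mul0r.
  rewrite /coords /=; congr (phi (_ * _)); rewrite xS exprMn exprVn rhoN.
  by rewrite -[in LHS](prednK (n := j)) ?lt0n // exprS; field.
Qed.

(** Motion towards 0, from z to q z: only the coordinate j = n - 1 is new, and the equation gives it
    after division by [hcoef] n. *)
Lemma spiral_down k' G (x : int -> C) (Kmax : int) :
  pfun G -> (forall K, x (K + 1) = rho * x K) ->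
  (forall K i, (i < k')%N -> lambda * (Q ^+ i * x K ^+ N) != 1) ->
  (forall K i, (i < k')%N -> hc n (Q ^+ i * x K ^+ N) != 0) ->
  forall K0, (forall K, K <= K0 -> G (x K) (coords (k' := k') (x K)) = 0) ->
  G (x Kmax) (coords (k' := k') (x Kmax)) = 0.
Proof.
move=> pG xS x1 xn K0 GK0.
pose h (a : 'I_k' * 'I_n) := if val a.2 == n.-1 then hpol n N (Q ^+ a.1) else 1%:P.
pose row (i : 'I_k') (j l : 'I_n) : {poly C} :=
  if val j == n.-1 then - hpol l N (Q ^+ i) else ((val l == j.+1)%N%:R)%:P.
pose B (a b : 'I_k' * 'I_n) := if b.1 == a.1 then row a.1 a.2 b.2 else 0.
apply: (@spiral_pfun _ _ x (fun K => coords (k' := k') (x K)) rho h B Kmax G _ _ _ _ K0) => //.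
- move=> K [i j] _; rewrite /h /=; case: ifP => _; last by rewrite hornerC oner_neq0.
  by rewrite hpolE xn.
- move=> K [i j] _; rewrite (sum_pair i (row i j)) /h /row /=.
  case: (eqVneq (val j) n.-1) => [j0|j0].
    have e := phi_eqn (x1 K i (ltn_ord i)); rewrite big_ord_recr /= in e.
    rewrite hpolE /coords /= j0 xS exprMn rhoN.
    rewrite (_ : Q ^+ i * (q ^+ n.-1 * _) = q ^+ n * (Q ^+ i * x K ^+ N)); last first.
      have -> : q ^+ n = q ^+ n.-1 * q by rewrite -exprSr prednK.
      ring.
    apply/eqP; rewrite -subr_eq0; apply/eqP.
    rewrite -[RHS]e addrC; congr (_ + _); rewrite -sumrN; apply: eq_bigr => l _.
    by rewrite hornerN hpolE mulNr opprK mulrCA.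
  have jj : (j.+1 < n)%N.
    rewrite ltn_neqAle ltn_ord andbT; apply: contraNneq j0 => e.
    by apply/eqP; rewrite /= -[LHS]/(j.+1.-1) e.
  rewrite hornerC mul1r (bigD1 (Ordinal jj)) //= eqxx hornerC mul1r.
  rewrite big1 ?addr0 => [|l]; last first.
    by rewrite -val_eqE /= => /negPf->; rewrite hornerC mul0r.
  by rewrite /coords /= xS exprMn rhoN exprSr -!mulrA.
Qed.

(** A point above z_K (1 + t)^N, where z_K = Q^(-k) q^(-K) / lambda. The parameter t moves the whole
    spiral by one common factor, so the recursion along it is kept while the poles are avoided. *)
Definition wpt (K : int) (t : C) : C := omega * (1 + t) * rho ^ (- K).

Let wpt_step K t : wpt (K + 1) t = rho^-1 * wpt K t.
Proof. by rewrite /wpt opprD expfzDr // exprN1 mulrCA mulrC mulrCA; ring. Qed.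

Let Qz i : Q ^+ i * Q ^- k = Q ^ (i%:Z - k%:Z).
Proof. by rewrite expfzDr // -exprnN. Qed.

Let exprzD_nat (x : C) (i j : nat) : x ^ (i%:Z + j%:Z) = x ^+ i * x ^+ j.
Proof. by rewrite -PoszD -[LHS]/(x ^+ (i + j)) exprD. Qed.

Let wptN i K t :
  lambda * (Q ^+ i * wpt K t ^+ N) = Q ^ (i%:Z - k%:Z) * q ^ (- K) * (1 + t) ^+ N.
Proof. by rewrite -Qz /wpt !exprMn omegaN rhoNz; field; rewrite lambda0 expf_neq0. Qed.

Let tends_1t : tends (fun t => 1 + t) (1 : C).
Proof. by rewrite -[X in tends _ X]addr0; apply: tendsD; [exact: tends_cst|exact: tends_id]. Qed.

Let tends_wpt K : tends (wpt K) (wpt K 0).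
Proof.
rewrite /wpt addr0; apply: tendsM; last exact: tends_cst.
by apply: tendsM; [exact: tends_cst|exact: tends_1t].
Qed.

Let near0_pow : near0 (fun t : C => (1 + t) ^+ N != 1).
Proof.
have T : tends (fun t => \sum_(i < N) (1 + t) ^+ i) (\sum_(i < N) (1 : C) ^+ i).
  by apply: tends_sum => i; apply: tendsX.
have nz : \sum_(i < N) (1 : C) ^+ i != 0.
  under eq_bigr do rewrite expr1n.
  by rewrite sumr_const card_ord pnatr_eq0 -lt0n.
have [d d0 H] := tends_neq T nz; exists d => // t t0 td.
by rewrite -subr_eq0 subrX1 addrAC subrr add0r mulf_neq0 ?H.
Qed.

(** For K' near -oo the left side has modulus below 1. Finitely many pairs remain, and each is
    avoided for small t, either by continuity or, when its limit is 1, because (1 + t)^N != 1. *)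
Lemma near_generic (K : int) : near0 (fun t => forall K' i, K' <= K -> (i < k.+1)%N ->
  lambda * (Q ^+ i * wpt K' t ^+ N) != 1).
Proof.
pose v (i : 'I_k.+1) : C := Q ^ (i%:Z - k%:Z).
have [J HJ] : exists J, forall i, cmod (v i) * 2 ^+ N * cmod q ^+ J < 1.
  have [J HJ] := expM_small ((\sum_i cmod (v i)) * 2 ^+ N) (ltW q_gt0) q_lt1 ltr01.
  exists J => i; apply: le_lt_trans HJ; rewrite ler_wpM2r ?exprn_ge0 ?(ltW q_gt0) //.
  rewrite ler_wpM2r ?exprn_ge0 // (bigD1 i) //= lerDl sumr_ge0 // => j _.
  exact: cmod_ge0.
have H1 : near0 (fun t : C => cmod t < 1) by exists 1.
have H2 : near0 (fun t : C => forall a : 'I_k.+1 * 'I_(`|K| + J).+1,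
    v a.1 * q ^ (a.2%:Z - K) * (1 + t) ^+ N != 1).
  apply: near0_all => -[i m] /=; set u := v i * _.
  have [u1|u1] := eqVneq u 1.
    by apply: near0_imp near0_pow => t; rewrite u1 mul1r.
  apply: (@tends_neq _ _ u) u1; rewrite -[X in tends _ X]mulr1.
  apply: tendsM; first exact: tends_cst.
  by rewrite -[X in tends _ X](expr1n _ N); apply: tendsX.
apply: near0_imp (near0_and H1 H2) => t [t1 {}H2] K' i KK ik; rewrite wptN.
have [Kl|Kl] := leP K' (- J%:Z).
  apply: contraTneq t1 => e; rewrite -leNgt; have := HJ (Ordinal ik).
  have h1 : cmod (1 + t) <= 2 -> 1 <= cmod (v (Ordinal ik)) * 2 ^+ N * cmod q ^+ J.
    move=> h2; have h3 : cmod (v (Ordinal ik) * q ^ (- K') * (1 + t) ^+ N) = 1.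
      by rewrite e cmod1.
    have a1 : cmod ((1 + t) ^+ N) <= 2 ^+ N by rewrite cmodX lerXn2r ?nnegrE ?cmod_ge0.
    have a2 : cmod (q ^ (- K')) <= cmod q ^+ J.
      have [j ->] : exists j : nat, - K' = J%:Z + j%:Z.
        by exists `|- K' - J%:Z|%N; clear -Kl; lia.
      rewrite exprzD_nat cmodM !cmodX.
      by rewrite ler_piMr ?exprn_ge0 ?cmod_ge0 // exprn_ile1 ?cmod_ge0 // ltW.
    have a3 := ler_wpM2l (cmod_ge0 (v (Ordinal ik))) a1.
    rewrite -[leLHS]h3 !cmodM mulrAC.
    exact: (ler_pM (mulr_ge0 (cmod_ge0 _) (cmod_ge0 _)) (cmod_ge0 _) a3 a2).
  rewrite ltNge; apply: contraR; rewrite -ltNge => t1; apply: h1.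
  by apply: le_trans (cmodD _ _) _; rewrite cmod1; lra.
have mK : (`|K - K'| < (`|K| + J).+1)%N by clear -Kl KK; lia.
have := H2 (Ordinal ik, Ordinal mK); rewrite /=.
by have -> : `|K - K'|%N%:Z - K = - K' by clear -KK; lia.
Qed.

Lemma wpt_small t e : 0 < e -> exists K0, forall K, K <= K0 -> cmod (wpt K t) < e.
Proof.
move=> e0; have [M HM] := expM_small (cmod (omega * (1 + t))) (ltW rho_gt0) rho_lt1 e0.
exists (- M%:Z) => K KM; apply: le_lt_trans HM; rewrite /wpt cmodM ler_wpM2l ?cmod_ge0 //.
have [j ->] : exists j : nat, - K = M%:Z + j%:Z.
  by exists `|- K - M%:Z|%N; clear -KM; lia.
rewrite exprzD_nat cmodM !cmodX.
by rewrite ler_piMr ?exprn_ge0 ?cmod_ge0 // exprn_ile1 ?cmod_ge0 // ltW.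
Qed.

Definition num_eval (k' : nat) (P : mpoly k' {poly C}) (w : C) : C :=
  mmap (horner_eval w) (fun i : 'I_k' => phi (Q ^+ i * w ^+ N)) P.

(** The relation holds near 0, that is, for K near -oo on the spiral of each small t, and
    [spiral_up] carries it outward to K. *)
Lemma relation_generic (P : mpoly k.+1 {poly C}) :
  (exists2 e, 0 < e & forall w, cmod w < e -> num_eval P w = 0) ->
  forall K, near0 (fun t => num_eval P (wpt K t) = 0).
Proof.
move=> [e e0 He] K; apply: near0_imp (near_generic K) => t gen.
pose G (x : C) (y : 'I_k.+1 * 'I_n -> C) :=
  mmap (horner_eval (1 * x)) (fun i => y (i, Ordinal n0)) P.
have pG : pfun G by exact: (pfun_mmap P 1 (fun i => (i, Ordinal n0))).
have GE w : G w (coords w) = num_eval P w.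
  rewrite /G /num_eval mul1r; congr (mmap _ _ P); apply/funext => i.
  by rewrite /coords /= expr0 mul1r.
have [K0 HK0] := wpt_small t e0.
rewrite -GE; apply: (@spiral_up k.+1 G (fun K => wpt K t) K pG _ _ K0) => //.
by move=> K' KK; rewrite GE He // HK0.
Qed.

Let Qk_wpt (K : nat) t : Q ^+ k * wpt K t ^+ N = q ^- K / lambda * (1 + t) ^+ N.
Proof.
apply: (mulfI lambda0); rewrite wptN subrr expr0z mul1r -exprnN.
by rewrite mulrA [lambda * _]mulrC divfK.
Qed.

(** With T(t) = 1 - (1 + t)^N, the product T phi(Q^k z) tends to R_K, while the phi(Q^i z) with i <
    k are continuous at z_K. The relation times T^d tends to F_d R_K^d. *)
Lemma lead_coef_vanishes (P : mpoly k.+1 {poly C}) (K : nat) :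
  near0 (fun t => num_eval P (wpt K t) = 0) -> res K != 0 ->
  num_eval (lead_coef (muni P)) (wpt K 0) = 0.
Proof.
move=> PK rK; pose F := muni P; pose d := (size F).-1.
pose mu t (A : mpoly k {poly C}) := num_eval A (wpt K t).
have muT A : tends (fun t => mu t A) (mu 0 A).
  apply: (tends_mmap A (tends_wpt K)) => i.
  have zT : tends (fun t => Q ^+ i * wpt K t ^+ N) (Q ^+ i * wpt K 0 ^+ N).
    by apply: tendsM; [exact: tends_cst|apply/tendsX/tends_wpt].
  apply: phi_cont zT _ => j; rewrite wptN addr0 expr1n mulr1.
  rewrite -mulrA -[q ^+ j]/(q ^ j%:Z) -expfzDr //; apply: Qq_neq1.
  by rewrite subr_eq0 eqz_nat neq_ltn ltn_ord.
pose T (t : C) : C := 1 - (1 + t) ^+ N.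
have TT : tends T 0.
  rewrite -[X in tends _ X](subrr (1 : C)) -[X in tends _ (_ - X)](expr1n _ N).
  by apply: tendsB; [exact: tends_cst|apply: tendsX].
have qK0 : q ^+ K != 0 by rewrite expf_neq0.
have lqE t : lambda * q ^+ K * (Q ^+ k * wpt K t ^+ N) = (1 + t) ^+ N.
  by rewrite Qk_wpt; field; rewrite lambda0 qK0.
have YT : tends (fun t => T t * phi (Q ^+ k * wpt K t ^+ N)) (res K).
  apply: (tends_ext _ (phi_polar (K := K) (Z := fun t => Q ^+ k * wpt K t ^+ N) _ _)).
  - by move=> t; rewrite lqE.
  - apply: (tends_ext (f := fun t => q ^- K / lambda * (1 + t) ^+ N)).
      by move=> t; rewrite Qk_wpt.
    rewrite -[X in tends _ X]mulr1; apply: tendsM; first exact: tends_cst.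
    by rewrite -[X in tends _ X](expr1n _ N); apply: tendsX.
  - by apply: near0_imp near0_pow => t; rewrite lqE.
pose S t := \sum_(j < d.+1) mu t F`_j * (T t * phi (Q ^+ k * wpt K t ^+ N)) ^+ j * T t ^+ (d - j).
have ST : tends S (\sum_(j < d.+1) mu 0 F`_j * res K ^+ j * 0 ^+ (d - j)).
  apply: tends_sum => j; apply: tendsM; last exact: tendsX.
  by apply: tendsM => //; apply: tendsX.
have S0 : near0 (fun t => 0 = S t).
  apply: near0_imp PK => t.
  rewrite /num_eval mmap_muni => /(congr1 (fun x => T t ^+ d * x)); rewrite mulr0.
  rewrite (@horner_coef_wide _ d.+1); last first.
    by apply: leq_trans (size_poly _ _) _; apply: leqSpred.
  move=> <-; rewrite mulr_sumr; apply: eq_bigr => j _; rewrite coef_map /=.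
  have jd : (j <= d)%N by rewrite -ltnS.
  have -> : T t ^+ d = T t ^+ j * T t ^+ (d - j) by rewrite -exprD subnKC.
  have gen (A B a Y : C) : A * B * (a * Y) = a * (A * Y) * B by ring.
  by rewrite [in RHS]exprMn; exact: gen.
have := tends_unique (tends_near S0 (tends_cst 0)) ST => /esym.
(* The power 0 ^+ (d - j) is 0 for j < d and 1 for j = d. *)
rewrite big_ord_recr /= subnn mulr1 big1 ?add0r => [/eqP|j _]; last first.
  by rewrite expr0n subn_eq0 leqNgt ltn_ord mulr0.
by rewrite mulf_eq0 expf_eq0 (negPf rK) andbF orbF => /eqP.
Qed.

(** The zeros of L are known only where R_K != 0, hence the product over n consecutive points. It
    vanishes far out, then everywhere by [spiral_down], and its zeros near 0 are zeros of L at
    nearby points. *)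
Lemma lead_coef_relation (P : mpoly k.+1 {poly C}) :
  mmap (pz C N) (fun i : 'I_k.+1 => scaled_series i) P = 0 ->
  mmap (pz C N) (fun i : 'I_k => scaled_series i) (lead_coef (muni P)) = 0.
Proof.
move=> P0; set L := lead_coef _.
have gP k' (A : mpoly k' {poly C}) :
    germ N (mmap (pz C N) (fun i : 'I_k' => scaled_series i) A) (num_eval A).
  by apply: germ_mmap => // i; apply: germ_scaled.
have zP := relation_generic (germ_eq0 N0 (gP _ P) P0).
have zL (K : nat) : res K != 0 -> num_eval L (wpt K 0) = 0.
  exact: lead_coef_vanishes (zP K).
pose x (m : int) : C := omega * rho ^ m.
(* Since (rho^j w)^N = q^j w^N, the j-th factor involves only the coordinates (i, j) of w. *)
pose G (w : C) (y : 'I_k * 'I_n -> C) :=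
  \prod_(j < n) mmap (horner_eval (rho ^+ j * w)) (fun i => y (i, j)) L.
have pG : pfun G by apply: pfun_prod => j; apply: pfun_mmap.
have GE w : G w (coords w) = \prod_(j < n) num_eval L (rho ^+ j * w).
  apply: eq_bigr => j _; congr (mmap _ _ L); apply/funext => i.
  by rewrite /coords /= exprMn -exprM mulnC exprM rhoN.
have xN i m : Q ^+ i * x m ^+ N = Q ^ (i%:Z - k%:Z) * q ^ m / lambda.
  by rewrite -Qz /x exprMn omegaN rhoNz; ring.
have Gx m : G (x m) (coords (x m)) = 0.
  apply: (@spiral_down k G x m pG _ _ _ (- n%:Z)) => [K|K i ik|K i ik|K Kn].
  - by rewrite /x expfzDr // expr1z; ring.
  - rewrite xN mulrC divfK //; apply: Qq_neq1.
    by rewrite subr_eq0 eqz_nat neq_ltn ik.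
  - by rewrite xN; apply: hcoefn; rewrite subr_eq0 eqz_nat neq_ltn ik.
  - have [K' KE nK'] : exists2 K' : nat, K = - K'%:Z & (n <= K')%N.
      by exists `|K|%N; clear -Kn; lia.
    (* One of the n indices from K' - n + 1 to K' has a nonzero polar coefficient; the factor number
       n - 1 - j is the value of L at that point. *)
    have [j jn rj] := res_neq0 (K' - n.-1); have jn' : (n.-1 - j < n)%N.
      by rewrite (leq_ltn_trans (leq_subr _ _)) // prednK.
    rewrite GE (bigD1 (Ordinal jn')) //= (_ : _ * x K = wpt (K' - n.-1 + j)%N 0).
      by rewrite zL // mul0r.
    rewrite /x /wpt KE addr0 mulr1 mulrCA; congr (_ * _).
    rewrite -[rho ^+ _]/(rho ^ (n.-1 - j)%N%:Z) -expfzDr //; congr (_ ^ _).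
    clear -nK' jn; lia.
apply: (germ_identity (gP _ L)) => e e0.
have [M HM] := expM_small (cmod omega) (ltW rho_gt0) rho_lt1 e0.
have /eqP := Gx M%:Z; rewrite GE => /prodf_eq0[j _ /eqP Lj].
exists (rho ^+ j * x M%:Z); split=> //.
  by rewrite mulf_neq0 ?expf_neq0 // /x mulf_neq0 // expfz_neq0.
apply: le_lt_trans HM; rewrite /x !cmodM -[rho ^ M]/(rho ^+ M) !cmodX.
by rewrite ler_piMl ?mulr_ge0 ?exprn_ge0 ?cmod_ge0 // exprn_ile1 ?cmod_ge0 // ltW.
Qed.

End Step.

(** Induction on k: the leading coefficient in the last variable is a relation between fewer
    translates, hence 0, and so is P. For k = 0 the embedding of polynomials in z^(1/N) is
    injective. *)
Lemma no_relation N k (P : mpoly k {poly C}) : (0 < N)%N ->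
  mmap (pz C N) (fun i : 'I_k => scaled_series i) P = 0 -> P = 0.
Proof.
move=> N0; elim: k P => [|k IH] P P0.
  move: P0; rewrite (mpoly0E P) mmapC => /eqP; rewrite raddf_eq0; last exact: pz_inj.
  by move=> /eqP->; rewrite mpolyC0.
have [rho rhoN] : exists rho : C, rho ^+ N = q by exists (N.-root q); rewrite rootCK.
have [omega omegaN] : exists omega : C, omega ^+ N = Q ^- k / lambda.
  by exists (N.-root (Q ^- k / lambda)); rewrite rootCK.
by apply/muni_eq0/eqP; rewrite -lead_coef_eq0; apply/eqP/IH;
  exact: (lead_coef_relation N0 rhoN omegaN P0).
Qed.

End Transcendence.

(** * Clearing denominators in relations over C(z^* ) *)

Section Descent.
Variable F : fieldType.

(** A fraction in z^(1/j) is also one in z^(1/N) for every multiple N of j; this freedom gives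
    finitely many coefficients a common root of z. *)
Lemma ratpuiseux_wide (f : puiseux F) : ratpuiseux f -> exists j, (0 < j)%N /\
  forall N, (j %| N)%N -> (0 < N)%N ->
  exists pd : {poly F} * {poly F}, pd.2 != 0 /\ f * pz F N pd.2 = pz F N pd.1.
Proof.
move=> [j [p [d [j0 d0 ->]]]]; exists j; split=> // N /dvdnP[l Nl] N0.
have l0 : (0 < l)%N by move: N0; rewrite Nl muln_gt0 => /andP[].
have zj : zroot F j = zroot F N ^+ l.
  rewrite zrootX Nl natrM /zroot; congr pmono.
  by field; rewrite !pnatr_eq0 -!lt0n l0 j0.
have pj (r : {poly F}) : (map_poly (@pconst F) r).[zroot F j] = pz F N (r \Po 'X^l).
  by rewrite pzE map_comp_poly map_polyXn horner_comp hornerXn zj.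
have d0' : d \Po 'X^l != 0 by rewrite comp_poly_eq0 // size_polyXn.
exists (p \Po 'X^l, d \Po 'X^l); split=> //=; rewrite !pj divfK //.
by rewrite raddf_eq0 //; apply: pz_inj.
Qed.

(** N is the product of the ramification indices and D that of the denominators. As D is not 0, no
    coefficient of P is lost. *)
Lemma clear_denominators k (P : mpoly k (puiseux F)) :
  (forall m, @ratpuiseux F (mcoeff m P)) ->
  exists N (D : puiseux F) (P' : mpoly k {poly F}), [/\ (0 < N)%N,
    forall x, mmap (pz F N) x P' = D * meval x P & P' = 0 -> P = 0].
Proof.
move=> rP; have [j jP] := boolp.choice (fun m => ratpuiseux_wide (rP m)).
pose N := (\prod_(m <- msupp P) j m)%N.
have N0 : (0 < N)%N by apply: prodn_gt0 => m; case: (jP m).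
have pd_ex m : exists pd : {poly F} * {poly F}, m \in msupp P ->
    pd.2 != 0 /\ mcoeff m P * pz F N pd.2 = pz F N pd.1.
  have [mP|_] := boolP (m \in msupp P); last by exists (0, 0).
  have jN : (j m %| N)%N by rewrite /N (bigD1_seq m) ?msupp_uniq //= dvdn_mulr.
  by have [_ /(_ N jN N0)[x xP]] := jP m; exists x.
have [pd pdP] := boolp.choice pd_ex.
pose e m := (pd m).1 * \prod_(m' <- msupp P | m' != m) (pd m').2.
pose D := pz F N (\prod_(m <- msupp P) (pd m).2).
have eD m : m \in msupp P -> pz F N (e m) = D * mcoeff m P.
  move=> mP; have [_ h] := pdP m mP.
  rewrite /e /D (bigD1_seq m) ?msupp_uniq // rmorphM -h.
  by rewrite -mulrA -rmorphM mulrC.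
pose P' : mpoly k {poly F} := \sum_(m <- msupp P) e m *: mpolyX _ m.
exists N, D, P'; split=> // [x|P'0].
  rewrite mmap_sum_polyX mevalE mulr_sumr !big_seq; apply: eq_bigr => m mP.
  by rewrite eD // mulrA.
apply/mpolyP => m; rewrite mcoeff0; have [mP|] := boolP (m \in msupp P); last first.
  exact: memN_msupp_eq0.
have : mcoeff m P' = 0 by rewrite P'0 mcoeff0.
rewrite /P' raddf_sum (bigD1_seq m) ?msupp_uniq //= mcoeffZ mcoeffX eqxx mulr1.
rewrite big1 ?addr0 => [em|m' m'm]; last first.
  by rewrite mcoeffZ mcoeffX (negPf m'm) mulr0.
have := eD m mP; rewrite em raddf0 => /esym/eqP; rewrite mulf_eq0 => /orP[|/eqP//].
rewrite raddf_eq0; last exact: pz_inj.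
rewrite big_seq_cond prodf_seq_eq0 => /hasP[m' _ /andP[]]; rewrite andbT => m'P.
by have [/negPf-> _] := pdP m' m'P.
Qed.

End Descent.

(** * Rational powers of q and torsion modulo powers of q *)

Section QTorsion.
Variable R : realType.
Local Notation C := R[i].

Lemma cexp0 : cexp 0 = 1 :> C.
Proof. by rewrite /cexp /= trigo.cos0 trigo.sin0 exp.expR0 mulr1 mulr0. Qed.

Lemma cexp_natM (x : C) d : cexp (d%:R * x) = cexp x ^+ d.
Proof.
elim: d => [|d IH].
  by rewrite mul0r expr0 cexp0.
by rewrite -addn1 natrD mulrDl mul1r cexpD IH exprD expr1.
Qed.

Lemma cexp_neq0 (x : C) : cexp x != 0.
Proof.
apply/eqP => x0; have /eqP : cexp (x - x) = 0 by rewrite cexpD x0 mul0r.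
by rewrite subrr cexp0 oner_eq0.
Qed.

Lemma cexp_intM (x : C) (p : int) : cexp (p%:~R * x) = cexp x ^ p.
Proof.
case: p => p; first exact: cexp_natM.
rewrite NegzE mulrNz mulNr -exprnN; apply: (mulfI (cexp_neq0 (p.+1%:~R * x))).
rewrite -cexpD subrr cexp0 -[p.+1%:~R]/(p.+1%:R).
by rewrite cexp_natM divff // expf_neq0 // cexp_neq0.
Qed.

(** The class of x modulo the powers of q is torsion. This holds on q^Q, is stable under products
    and inverses, and is tested without logarithms against multiplicative independence. *)
Definition qtorsion (q x : C) := exists (d : nat) (p : int), (0 < d)%N /\ x ^+ d = q ^ p.

Lemma qpow_rat_torsion (logq x : C) : qpow_rat logq x -> qtorsion (cexp logq) x.
Proof.
move=> [r _ <-]; exists `|denq r|%N, (numq r); split; first by rewrite absz_gt0.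
rewrite /qpow -cexp_natM -cexp_intM; congr cexp; rewrite mulrA; congr (_ * _).
have dC : (denq r)%:~R != 0 :> C by rewrite intr_eq0.
have -> : `|denq r|%:R = (denq r)%:~R :> C by rewrite -[in RHS](absz_denq r).
by rewrite /ratr mulrC divfK.
Qed.

Variable q : C.
Hypothesis q0 : q != 0.

Lemma qtorsion_neq0 x : qtorsion q x -> x != 0.
Proof.
move=> [d [p [d0 e]]]; apply: contraNneq (expfz_neq0 p q0) => x0.
by rewrite -e x0 expr0n gtn_eqF.
Qed.

Lemma qtorsionM x y : qtorsion q x -> qtorsion q y -> qtorsion q (x * y).
Proof.
move=> [d [p [d0 e]]] [d' [p' [d'0 e']]]; exists (d * d')%N, (p * d'%:Z + p' * d%:Z).
split; first by rewrite muln_gt0 d0.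
rewrite expfzDr // -!exprz_exp -e -e' -!exprnP exprMn -!exprM.
by rewrite [(d' * d)%N]mulnC.
Qed.

Lemma qtorsionV x : qtorsion q x -> qtorsion q x^-1.
Proof.
move=> [d [p [d0 e]]]; exists d, (- p); split=> //.
by rewrite exprVn e invr_expz.
Qed.

Lemma qtorsion_expz (p : int) : qtorsion q (q ^ p).
Proof. by exists 1%N, p; rewrite expr1. Qed.

Lemma qtorsion_prod (I : Type) (r : seq I) (f : I -> C) :
  (forall i, qtorsion q (f i)) -> qtorsion q (\prod_(i <- r) f i).
Proof.
move=> fq; elim/big_rec: _ => [|i x _]; last exact: qtorsionM.
by have := qtorsion_expz 0; rewrite expr0z.
Qed.

End QTorsion.

(** * Application to the hypergeometric series *)

Theorem corollary8p3 (R : realType) (q logq Q : R[i]) (Qr : nat -> R[i])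
    (n : nat) (a b : 'I_n -> R[i]) (lambda : R[i])
    (hq0 : 0 < `|q|) (hq1 : `|q| < 1) (hlogq : cexp logq = q)
    (hQ0 : Q != 0) (hQ1 : `|Q| != 1)
    (hqQ : forall l m : int, q ^ l * Q ^ m = 1 -> l = 0 /\ m = 0)
    (hQr : root_system Q Qr)
    (hn : (2 <= n)%N)
    (ha : forall i, qpow_rat logq (a i))
    (hb : forall j, qpow_rat logq (b j) /\ forall m : nat, b j <> q ^- m)
    (hb1 : forall j : 'I_n, nat_of_ord j = 0%N -> b j = q)
    (hlambda : lambda != 0)
    (hirr : op_irreducible q (hyper_op q a b lambda))
    (hkum : ~ q_kummer_induced q logq a b lambda) :
  sigma_transcendental Qr (hyper_series q a b lambda).
Proof.
pose c m := (\prod_(i < n) qpochhammer q (a i) m)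
  / (\prod_(j < n) qpochhammer q (b j) m) * lambda ^+ m.
have q0 : q != 0 by rewrite -normr_gt0.
have q_gt0 : 0 < cmod q by rewrite cmod_gt0.
have q_lt1 : cmod q < 1 by move: hq1; rewrite cmodE -[1]/(1%:C%C) ltcR.
have q1 k : q ^+ k.+1 != 1.
  apply/eqP => e; have h : cmod q ^+ k.+1 < 1 by rewrite exprn_ilt1 // ltW.
  by move: h; rewrite -cmodX e cmod1 ltxx.
have aT i : qtorsion q (a i) by rewrite -hlogq; apply: qpow_rat_torsion.
have bT j : qtorsion q (b j).
  by rewrite -hlogq; apply: qpow_rat_torsion; case: (hb j).
have a0 i : a i != 0 by apply: qtorsion_neq0 (aT i).
have b0 j : b j != 0 by apply: qtorsion_neq0 (bT j).
have bq0 j : b j / q != 0 by rewrite mulf_neq0 ?invr_eq0.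
pose al := charpoly a; pose be := charpoly (fun j => b j / q).
have n_gt0 : (0 < n)%N by apply: leq_trans hn.
have be1 : be.[1] = 0.
  rewrite horner_charpoly (bigD1 (Ordinal n_gt0)) //= hb1 // divff // mul1r subrr mul0r.
  by [].
have beE m : be.[q ^+ m.+1] = \prod_j (b j * q ^+ m - 1).
  rewrite horner_charpoly; apply: eq_bigr => j _; congr (_ - 1).
  by rewrite exprS mulrA divfK.
(* A zero would mean b_j = q^(-m) for some j. *)
have beq m : be.[q ^+ m.+1] != 0.
  rewrite beE; apply/prodf_neq0 => j _; rewrite subr_eq0; apply/eqP => e.
  have [_ /(_ m)] := hb j; apply; apply: (mulIf (expf_neq0 m q0)).
  by rewrite e mulVf // expf_neq0.
(* The symbols have factors c x - 1 and the q-Pochhammer symbols 1 - c x; the signs (-1)^n cancel in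
   the recurrence. *)
have sgnE (x : 'I_n -> R[i]) : \prod_i (x i - 1) = (-1) ^+ n * \prod_i (1 - x i).
  rewrite -[X in _ ^+ X](card_ord n) -prodr_const -big_split /=.
  by apply: eq_bigr => i _; rewrite mulN1r opprB.
have pochS (x : 'I_n -> R[i]) m : \prod_i qpochhammer q (x i) m.+1 =
    \prod_i qpochhammer q (x i) m * \prod_i (1 - x i * q ^+ m).
  by rewrite -big_split; apply: eq_bigr => i _; rewrite /qpochhammer big_ord_recr.
have c0 : c 0%N = 1.
  rewrite /c expr0 mulr1 !big1 ?divr1 // => i _; exact: big_ord0.
have crec m : be.[q ^+ m.+1] * c m.+1 = lambda * al.[q ^+ m] * c m.
  have h : \prod_j (1 - b j * q ^+ m) != 0.
    have := beq m; rewrite beE sgnE; apply: contraNneq => ->.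
    by rewrite mulr0.
  rewrite /al horner_charpoly beE !sgnE /c !pochS invfM exprS.
  move: (\prod_i (1 - b i * q ^+ m)) h => B h.
  move: (\prod_i qpochhammer q (b i) m)^-1 => Bm.
  move: (\prod_i qpochhammer _ _ _) (\prod_i (1 - _)) ((-1) ^+ n) (lambda ^+ m) => A A' s l.
  by field.
have alq m : al.[q ^+ m] != 0.
  have c00 : c 0%N != 0 by rewrite c0 oner_neq0.
  exact: (@irreducible_nonterminating _ q q0 n a b lambda hn hlambda a0 b0 hirr c m c00 be1 crec).
have ab0 : al`_0 = be`_0 by rewrite !coef0_charpoly.
have be0 : be`_0 != 0 by rewrite coef0_charpoly signr_eq0.
have sal : size al = n.+1 by apply: size_charpoly.
have sbe : size be = n.+1 by apply: size_charpoly.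
have no_poly (D : {poly R[i]}) : D`_0 != 0 -> al * D = (be * D) \Po (q *: 'X) -> False.
  by move=> D0; apply: (irreducible_no_poly q0 hn hlambda a0 b0 hirr q1 D0 be1).
have [phi [res [G E K P r]]] :=
  hyper_continuation q_gt0 q_lt1 hlambda sal sbe ab0 be0 be1 beq alq c0 crec no_poly.
(* A zero would express Q^m through the a_i, the b_j and powers of q; Q^m would be torsion modulo
   powers of q, against multiplicative independence. *)
have hcoefn (m l : int) : m != 0 -> hcoef lambda al be n (Q ^ m * q ^ l / lambda) != 0.
  have lz : lambda * (Q ^ m * q ^ l / lambda) = Q ^ m * q ^ l by rewrite mulrC divfK.
  move=> m0; rewrite /hcoef lz subr_eq0; apply/eqP => e.
  have [d [p [d0]]] : qtorsion q (Q ^ m).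
    have -> : Q ^ m = be`_n * (al`_n)^-1 * (q ^ l)^-1.
      rewrite -e !lead_coef_charpoly //; field.
      by rewrite expfz_neq0 // prodf_seq_neq0; apply/allP => i _; rewrite a0.
    rewrite !lead_coef_charpoly //; apply: qtorsionM => //; last first.
      by apply: qtorsionV => //; apply: qtorsion_expz.
    apply: qtorsionM => //; last by apply: qtorsionV => //; apply: qtorsion_prod.
    apply: qtorsion_prod => // j; apply: qtorsionM => //.
    by apply: qtorsionV => //; have := qtorsion_expz q 1; rewrite expr1z.
  rewrite -[_ ^+ d]/(_ ^ d%:Z) exprz_exp => h.
  have [|_ /eqP] := hqQ (- p) (m * d%:Z).
    by rewrite h -expfzDr // addNr expr0z.
  by rewrite mulf_eq0 (negPf m0) /= eqz_nat => /eqP d00; rewrite d00 in d0.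
have iterE i : iter i (psigma Qr) (hyper_series q a b lambda) = scaled_series Q c i.
  elim: i => [|i IH] /=.
    congr (pseries _); apply/funext => m.
    by rewrite expr0 expr1n mul1r.
  rewrite IH /scaled_series (psigma_series hQr); congr (pseries _); apply/funext => m.
  by rewrite mulrA -exprMn -exprS.
(* A relation over C(z^* ) becomes one whose coefficients are polynomials in z^(1/N), to which
   [no_relation] applies. *)
move=> k A rA; have [N [D [A' [N0 A'E A'0]]]] := clear_denominators rA.
move=> A0; apply/A'0/(no_relation q_gt0 q_lt1 hlambda hQ0 hqQ ab0 be0 hcoefn G E K P r N0).
rewrite (_ : (fun i : 'I_k => _) = fun i : 'I_k => iter i (psigma Qr) (hyper_series q a b lambda)).
  by rewrite A'E A0 mulr0.
by apply/funext => i; rewrite iterE.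
Qed.
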